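(* Let $d\in\mathbb{N}$ and $m\in\mathbb{N}$. Let $v_n\in\{b_n,x_n\}$ (Bernstein or Weyl numbers) and $u_n\in\{a_n,d_n\}$ (approximation or Kolmogorov numbers). (i) Let $(\sigma_k)_{k\in\mathbb{N}}$ be the non-increasing rearrangement of the sequence $(1/\omega_m(\boldsymbol{k}))_{\boldsymbol{k}\in\mathring{\mathbb{Z}}^d}$. Then, for all $n\in\mathbb{N}$, $$v_n\big(id:\mathring{S}^m_\infty W(\mathbb{T}^d)\to L_2(\mathbb{T}^d)\big)=\Bigg(\sum_{k=1}^n\sigma_k^{-2}\Bigg)^{-1/2}.$$ (ii) $$\lim_{n\to\infty}\frac{v_n\big(id:\mathring{S}^m_\infty W(\mathbb{T}^d)\to L_2(\mathbb{T}^d)\big)}{n^{-m-\frac12}(\ln n)^{m(d-1)}}=\sqrt{2m+1}\,\bigg(\frac{2^d}{(d-1)!}\bigg)^m .$$ (iii) For all $\varepsilon>0$ there exists some $n_0\in\mathbb{N}$ such that $$\bigg(\frac{2m}{2m+1}\bigg)^m\bigg(\frac{2^d}{(d-1)!}\bigg)^m-\varepsilon\ \le\ \frac{u_n\big(id:\mathring{S}^m_\infty W(\mathbb{T}^d)\to L_2(\mathbb{T}^d)\big)}{n^{-m}(\ln n)^{m(d-1)}}\ \le\ \bigg(\frac{2^d}{(d-1)!}\bigg)^m+\varepsilon$$ holds for all $n\ge n_0$.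
   Context: $\mathbb{T}^d$ is the $d$-dimensional torus ($[0,2\pi]^d$ with endpoints identified) with the probability measure $(2\pi)^{-d}d\boldsymbol{x}$, with respect to which $L_p$ norms are taken; $\hat f(\boldsymbol{k})=(2\pi)^{-d}\int_{\mathbb{T}^d}f(\boldsymbol{x})e^{-i\boldsymbol{k}\boldsymbol{x}}\,d\boldsymbol{x}$. $\mathring{\mathbb{Z}}^d:=\{\boldsymbol{k}\in\mathbb{Z}^d: k_j\ne0,\ j=1,\dots,d\}$ and $\omega_m(\boldsymbol{k}):=\prod_{j=1}^d|k_j|^m$ for $\boldsymbol{k}\in\mathring{\mathbb{Z}}^d$. The non-increasing rearrangement lists all the values $1/\omega_m(\boldsymbol{k})$, counted with multiplicity, in non-increasing order. Let $F_m(\boldsymbol{x})=2^d\sum_{\boldsymbol{k}\in\mathbb{N}^d}\prod_{j=1}^d k_j^{-m}\cos\big(k_jx_j-\frac{m\pi}{2}\big)$ (multidimensional Bernoulli kernel). $\mathring{S}^m_\infty W(\mathbb{T}^d)$ is the set of all $f\in L_\infty(\mathbb{T}^d)$ which can be represented as $f(\boldsymbol{x})=(F_m*\varphi)(\boldsymbol{x})=(2\pi)^{-d}\int_{\mathbb{T}^d}\varphi(\boldsymbol{y})F_m(\boldsymbol{x}-\boldsymbol{y})\,d\boldsymbol{y}$ with $\varphi\in L_\infty(\mathbb{T}^d)$. Here the representing function is $\varphi=D^{(m,\dots,m)}f$ (the distributional mixed derivative of order $m$ in each variable; equivalently, $\varphi$ is the representing function with $\hat\varphi(\boldsymbol{k})=0$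 for $\boldsymbol{k}\notin\mathring{\mathbb{Z}}^d$), and the norm is $\|f|\mathring{S}^m_\infty W(\mathbb{T}^d)\|:=\|\varphi|L_\infty(\mathbb{T}^d)\|=\|D^{(m,\dots,m)}f|L_\infty(\mathbb{T}^d)\|$. $id$ denotes the identity (embedding) operator. For a continuous linear operator $T:X\to Y$ between Banach spaces and $n\in\mathbb{N}$: approximation numbers $a_n(T)=\inf\{\|T-A\|: A\in\mathcal{L}(X,Y),\ \mathrm{rank}(A)<n\}$; Kolmogorov numbers $d_n(T)=\inf_{L_{n-1}}\sup_{\|x|X\|\le1}\inf_{y\in L_{n-1}}\|Tx-y|Y\|$, infimum over all $(n-1)$-dimensional subspaces $L_{n-1}$ of $Y$; Weyl numbers $x_n(T)=\sup\{a_n(TA): A\in\mathcal{L}(\ell_2,X),\ \|A\|\le1\}$; Bernstein numbers $b_n(T)=\sup_{L_n}\inf_{x\in L_n,\,0<\|x|X\|\le1}\|Tx|Y\|/\|x|X\|$, supremum over all $n$-dimensional subspaces $L_n$ of $X$. *)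

(* Defs.v *)
From HB Require Import structures.
From mathcomp Require Import all_boot all_order all_algebra.
From mathcomp Require Import generic_quotient ring_quotient complex.
From mathcomp Require Import all_classical all_reals all_analysis.
From mathcomp Require Import measurable_realfun ess_sup_inf.

Set Implicit Arguments.
Unset Strict Implicit.
Unset Printing Implicit Defensive.
Import Order.TTheory GRing.Theory Num.Theory.
Import numFieldNormedType.Exports.
Import ComplexField.Normc.

Local Open Scope classical_set_scope.
Local Open Scope ring_scope.
Local Open Scope complex_scope.
Local Open Scope quotient_scope.

Section ComplexFacts.
Context {R : realType}.
Implicit Types a x y : R[i].

Lemma ReZD a x y : complex.Re (a * x + y) =
  complex.Re a * complex.Re x - complex.Im a * complex.Im x + complex.Re y.
Proof. by case: a x y => [? ?] [? ?] [? ?]. Qed.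

Lemma ImZD a x y : complex.Im (a * x + y) =
  complex.Re a * complex.Im x + complex.Im a * complex.Re x + complex.Im y.
Proof. by case: a x y => [? ?] [? ?] [? ?]. Qed.

Lemma normcE x : normc x = Num.sqrt (complex.Re x ^+ 2 + complex.Im x ^+ 2).
Proof. by case: x. Qed.

Lemma normc_ge0 x : 0 <= normc x.
Proof. by rewrite normcE sqrtr_ge0. Qed.

Lemma normcZD_le a x y : normc (a * x + y) <= normc a * normc x + normc y.
Proof. by rewrite -normcM; exact: le_normcD. Qed.

End ComplexFacts.

Section MeasurableComplex.
Context d (T : measurableType d) (R : realType).

Definition cmeasurable : {pred T -> R[i]} := fun f =>
  `[< measurable_fun [set: T] (fun x => complex.Re (f x)) /\
      measurable_fun [set: T] (fun x => complex.Im (f x)) >].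

Lemma cmeasurable_submod_closed : submod_closed cmeasurable.
Proof.
split; first by apply/asboolP; split; exact: measurable_cst.
move=> a f g /asboolP[f1 f2] /asboolP[g1 g2]; apply/asboolP; split.
  under eq_fun do rewrite ReZD.
  by apply: measurable_funD => //; apply: measurable_funB;
     apply: measurable_funM.
under eq_fun do rewrite ImZD.
by apply: measurable_funD => //; apply: measurable_funD;
   apply: measurable_funM.
Qed.

HB.instance Definition _ :=
  GRing.isSubmodClosed.Build _ _ cmeasurable cmeasurable_submod_closed.

Record cmfun := CMFun {
  cmfun_fun :> T -> R[i] ;
  cmfunP : cmfun_fun \in cmeasurable }.
HB.instance Definition _ := [isSub for cmfun_fun].
HB.instance Definition _ := [Choice of cmfun by <:].
HB.instance Definition _ := [SubChoice_isSubLmodule of cmfun by <:].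

Lemma measurable_normc (f : cmfun) : measurable_fun [set: T] (fun x => normc (f x)).
Proof.
have /asboolP[f1 f2] := cmfunP f.
under eq_fun do rewrite normcE.
apply: (@measurableT_comp _ _ _ _ _ _ (@Num.sqrt R)).
  by apply: continuous_measurable_fun; exact: sqrt_continuous.
by apply: measurable_funD; exact: measurable_funX.
Qed.

End MeasurableComplex.

(* The space of all complex measurable functions modulo equality almost
   everywhere, of which L_p and SW below are linear subspaces. *)
Section L0.
Context d (T : measurableType d) (R : realType).
Variable mu : {measure set T -> \bar R}.

Definition ae_null : {pred cmfun T R} := fun f => `[< \forall x \ae mu, f x = 0 >].

Lemma ae_null_submod_closed : submod_closed ae_null.
Proof.
split; first by apply/asboolP; exact: nearW.
move=> a f g /asboolP f0 /asboolP g0; apply/asboolP.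
apply: filterS2 f0 g0 => x fx gx.
by rewrite /= [LHS](_ : _ = a * f x + g x)// fx gx mulr0 addr0.
Qed.

HB.instance Definition _ :=
  GRing.isSubmodClosed.Build _ _ ae_null ae_null_submod_closed.

Definition L0 : Type := Quotient.quot ae_null.
HB.instance Definition _ := Choice.on L0.
HB.instance Definition _ := EqQuotient.on L0.
HB.instance Definition _ := GRing.Zmodule.on L0.

Lemma L0_eqP (f g : cmfun T R) :
  reflect (\forall x \ae mu, f x = g x) (\pi_L0 f == \pi_L0 g).
Proof.
rewrite -[_ == _]/(f == g %[mod (Quotient.quot ae_null)]) -Quotient.idealrBE.
apply: (iffP (asboolP _)); apply: filterS => x.
  by move=> /eqP; rewrite [X in X == _](_ : _ = f x - g x)// subr_eq0 => /eqP.
by move=> fg; rewrite [LHS](_ : _ = f x - g x)// fg subrr.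
Qed.

Lemma repr_piL0 (f : cmfun T R) : \forall x \ae mu, repr (\pi_L0 f) x = f x.
Proof. by apply/L0_eqP; rewrite reprK. Qed.

Lemma L0_surj (f : L0) : exists h, f = \pi_L0 h.
Proof. by exists (repr f); rewrite reprK. Qed.

Definition L0_scale (a : R[i]) (f : L0) : L0 := \pi_L0 (a *: repr f).

Lemma L0_scale_pi a (f : cmfun T R) : L0_scale a (\pi_L0 f) = \pi_L0 (a *: f).
Proof.
apply/eqP/L0_eqP; apply: filterS (repr_piL0 f) => x fx.
by rewrite [LHS](_ : _ = a * repr (\pi_L0 f) x)// fx.
Qed.

Lemma L0_piD (f g : cmfun T R) : \pi_L0 f + \pi_L0 g = \pi_L0 (f + g).
Proof. exact/esym/Quotient.pi_add. Qed.

Lemma L0_scaleA a b (f : L0) : L0_scale a (L0_scale b f) = L0_scale (a * b) f.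
Proof. by have [h ->] := L0_surj f; rewrite !L0_scale_pi scalerA. Qed.
Lemma L0_scale1 : left_id 1 L0_scale.
Proof. by move=> f; have [h ->] := L0_surj f; rewrite L0_scale_pi scale1r. Qed.
Lemma L0_scaleDr : right_distributive L0_scale +%R.
Proof.
move=> a f g; have [h ->] := L0_surj f; have [k ->] := L0_surj g.
by rewrite !(L0_scale_pi, L0_piD) scalerDr.
Qed.
Lemma L0_scaleDl (f : L0) : {morph L0_scale^~ f : a b / a + b}.
Proof.
by move=> a b; have [h ->] := L0_surj f; rewrite !(L0_scale_pi, L0_piD) scalerDl.
Qed.
HB.instance Definition _ := GRing.Zmodule_isLmodule.Build R[i] L0
  L0_scaleA L0_scale1 L0_scaleDr L0_scaleDl.

Lemma L0_piZ a (f : cmfun T R) : a *: \pi_L0 f = \pi_L0 (a *: f).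
Proof. exact: L0_scale_pi. Qed.

Lemma L0_pi0 : \pi_L0 0 = 0.
Proof. by rewrite -[RHS]/(Quotient.zero ae_null) /Quotient.zero -lock. Qed.

Lemma repr_L0_ZD a (f g : L0) :
  \forall x \ae mu, repr (a *: f + g) x = a * repr f x + repr g x.
Proof.
have -> : a *: f + g = \pi_L0 (a *: repr f + repr g).
  by rewrite -L0_piD -L0_piZ !reprK.
exact: repr_piL0.
Qed.

Lemma repr_L0_0 : \forall x \ae mu, repr (0 : L0) x = 0.
Proof.
rewrite -L0_pi0; exact: repr_piL0.
Qed.

End L0.

Section Lp.
Context d (T : measurableType d) (R : realType).
Variable mu : {measure set T -> \bar R}.
Variable p : \bar R.

Definition Lp_norm (f : L0 mu) : \bar R :=
  ('N[mu]_p[(fun x => (normc (repr f x))%:E)])%E.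

Hypothesis p1 : (1 <= p)%E.

Lemma le_Lnorm_ae (f g : T -> R) :
  measurable_fun [set: T] f -> measurable_fun [set: T] g ->
  (forall x, 0 <= f x) -> (forall x, 0 <= g x) ->
  (\forall x \ae mu, f x <= g x) ->
  ('N[mu]_p[EFin \o f] <= 'N[mu]_p[EFin \o g])%E.
Proof.
move=> mf mg f0 g0 fg; move: p1; rewrite unlock; case: p => [r r1||]; last by [].
  have r0 : 0 <= r by rewrite -lee_fin (le_trans _ r1)// lee_fin ler01.
  have mpow (h : T -> R) : measurable_fun [set: T] h ->
      measurable_fun [set: T] (fun x => (`|(h x)%:E| `^ r)%E).
    move=> mh; apply: (measurableT_comp (measurable_poweR r)).
    by apply: measurableT_comp => //; exact/measurable_EFinP.
  apply: gt0_ler_poweR.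
  - by rewrite invr_ge0.
  - by rewrite in_itv/= leey integral_ge0// => x _; exact: poweR_ge0.
  - by rewrite in_itv/= leey integral_ge0// => x _; exact: poweR_ge0.
  apply: ae_ge0_le_integral => //.
  - by move=> x _; exact: poweR_ge0.
  - exact: mpow.
  - by move=> x _; exact: poweR_ge0.
  - exact: mpow.
  apply: filterS fg => x fgx _ /=.
  rewrite !ger0_norm// lee_fin.
  by apply: ge0_ler_powR => //; rewrite nnegrE.
move=> _; case: ifPn => // _; apply: le_ess_sup.
by apply: filterS fg => x fgx; rewrite /= lee_fin !ger0_norm.
Qed.

(* The proof of 1 <= p is an argument so that the predicate can carry the
   structure of a submodule. *)
Definition Lp_pred (_ : (1 <= p)%E) : {pred L0 mu} := fun f => (Lp_norm f < +oo)%E.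

Lemma normc_Lfun (f : L0 mu) :
  (f \in Lp_pred p1) = ((fun x => normc (repr f x)) \in Lfun mu p).
Proof.
apply/idP/idP => [fp|].
  by apply/andP; split; rewrite inE//=; exact: measurable_normc.
by move=> /andP[_]; rewrite inE.
Qed.

Lemma Lp_submod_closed : submod_closed (Lp_pred p1).
Proof.
split.
  rewrite normc_Lfun; apply/andP; split; rewrite inE/=.
    exact: measurable_normc.
  apply: le_lt_trans (finite_norm_cst0 mu p1); apply: le_Lnorm_ae => //.
  - exact: measurable_normc.
  - by move=> x; exact: normc_ge0.
  by apply: filterS (repr_L0_0 mu) => x /= ->; rewrite normc0.
move=> a f g; rewrite !normc_Lfun => fp gp.
have h : normc a *: (fun x => normc (repr f x)) + (fun x => normc (repr g x)) \in Lfun mu p.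
  by rewrite -[_ \in _]/(_ \in Lfun mu p) (LfunP (normc a *: Lfun_Sub p1 fp + Lfun_Sub p1 gp)).
apply/andP; split; rewrite inE/=; first exact: measurable_normc.
move: h => /andP[]; rewrite !inE/= => mh; apply: le_lt_trans.
apply: le_Lnorm_ae => //.
- exact: measurable_normc.
- by move=> x; exact: normc_ge0.
- by move=> x; rewrite addr_ge0 ?mulr_ge0 ?normc_ge0.
apply: filterS (repr_L0_ZD a f g) => x /= ->; exact: normcZD_le.
Qed.

HB.instance Definition _ :=
  GRing.isSubmodClosed.Build _ _ (Lp_pred p1) Lp_submod_closed.

Record Lp := MkLp { Lp_val :> L0 mu ; LpP : Lp_val \in Lp_pred p1 }.
HB.instance Definition _ := [isSub for Lp_val].
HB.instance Definition _ := [Choice of Lp by <:].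
HB.instance Definition _ := [SubChoice_isSubLmodule of Lp by <:].

Definition normLp (f : Lp) : R := fine (Lp_norm f).

End Lp.

Notation Linfty_pred mu := (@Lp_pred _ _ _ mu +oo%E (leey 1%E)).
Notation L2_pred mu := (@Lp_pred _ _ _ mu 2%:E (lee1n 2)).
Notation L2 mu := (@Lp _ _ _ mu 2%:E (lee1n 2)).

Section ComplexIntegral.
Context d (T : measurableType d) (R : realType).
Variable mu : {measure set T -> \bar R}.
Implicit Types g h : T -> R[i].

Definition cintegrable g : Prop :=
  mu.-integrable [set: T] (fun x => (complex.Re (g x))%:E) /\
  mu.-integrable [set: T] (fun x => (complex.Im (g x))%:E).

Definition cintegral g : R[i] :=
  (\int[mu]_x complex.Re (g x)) +i* (\int[mu]_x complex.Im (g x)).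

Lemma cintegrable0 : cintegrable (fun=> 0).
Proof. by split; exact: integrable0. Qed.

Lemma cintegral0 : cintegral (fun=> 0) = 0.
Proof. by rewrite /cintegral /= /Rintegral integral0. Qed.

Lemma cintegrableZD a g h : cintegrable g -> cintegrable h ->
  cintegrable (fun x => a * g x + h x).
Proof.
move=> [g1 g2] [h1 h2]; split.
  under eq_fun do rewrite ReZD EFinD EFinB !EFinM.
  by apply: integrableD => //; apply: integrableB => //; exact: integrableZl.
under eq_fun do rewrite ImZD !EFinD !EFinM.
by apply: integrableD => //; apply: integrableD => //; exact: integrableZl.
Qed.

Lemma cintegralZD a g h : cintegrable g -> cintegrable h ->
  cintegral (fun x => a * g x + h x) = a * cintegral g + cintegral h.
Proof.
move=> [g1 g2] [h1 h2].
have iZ (b : R) k : mu.-integrable [set: T] (fun x => (k x)%:E) ->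
    mu.-integrable [set: T] (EFin \o (fun x => b * k x)).
  by move=> ik; rewrite /comp; under eq_fun do rewrite EFinM; exact: integrableZl.
apply/eqP; rewrite eq_complex ReZD ImZD /=; apply/andP; split; apply/eqP.
  under eq_Rintegral do rewrite ReZD.
  rewrite RintegralD// ?RintegralB ?RintegralZl//; try exact: iZ.
  rewrite /comp; under eq_fun do rewrite EFinB.
  by apply: integrableB => //; exact: iZ.
under eq_Rintegral do rewrite ImZD.
rewrite RintegralD// ?RintegralD ?RintegralZl//; try exact: iZ.
rewrite /comp; under eq_fun do rewrite EFinD.
by apply: integrableD => //; exact: iZ.
Qed.

(* f(x) = \int k(x, y) phi(y) dmu(y) for almost every x, the integral being
   absolutely convergent. *)
Definition is_integral_transform (k : T -> T -> R[i]) (phi : cmfun T R)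
    (f : L0 mu) : Prop :=
  \forall x \ae mu, cintegrable (fun y => phi y * k x y) /\
    repr f x = cintegral (fun y => phi y * k x y).

Lemma is_integral_transform0 k : is_integral_transform k 0 0.
Proof.
apply: filterS (repr_L0_0 mu) => x ->.
under eq_fun do rewrite [X in X * _](_ : _ = 0)// mul0r.
by rewrite cintegral0; split => //; exact: cintegrable0.
Qed.

Lemma is_integral_transformZD k a (phi psi : cmfun T R) (f g : L0 mu) :
  is_integral_transform k phi f -> is_integral_transform k psi g ->
  is_integral_transform k (a *: phi + psi) (a *: f + g).
Proof.
move=> hf hg.
apply: filterS3 hf hg (repr_L0_ZD a f g) => x [i1 e1] [i2 e2] ->.
have -> : (fun y => (a *: phi + psi) y * k x y) =
    fun y => a * (phi y * k x y) + psi y * k x y.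
  apply/funext => y.
  by rewrite [X in X * _](_ : _ = a * phi y + psi y)// mulrDl mulrA.
by rewrite cintegralZD// e1 e2; split => //; exact: cintegrableZD.
Qed.

End ComplexIntegral.

Section Torus.
Context {R : realType}.

Lemma twopi_gt0 : 0 < 2 * pi :> R.
Proof. by rewrite mulr_gt0// pi_gt0. Qed.

Definition cons_pair d (x : measurableTypeR R * d.-tuple (measurableTypeR R)) :
  d.+1.-tuple (measurableTypeR R) := [tuple of x.1 :: x.2].

Lemma measurable_cons_pair d : measurable_fun [set: _] (@cons_pair d).
Proof. exact: measurable_cons. Qed.
HB.instance Definition _ d :=
  isMeasurableFun.Build _ _ _ _ (@cons_pair d) (@measurable_cons_pair d).

(* The measure (2 pi)^-d dx on the cube [0, 2 pi]^d, as a probability on R^d.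
   A function on the torus is represented by a function on R^d modulo equality
   almost everywhere for this measure, so values off the cube are irrelevant. *)
Fixpoint torus d : probability (d.-tuple (measurableTypeR R)) R :=
  match d with
  | 0 => \d_ [tuple]
  | d'.+1 => distribution (uniform_prob twopi_gt0 \x torus d')%E (@cons_pair d')
  end.

Lemma torus_box d (A : 'I_d -> set (measurableTypeR R)) :
  (forall j, measurable (A j)) ->
  torus d [set x | forall j, A j (tnth x j)] =
    (\prod_(j < d) uniform_prob twopi_gt0 (A j))%E.
Proof.
elim: d A => [|d IH] A mA.
  rewrite big_ord0 /= diracE mem_set//; by case.
rewrite big_ord_recl -(IH (fun j => A (lift ord0 j)))// -product_measure1E//.
  rewrite /= /distribution /pushforward; congr (_ _).
  apply/seteqP; split => [[a x] /= h|[a x] [/= ha hx] j].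
    split; first exact: (h ord0).
    by move=> j; have := h (lift ord0 j); rewrite /cons_pair tnthS.
  rewrite /cons_pair/=; case: (unliftP ord0 j) => [k ->|->//].
  by rewrite tnthS; exact: hx.
rewrite [X in measurable X](_ : _ = \bigcap_(j in [set: 'I_d])
    ((fun x => tnth x j) @^-1` A (lift ord0 j))).
  apply: fin_bigcap_measurable => // j _.
  by rewrite -[X in measurable X]setTI; exact: measurable_tnth.
by apply/seteqP; split => x h j; [move=> _; exact: h|exact: (h j I)].
Qed.

End Torus.

Section SpaceSW.
Context {R : realType} (d m : nat).
Local Notation mu := (torus d : {measure set _ -> \bar R}).
Local Notation T := (d.-tuple (measurableTypeR R)).

(* The series over N^d is summed over the cubes {1,..,N}^d, N --> oo: for m = 1
   it is not absolutely convergent. *)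
Definition bernoulli_kernel (t : 'I_d -> R) : R :=
  2 ^+ d * limn (fun N => \sum_(k : d.-tuple 'I_N) \prod_(j < d)
    (((tnth k j).+1%:R ^- m) *
     cos ((tnth k j).+1%:R * t j - m%:R * pi / 2))).

Definition is_conv (phi : cmfun T R) (f : L0 mu) : Prop :=
  is_integral_transform
    (fun x y : T => (bernoulli_kernel (fun j => (tnth x j : R) - (tnth y j : R)))%:C) phi f.

Definition nonzero_freq : set (d.-tuple int) :=
  [set k | forall j, tnth k j != 0].

Definition fourier_coef (f : T -> R[i]) (k : d.-tuple int) : R[i] :=
  cintegral mu (fun x =>
    let t := \sum_(j < d) (tnth k j)%:~R * (tnth x j : R) in
    f x * (cos t -i* sin t)).

Definition essentially_bounded (phi : cmfun T R) : Prop :=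
  \pi_(L0 mu) phi \in Linfty_pred mu.

Definition SW_pred : {pred L0 mu} := fun f =>
  (f \in Linfty_pred mu) &&
  `[< exists2 phi : cmfun T R, essentially_bounded phi & is_conv phi f >].

Lemma SW_submod_closed : submod_closed SW_pred.
Proof.
split.
  apply/andP; split; first exact: rpred0.
  apply/asboolP; exists 0.
    by rewrite /essentially_bounded L0_pi0 rpred0.
  exact: is_integral_transform0.
move=> a f g /andP[fb /asboolP[phi phib fphi]] /andP[gb /asboolP[psi psib gpsi]].
apply/andP; split; first by rewrite rpredD ?rpredZ.
apply/asboolP; exists (a *: phi + psi).
  by rewrite /essentially_bounded -L0_piD -L0_piZ rpredD ?rpredZ.
exact: is_integral_transformZD.
Qed.

HB.instance Definition _ :=
  GRing.isSubmodClosed.Build _ _ SW_pred SW_submod_closed.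

Record SW := MkSW { SW_val :> L0 mu ; SWP : SW_val \in SW_pred }.
HB.instance Definition _ := [isSub for SW_val].
HB.instance Definition _ := [Choice of SW by <:].
HB.instance Definition _ := [SubChoice_isSubLmodule of SW by <:].

(* D^(m,..,m) f: the representing function phi of f with
   \hat\phi(k) = 0 unless all k_j != 0 (unique up to a null set). *)
Definition mixed_derivative (f : SW) : cmfun T R :=
  xget 0 [set phi : cmfun T R | [/\ essentially_bounded phi,
    is_conv phi (SW_val f) &
    forall k, ~ nonzero_freq k -> fourier_coef phi k = 0]].

Definition normSW (f : SW) : R :=
  fine (Lp_norm +oo%E (\pi_(L0 mu) (mixed_derivative f))).

Definition norm_L2 : L2 mu -> R := @normLp _ _ _ mu _ _.

Lemma SW_sub_L2 (f : SW) : (f : L0 mu) \in L2_pred mu.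
Proof.
have /andP[fb _] := SWP f; move: fb; rewrite !normc_Lfun.
apply: Lfun_subset; [exact: lee1n|exact: leey| |exact: leey].
exact: fin_num_measure.
Qed.

Definition SW_id (f : SW) : L2 mu := MkLp (SW_sub_L2 f).

Lemma SW_id_linear : linear SW_id.
Proof. by move=> a f g; apply: val_inj. Qed.
HB.instance Definition _ :=
  GRing.isLinear.Build R[i] SW (L2 mu) _ SW_id SW_id_linear.

End SpaceSW.

Section Subspaces.
Context {K : fieldType} {V : lmodType K}.

Definition lin_indep k (e : 'I_k -> V) : Prop :=
  forall c : 'I_k -> K, \sum_i c i *: e i = 0 -> forall i, c i = 0.

Definition lin_span k (e : 'I_k -> V) : set V :=
  [set v | exists c : 'I_k -> K, v = \sum_i c i *: e i].

Definition has_dim (L : set V) (k : nat) : Prop :=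
  exists2 e : 'I_k -> V, lin_indep e & L = lin_span e.

End Subspaces.

(* The norms of X and Y are explicit arguments: X and Y carry only their linear
   structure, and SW has a norm different from that of its ambient space. *)
Section SNumbers.
Context {R : realType} {X Y : lmodType R[i]} (nX : X -> R) (nY : Y -> R).

Definition bounded_op (A : X -> Y) : Prop :=
  exists c : R, forall x, nY (A x) <= c * nX x.

Definition opnorm (A : X -> Y) : \bar R :=
  ereal_sup [set (nY (A x))%:E | x in [set x | nX x <= 1]].

Definition rank_lt (A : X -> Y) (n : nat) : Prop :=
  exists2 k, (k < n)%N & has_dim (range A) k.

Definition approximation_number (T : {linear X -> Y}) (n : nat) : \bar R :=
  ereal_inf [set opnorm (fun x => T x - A x) | A in
    [set A : {linear X -> Y} | bounded_op A /\ rank_lt A n]].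

Definition kolmogorov_number (T : {linear X -> Y}) (n : nat) : \bar R :=
  ereal_inf [set
    ereal_sup [set
      ereal_inf [set (nY (T x - y))%:E | y in L]
    | x in [set x | nX x <= 1]]
  | L in [set L : set Y | has_dim L n.-1]].

Definition bernstein_number (T : {linear X -> Y}) (n : nat) : \bar R :=
  ereal_sup [set
    ereal_inf [set (nY (T x) / nX x)%:E | x in
      [set x | L x /\ 0 < nX x <= 1]]
  | L in [set L : set X | has_dim L n]].

End SNumbers.

Section WeylNumbers.
Context {R : realType}.

(* The space of square-summable sequences: L_2 of the counting measure on nat,
   for which only the empty set is negligible. *)
Definition ell2 : lmodType R[i] := L2 (@counting nat R).

Definition norm_ell2 : ell2 -> R := @normLp _ _ _ (@counting nat R) _ _.

Definition weyl_number {X Y : lmodType R[i]} (nX : X -> R) (nY : Y -> R)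
    (T : {linear X -> Y}) (n : nat) : \bar R :=
  ereal_sup [set approximation_number norm_ell2 nY (T \o A) n | A in
    [set A : {linear ell2 -> X} |
      bounded_op norm_ell2 nX A /\ (opnorm norm_ell2 nX A <= 1)%E]].

End WeylNumbers.

Definition omega {R : realType} {d : nat} (m : nat) (k : d.-tuple int) : R :=
  \prod_(j < d) `|(tnth k j)%:~R| ^+ m.

(* sigma is indexed from 1; its value at 0 is irrelevant. *)
Definition nonincreasing_rearrangement {R : realType} (d m : nat)
    (sigma : nat -> R) : Prop :=
  (forall i j, (0 < i)%N -> (i <= j)%N -> sigma j <= sigma i) /\
  exists e : nat -> d.-tuple int,
    set_bij [set i | (0 < i)%N] (nonzero_freq (d := d)) e /\
    forall i, (0 < i)%N -> sigma i = (omega m (e i))^-1.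

(* Main.v *)
Require Import Defs.
From HB Require Import structures.
From mathcomp Require Import all_boot all_order all_algebra.
From mathcomp Require Import generic_quotient complex.
From mathcomp Require Import all_classical all_reals all_analysis.
From mathcomp Require Import measurable_realfun ess_sup_inf spectral.
From mathcomp Require Import ring lra zify.
From mathcomp Require Import sesquilinear.
Import Defs.

(** The mixed derivative identifies the class with bounded functions [phi] on the torus,
    and on the Fourier side the embedding into [L_2] is the diagonal multiplier [lam],
    of modulus [1/omega_m]. Put the frequencies in the order in which the moduli
    decrease, [sigma_1 >= sigma_2 >= ...], and write [S_n] for the sum of the
    [sigma_k^-2] over [k <= n].

    The factor [S_n^(-1/2)] comes from two facts about the uniform norm. It is at most
    the [l_1] norm of the coefficients of a trigonometric polynomial; on the span of the
    first [n] characters Cauchy-Schwarz then bounds the embedding below by [S_n^(-1/2)],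
    which gives [bernstein_lower] and, composed with a diagonal operator, [weyl_lower].
    Conversely, a bounded operator from a Hilbert space into bounded functions is
    Hilbert-Schmidt into [L_2] with the same constant ([hilbert_schmidt_bound]). If its
    composition with the embedding has [n] orthonormal images, the squares of their
    coefficients are weights in [[0,1]] of total mass [n], and the sum of the
    [sigma_k^-2] with these weights is at least [S_n] ([orthonormal_family_bound]). This
    bounds the Bernstein numbers after orthonormalising a basis, and the Weyl numbers
    after a singular value decomposition of a finite section of the operator.

    Partial Fourier sums give the upper bound [sigma_n] for the approximation and
    Kolmogorov numbers. For the lower bound, a space of dimension [p] has to approximate
    the primitives of the first [N] characters; a matrix of rank [p] differs from the
    identity of size [N] by at least [N - p] in squared Frobenius norm, so that one of
    the errors is at least the square root of [(N - p) / S_N] ([averaging_exists]), and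
    [N] is then taken to be about [(2m+1)/(2m)] times [n].

    The asymptotics of [sigma_n] follow from counting the integer points of the
    hyperbolic cross of the [k] with [\prod_j |k_j| <= t]: there are about
    [2^d t (ln t)^(d-1) / (d-1)!] of them ([hcount_lower], [hcount_upper], by induction on
    the dimension), and inverting this relation gives [product_asymptotics]. The
    Stolz-Cesaro theorem transfers it to [S_n].

    The definition of the class involves the Bernoulli kernel pointwise and the mixed
    derivative by its Fourier coefficients, so that the diagonal picture has to be
    established first: the characters are complete ([annihilating_ae0]), frequencies with
    a zero coordinate can be removed without losing boundedness ([remove_frequencies]),
    and the convolution with the kernel multiplies the coefficients by [lam]
    ([fourier_convolution]). *)

Set Implicit Arguments.
Unset Strict Implicit.
Unset Printing Implicit Defensive.
Import Order.TTheory GRing.Theory Num.Theory.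
Import numFieldNormedType.Exports.
Import ComplexField.Normc.

Local Open Scope classical_set_scope.
Local Open Scope ring_scope.
Local Open Scope complex_scope.
Local Open Scope quotient_scope.
Local Notation "x ^*" := (conjc x) : ring_scope.

#[local] Arguments cintegral : simpl never.
#[local] Arguments normc : simpl never.

(** * Complex numbers, integrals and unimodular exponentials *)

Section ComplexNumbers.
Context {R : realType}.
Implicit Types (z w : R[i]) (t : R).

Lemma cReD z w : complex.Re (z + w) = complex.Re z + complex.Re w.
Proof. by case: z w => [? ?] [? ?]. Qed.
Lemma cImD z w : complex.Im (z + w) = complex.Im z + complex.Im w.
Proof. by case: z w => [? ?] [? ?]. Qed.
Lemma cReM z w : complex.Re (z * w) =
  complex.Re z * complex.Re w - complex.Im z * complex.Im w.
Proof. by case: z w => [? ?] [? ?]. Qed.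
Lemma cImM z w : complex.Im (z * w) =
  complex.Re z * complex.Im w + complex.Im z * complex.Re w.
Proof. by case: z w => [? ?] [? ?]. Qed.
Lemma cReB z w : complex.Re (z - w) = complex.Re z - complex.Re w.
Proof. by case: z w => [? ?] [? ?]. Qed.
Lemma cImB z w : complex.Im (z - w) = complex.Im z - complex.Im w.
Proof. by case: z w => [? ?] [? ?]. Qed.

Lemma complex_eqP z w :
  complex.Re z = complex.Re w -> complex.Im z = complex.Im w -> z = w.
Proof. by case: z w => [? ?] [? ?] /= -> ->. Qed.

Lemma normc2E z : normc z ^+ 2 = complex.Re z ^+ 2 + complex.Im z ^+ 2.
Proof. by rewrite Defs.normcE sqr_sqrtr// addr_ge0// sqr_ge0. Qed.

Lemma normc2_conj z : (normc z ^+ 2)%:C = z * z^*.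
Proof.
rewrite normc2E; case: z => a b; apply: complex_eqP => /=.
  by rewrite !expr2 mulrN opprK.
by rewrite mulrN mulrC addNr.
Qed.

Lemma ReJM z : complex.Re (z * z^*) = normc z ^+ 2.
Proof. by rewrite -normc2_conj. Qed.

Lemma normcJ z : normc z^* = normc z.
Proof. by rewrite !Defs.normcE; case: z => a b /=; rewrite sqrrN. Qed.

Lemma normcR t : normc t%:C = `|t|.
Proof. by rewrite Defs.normcE /= expr0n addr0 sqrtr_sqr. Qed.

Lemma normc_Re z : `|complex.Re z| <= normc z.
Proof.
by rewrite Defs.normcE -sqrtr_sqr ler_wsqrtr// lerDl sqr_ge0.
Qed.

Lemma normc_Im z : `|complex.Im z| <= normc z.
Proof.
by rewrite Defs.normcE -sqrtr_sqr ler_wsqrtr// lerDr sqr_ge0.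
Qed.

Lemma normc_le_ReIm z : normc z <= `|complex.Re z| + `|complex.Im z|.
Proof.
rewrite -(@ler_pXn2r _ 2)// ?nnegrE ?addr_ge0 ?normc_ge0//.
by rewrite normc2E sqrrD !real_normK ?num_real// lerD2r lerDl mulrn_wge0 ?mulr_ge0.
Qed.

Lemma normc_eq0 z : (normc z == 0) = (z == 0).
Proof.
apply/eqP/eqP => [|->]; first exact: eq0_normc.
by rewrite Defs.normcE /= expr0n addr0 sqrtr0.
Qed.

Lemma normc_sum (I : Type) (s : seq I) (P : pred I) (F : I -> R[i]) :
  normc (\sum_(i <- s | P i) F i) <= \sum_(i <- s | P i) normc (F i).
Proof.
elim/big_rec2: _ => [|i x y Pi H]; first by rewrite Defs.normcE /= expr0n addr0 sqrtr0.
by rewrite (le_trans (le_normcD _ _))// lerD2l.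
Qed.

Lemma Re_sum (I : Type) (s : seq I) (P : pred I) (F : I -> R[i]) :
  complex.Re (\sum_(i <- s | P i) F i) = \sum_(i <- s | P i) complex.Re (F i).
Proof. by elim/big_rec2: _ => //= i x y Pi <-; rewrite cReD. Qed.

Lemma conj_sum (I : Type) (s : seq I) (P : pred I) (F : I -> R[i]) :
  (\sum_(i <- s | P i) F i)^* = \sum_(i <- s | P i) (F i)^*.
Proof. exact: (raddf_sum (@conjc R)). Qed.

Lemma conjcM z w : (z * w)^* = z^* * w^*.
Proof. exact: (rmorphM (@conjc R)). Qed.
Lemma conjcB z w : (z - w)^* = z^* - w^*.
Proof. exact: (raddfB (@conjc R)). Qed.
Lemma conjcKK z : z^*^* = z. Proof. by case: z => a b /=; rewrite opprK. Qed.

Lemma normc_prod (I : Type) (s : seq I) (P : pred I) (F : I -> R[i]) :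
  normc (\prod_(i <- s | P i) F i) = \prod_(i <- s | P i) normc (F i).
Proof.
elim/big_rec2: _ => [|i x y Pi <-]; last by rewrite normcM.
by rewrite Defs.normcE /= expr1n expr0n addr0 sqrtr1.
Qed.

Lemma normcDsq z w : normc (z + w) ^+ 2 <= 2 * normc z ^+ 2 + 2 * normc w ^+ 2.
Proof.
rewrite !normc2E cReD cImD.
set a := complex.Re z; set b := complex.Re w.
set c := complex.Im z; set d := complex.Im w.
rewrite -subr_ge0 (_ : _ - _ = (a - b) ^+ 2 + (c - d) ^+ 2); last by ring.
by rewrite addr_ge0 ?sqr_ge0.
Qed.

Lemma normc_distC z w : normc (z - w) = normc (w - z).
Proof. by rewrite -opprB normcN. Qed.

Lemma normc_tri z w v : normc (z - v) <= normc (z - w) + normc (w - v).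
Proof. by rewrite -[z - v](subrKA w) le_normcD. Qed.

Definition cis t : R[i] := cos t +i* sin t.

Lemma cisD s t : cis (s + t) = cis s * cis t.
Proof.
by apply: complex_eqP => /=; rewrite ?cosD// sinD addrC.
Qed.

Lemma cis0 : cis 0 = 1.
Proof. by apply: complex_eqP; rewrite /= ?cos0 ?sin0. Qed.

Lemma cisN t : cis (- t) = (cis t)^*.
Proof. by rewrite /cis cosN sinN. Qed.

Lemma normc_cis t : normc (cis t) = 1.
Proof. by rewrite Defs.normcE /= cos2Dsin2 sqrtr1. Qed.

Lemma cis_conj t : cis t * (cis t)^* = 1.
Proof. by rewrite -normc2_conj normc_cis expr1n. Qed.

Lemma cis_sum (I : Type) (s : seq I) (P : pred I) (F : I -> R) :
  cis (\sum_(i <- s | P i) F i) = \prod_(i <- s | P i) cis (F i).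
Proof. by elim/big_rec2: _ => [|i x y Pi <-]; rewrite ?cis0// cisD. Qed.

End ComplexNumbers.

Section ComplexIntegration.
Context d (T : measurableType d) (R : realType).
Variable mu : probability T R.
Implicit Types f g : T -> R[i].

Definition cmeas f : Prop :=
  measurable_fun [set: T] (fun x => complex.Re (f x)) /\
  measurable_fun [set: T] (fun x => complex.Im (f x)).

Lemma cmeasP (f : cmfun T R) : cmeas f.
Proof. by have /asboolP := cmfunP f. Qed.

Definition mkcmfun f (mf : cmeas f) : cmfun T R := @CMFun _ T R f (asboolT mf).

Lemma cmeas_cst z : cmeas (fun=> z).
Proof. by split; exact: measurable_cst. Qed.

Lemma cmeasD f g : cmeas f -> cmeas g -> cmeas (fun x => f x + g x).
Proof.
move=> [f1 f2] [g1 g2]; split.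
  by under eq_fun do rewrite cReD; apply: measurable_funD.
by under eq_fun do rewrite cImD; apply: measurable_funD.
Qed.

Lemma cmeasM f g : cmeas f -> cmeas g -> cmeas (fun x => f x * g x).
Proof.
move=> [f1 f2] [g1 g2]; split.
  by under eq_fun do rewrite cReM; apply: measurable_funB; apply: measurable_funM.
by under eq_fun do rewrite cImM; apply: measurable_funD; apply: measurable_funM.
Qed.

Lemma cmeasB f g : cmeas f -> cmeas g -> cmeas (fun x => f x - g x).
Proof.
move=> [f1 f2] [g1 g2]; split.
  by under eq_fun do rewrite cReB; apply: measurable_funB.
by under eq_fun do rewrite cImB; apply: measurable_funB.
Qed.

Lemma cmeas_sum (I : Type) (s : seq I) (F : I -> T -> R[i]) :
  (forall i, cmeas (F i)) -> cmeas (fun x => \sum_(i <- s) F i x).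
Proof.
move=> mF; elim: s => [|i s IH].
  by under eq_fun do rewrite big_nil; exact: cmeas_cst.
by under eq_fun do rewrite big_cons; apply: cmeasD.
Qed.

Lemma cmeasJ f : cmeas f -> cmeas (fun x => (f x)^*).
Proof.
move=> [f1 f2]; split.
  by rewrite (_ : (fun x => complex.Re _) = fun x => complex.Re (f x));
    [|apply/funext => x; case: (f x)].
rewrite (_ : (fun x => complex.Im _) = fun x => - complex.Im (f x)).
  exact: measurableT_comp.
by apply/funext => x; case: (f x).
Qed.

Lemma cmeas_normc f : cmeas f -> measurable_fun [set: T] (fun x => normc (f x)).
Proof. by move=> mf; exact: (measurable_normc (mkcmfun mf)). Qed.

Lemma integrableR_le (h g : T -> R) : measurable_fun [set: T] h ->
  mu.-integrable [set: T] (EFin \o g) -> (forall x, `|h x| <= g x) ->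
  mu.-integrable [set: T] (EFin \o h).
Proof.
move=> mh ig hg; apply: le_integrable ig => //; first exact/measurable_EFinP.
by move=> x _ /=; rewrite lee_fin (le_trans (hg x))// ler_norm.
Qed.

Lemma integrableR_cst (c : R) : mu.-integrable [set: T] (EFin \o (fun=> c)).
Proof. by apply: finite_measure_integrable_cst. Qed.

Lemma integrableR_ae_le (h g : T -> R) : measurable_fun [set: T] h ->
  mu.-integrable [set: T] (EFin \o g) -> (\forall x \ae mu, `|h x| <= g x) ->
  mu.-integrable [set: T] (EFin \o h).
Proof.
move=> mh ig hg; apply/integrableP; split; first exact/measurable_EFinP.
have /integrableP[mg] := ig.
apply: le_lt_trans; apply: ae_ge0_le_integral => //.
- by apply: measurableT_comp => //; exact/measurable_EFinP.
- exact: measurableT_comp.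
- by apply: filterS hg => x hx _ /=; rewrite lee_fin (le_trans hx)// ler_norm.
Qed.

Lemma cintegrable_ae_le f (g : T -> R) : cmeas f ->
  mu.-integrable [set: T] (EFin \o g) -> (\forall x \ae mu, normc (f x) <= g x) ->
  cintegrable mu f.
Proof.
move=> [f1 f2] ig fg; split; apply: (integrableR_ae_le _ ig) => //.
  by apply: filterS fg => x; apply: le_trans; exact: normc_Re.
by apply: filterS fg => x; apply: le_trans; exact: normc_Im.
Qed.

Lemma cintegrable_bounded f (M : R) : cmeas f ->
  (\forall x \ae mu, normc (f x) <= M) -> cintegrable mu f.
Proof. by move=> mf fM; apply: cintegrable_ae_le mf (integrableR_cst M) _. Qed.

Lemma cintegrable_cst z : cintegrable mu (fun=> z).
Proof. by apply: (@cintegrable_bounded _ (normc z)) (cmeas_cst z) _; exact: nearW. Qed.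

Lemma cintegral_cst z : cintegral mu (fun=> z) = z.
Proof.
rewrite /cintegral !Rintegral_cst//= probability_setT/= !mulr1.
by case: z.
Qed.

Lemma cintegrableD f g : cintegrable mu f -> cintegrable mu g ->
  cintegrable mu (fun x => f x + g x).
Proof.
move=> fi gi; under eq_fun do rewrite -[f _]mul1r; exact: cintegrableZD.
Qed.

Lemma cintegralD f g : cintegrable mu f -> cintegrable mu g ->
  cintegral mu (fun x => f x + g x) = cintegral mu f + cintegral mu g.
Proof.
move=> fi gi; under eq_fun do rewrite -[f _]mul1r.
by rewrite cintegralZD// mul1r.
Qed.

Lemma cintegrableZ z f : cintegrable mu f -> cintegrable mu (fun x => z * f x).
Proof.
move=> fi; under eq_fun do rewrite -[_ * _]addr0.
by apply: cintegrableZD => //; exact: cintegrable_cst.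
Qed.

Lemma cintegralZ z f : cintegrable mu f ->
  cintegral mu (fun x => z * f x) = z * cintegral mu f.
Proof.
move=> fi; under eq_fun do rewrite -[_ * _]addr0.
by rewrite cintegralZD ?cintegral_cst ?addr0//; exact: cintegrable_cst.
Qed.

Lemma cintegrableB f g : cintegrable mu f -> cintegrable mu g ->
  cintegrable mu (fun x => f x - g x).
Proof.
move=> fi gi; under eq_fun do rewrite addrC -mulN1r; exact: cintegrableZD.
Qed.

Lemma cintegralB f g : cintegrable mu f -> cintegrable mu g ->
  cintegral mu (fun x => f x - g x) = cintegral mu f - cintegral mu g.
Proof.
move=> fi gi; under eq_fun do rewrite addrC -mulN1r.
by rewrite cintegralZD// mulN1r addrC.
Qed.

Lemma cintegrable_sum (I : Type) (s : seq I) (F : I -> T -> R[i]) :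
  (forall i, cintegrable mu (F i)) ->
  cintegrable mu (fun x => \sum_(i <- s) F i x).
Proof.
move=> iF; elim: s => [|i s IH].
  by under eq_fun do rewrite big_nil; exact: cintegrable_cst.
by under eq_fun do rewrite big_cons; apply: cintegrableD.
Qed.

Lemma cintegral_sum (I : Type) (s : seq I) (F : I -> T -> R[i]) :
  (forall i, cintegrable mu (F i)) ->
  cintegral mu (fun x => \sum_(i <- s) F i x) = \sum_(i <- s) cintegral mu (F i).
Proof.
move=> iF; elim: s => [|i s IH].
  by under eq_fun do rewrite big_nil; rewrite cintegral_cst big_nil.
under eq_fun do rewrite big_cons.
by rewrite cintegralD ?IH ?big_cons//; exact: cintegrable_sum.
Qed.

Lemma cintegral_ae f g : cmeas f -> cmeas g ->
  (\forall x \ae mu, f x = g x) -> cintegral mu f = cintegral mu g.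
Proof.
move=> [f1 f2] [g1 g2] fg; rewrite /cintegral /Rintegral.
congr ((fine _) +i* (fine _)); apply: ae_eq_integral => //;
  try exact/measurable_EFinP.
  by apply: filterS fg => x -> _.
by apply: filterS fg => x -> _.
Qed.

Lemma cintegrable_meas f : cintegrable mu f -> cmeas f.
Proof.
by move=> [/integrableP[f1 _] /integrableP[f2 _]]; split; exact/measurable_EFinP.
Qed.

Lemma integrable_normc f : cintegrable mu f ->
  mu.-integrable [set: T] (EFin \o (fun x => normc (f x))).
Proof.
move=> fi; have mf := cintegrable_meas fi; case: fi => f1 f2.
apply: (@integrableR_le _
  (fun x => `|complex.Re (f x)| + `|complex.Im (f x)|)).
- exact: cmeas_normc.
- apply: (@integrableD _ _ _ mu _ measurableT
    (EFin \o (fun x => `|complex.Re (f x)|)) (EFin \o (fun x => `|complex.Im (f x)|))).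
    exact: (integrable_norm f1).
  exact: (integrable_norm f2).
- by move=> x; rewrite ger0_norm ?normc_ge0// normc_le_ReIm.
Qed.

(** Rotating the integral onto the positive real axis reduces the bound to the
    monotonicity of the real integral. *)
Lemma normc_cintegral f : cintegrable mu f ->
  normc (cintegral mu f) <= \int[mu]_x normc (f x).
Proof.
move=> fi; set I := cintegral mu f.
have nf := integrable_normc fi.
have [I0|I0] := eqVneq I 0.
  by rewrite I0 normc0; apply: Rintegral_ge0 => x _; exact: normc_ge0.
have nI : 0 < normc I by rewrite lt_neqAle normc_ge0 eq_sym normc_eq0 I0.
pose u := I^* / (normc I)%:C.
have nu : normc u = 1.
  by rewrite normcM normcV normcJ normcR ger0_norm ?normc_ge0// divff ?gt_eqF.
have uI : u * I = (normc I)%:C.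
  rewrite /u mulrAC [I^* * I]mulrC -normc2_conj expr2 rmorphM/= mulfK//.
  by rewrite -[0]/(0%:C) (inj_eq (@complexI _)) gt_eqF.
have ui := cintegrableZ u fi.
rewrite -[normc I]/(complex.Re (normc I)%:C) -uI -cintegralZ//=.
apply: le_Rintegral => //; first by case: ui.
by move=> x _; rewrite (le_trans (ler_norm _))// (le_trans (normc_Re _))// normcM nu mul1r.
Qed.

Lemma Rintegral_cstT (c : R) : \int[mu]_x c = c.
Proof. rewrite Rintegral_cst//=. by rewrite (probability_setT mu) /= mulr1. Qed.

Lemma normc_cintegral_ae_le f (M : R) : 0 <= M -> cmeas f ->
  (\forall x \ae mu, normc (f x) <= M) -> normc (cintegral mu f) <= M.
Proof.
move=> M0 mf fM; have fi := cintegrable_bounded mf fM.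
apply: (le_trans (normc_cintegral fi)); rewrite -[leRHS]Rintegral_cstT.
rewrite -lee_fin !fineK.
- apply: ae_ge0_le_integral => //.
  + by move=> x _; rewrite lee_fin normc_ge0.
  + exact/measurable_EFinP/cmeas_normc.
  + by apply: filterS fM => x; rewrite lee_fin.
- exact: (integrable_fin_num measurableT (integrableR_cst M)).
- exact: (integrable_fin_num measurableT (integrable_normc fi)).
Qed.

Lemma bounded_cvg_cintegral (F : nat -> T -> R[i]) f (M : R) :
  (forall n, cmeas (F n)) -> cmeas f ->
  (\forall x \ae mu, forall n, normc (F n x) <= M) ->
  (\forall x \ae mu, normc (F n x - f x) @[n --> \oo] --> (0 : R)) ->
  normc (cintegral mu (F n) - cintegral mu f) @[n --> \oo] --> (0 : R).
Proof.
move=> mF mf FM Ff.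
have fM : \forall x \ae mu, normc (f x) <= M.
  apply: filterS2 FM Ff => x FMx Ffx.
  apply/ler_addgt0Pr => e e0.
  have := cvgr_lt _ Ffx e e0 => -[n _ /(_ n (leqnn n)) /= h].
  rewrite -[f x](subrKC (F n x)) (le_trans (le_normcD _ _))// lerD//.
  by rewrite normc_distC ltW.
have iF n : cintegrable mu (F n).
  apply: (cintegrable_bounded (M := M)) => //.
  by apply: filterS FM => x; exact.
have if_ := cintegrable_bounded mf fM.
have [|||||_ _ /=] := @dominated_convergence _ T R mu [set: T] measurableT
  (fun n x => (normc (F n x - f x))%:E) (fun=> 0%:E) (fun=> (M + M)%:E).
- by move=> n; exact/measurable_EFinP/cmeas_normc/cmeasB.
- exact: measurable_cst.
- apply: filterS Ff => x Ffx _; apply: cvg_EFin => //; exact: nearW.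
- exact: (integrableR_cst (M + M)).
- apply: filterS2 FM fM => x FMx fMx n _; rewrite lee_fin ger0_norm ?normc_ge0//.
  by rewrite (le_trans (le_normcD _ _))// normcN lerD.
rewrite integral0 => /fine_cvgP[_ h].
apply: (@squeeze_cvgr _ _ _ _ (cst 0) (fun n => \int[mu]_x normc (F n x - f x))).
- apply: nearW => n; apply/andP; split. by rewrite /cst; exact: normc_ge0.
  rewrite -cintegralB//.
  by apply: normc_cintegral; exact: cintegrableB.
- exact: cvg_cst.
- exact: h.
Qed.

(** Fatou's lemma, to be applied to differences of partial Fourier sums. *)
Lemma fatou_normc2 (F : nat -> T -> R[i]) f (M : R) :
  (forall n, cmeas (F n)) -> cmeas f ->
  (forall n, (\int[mu]_x (normc (F n x) ^+ 2)%:E <= M%:E)%E) ->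
  (forall x, normc (F n x - f x) @[n --> \oo] --> (0 : R)) ->
  (\int[mu]_x (normc (f x) ^+ 2)%:E <= M%:E)%E.
Proof.
move=> mF mf FM Ff.
have cn x : (normc (F n x))@[n --> \oo] --> normc (f x).
  apply/cvgrPdist_lt => e e0; near=> n.
  have hn : normc (F n x - f x) < e by near: n; apply: (cvgr_lt _ (Ff x)).
  rewrite ltr_norml; apply/andP; split.
    rewrite ltrNl opprB (le_lt_trans _ hn)// lerBlDr.
    by rewrite (le_trans _ (le_normcD _ _))// subrK.
  rewrite (le_lt_trans _ hn)// lerBlDr normc_distC.
  by rewrite (le_trans _ (le_normcD _ _))// subrK.
have h := @fatou _ T R mu [set: T] measurableT
   (fun n x => (normc (F n x) ^+ 2)%:E).
rewrite (_ : (fun x => (normc (f x) ^+ 2)%:E) =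
    fun x => limn_einf (fun n => (normc (F n x) ^+ 2)%:E)); last first.
  apply/funext => x.
  suff c : (fun n => (normc (F n x) ^+ 2)%:E) @ \oo --> (normc (f x) ^+ 2)%:E.
    by have [<- _] := cvg_limn_einf_sup c.
  apply: cvg_EFin; first exact: nearW.
  by rewrite /comp /=; under eq_fun do rewrite expr2; rewrite expr2; exact: cvgM.
apply: le_trans (h _ _) _.
- by move=> n; apply/measurable_EFinP; apply: measurable_funX; exact: cmeas_normc.
- by move=> n x _; rewrite lee_fin sqr_ge0.
- rewrite limn_einf_lim; apply: lime_le; first exact: is_cvg_einfs.
  apply: nearW => n; apply: le_trans (FM n).
  by apply: ereal_inf_lbound; exists n => /=.
Unshelve. all: by end_near. Qed.

End ComplexIntegration.

(** * The normalised measure of the torus and its characters *)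

Section TorusMeasure.
Context {R : realType}.
Local Notation RR := (measurableTypeR R).

Definition box d (A : 'I_d -> set RR) : set (d.-tuple RR) :=
  [set x | forall j, A j (tnth x j)].

Lemma measurable_box d (A : 'I_d -> set RR) :
  (forall j, measurable (A j)) -> measurable (box A).
Proof.
move=> mA; rewrite [X in measurable X](_ : _ = \bigcap_(j in [set: 'I_d])
    ((fun x => tnth x j) @^-1` A j)).
  apply: fin_bigcap_measurable => // j _.
  by rewrite -[X in measurable X]setTI; exact: measurable_tnth.
by apply/seteqP; split => x h j; [move=> _; exact: h|exact: (h j I)].
Qed.

(** Boxes are stable under intersection and generate the product sigma-algebra. *)
Lemma measure_box_unique d (m1 m2 : {finite_measure set (d.-tuple RR) -> \bar R}) :
  (forall A : 'I_d -> set RR, (forall j, measurable (A j)) ->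
    m1 (box A) = m2 (box A)) ->
  forall B, measurable B -> m1 B = m2 B.
Proof.
move=> m12 B mB.
pose G := [set box A | A in [set A : 'I_d -> set RR | forall j, measurable (A j)]].
have boxT : box (fun=> setT) = [set: d.-tuple RR].
  by apply/seteqP; split => x //= _ j.
apply: (measure_unique G (fun=> setT)) => //.
- apply/seteqP; split.
    apply: smallest_sub; first exact: smallest_sigma_algebra.
    move=> C hC.
    have [i [A mA <-{C hC}]] : exists i : 'I_d,
        preimage_set_system setT (fun x : d.-tuple RR => tnth x i) measurable C.
      elim/big_ind: _ hC => // [P Q hP hQ [/hP|/hQ]//|i _ hC]; by exists i.
    apply: sub_sigma_algebra; exists (fun j => if j == i then A else setT) => /=.
      by move=> j; case: ifP.
    rewrite setTI; apply/seteqP; split => x /=.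
      by move/(_ i); rewrite eqxx.
    by move=> Ax j; case: eqP => // ->.
  apply: smallest_sub; first exact: sigma_algebra_measurable.
  by move=> _ [A mA <-]; exact: measurable_box.
- move=> _ _ [A mA <-] [A' mA' <-]; exists (fun j => A j `&` A' j).
    by move=> j; exact: measurableI.
  apply/seteqP; split => x /=.
    by move=> h; split => j; have [] := h j.
  by move=> [h h'] j; split; [exact: h|exact: h'].
- by move=> _; exists (fun=> setT) => //; exact: measurableT.
- by rewrite bigcup_const.
- by move=> _ [A mA <-]; exact: m12.
- by move=> _; exact: (fin_num_fun_lty (@fin_num_measure _ _ _ m1)).
Qed.

Section FixDimension.
Variable d : nat.
Local Notation T := (d.-tuple RR).
Local Notation mu := (@torus R d).

Lemma torus_coord (j : 'I_d) (A : set RR) : measurable A ->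
  mu [set x | A (tnth x j)] = uniform_prob (@twopi_gt0 R) A.
Proof.
move=> mA; have := @torus_box R d (fun i => if i == j then A else setT).
rewrite (_ : [set x | _] = [set x | A (tnth x j)]); last first.
  apply/seteqP; split => x /=; first by move/(_ j); rewrite eqxx.
  by move=> Ax i; case: eqP => // ->.
move=> -> //; last by move=> i; case: ifP.
rewrite (bigD1 j)//= eqxx big1 ?mule1// => i /negPf ->.
exact: probability_setT.
Qed.

(** Resampling a coordinate makes one-dimensional integrals accessible without
    splitting the torus into a product. *)
Definition mix (j : 'I_d) (p : T * T) : T :=
  [tuple if i == j then tnth p.2 i else tnth p.1 i | i < d].

Lemma tnth_mix j p i :
  tnth (mix j p) i = if i == j then tnth p.2 i else tnth p.1 i.
Proof. by rewrite tnth_mktuple. Qed.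

Lemma measurable_mix j : measurable_fun [set: T * T] (mix j).
Proof.
apply/measurable_fun_tnthP => i.
rewrite (_ : _ \o _ = fun p : T * T => if i == j then tnth p.2 i else tnth p.1 i).
  by case: (i == j); apply: (measurableT_comp (measurable_tnth i)).
by apply/funext => p /=; rewrite tnth_mix.
Qed.
HB.instance Definition _ j := isMeasurableFun.Build _ _ _ _ (mix j) (measurable_mix j).

(** Both sides agree on boxes: the new coordinate is independent of the remaining
    ones and has the law of the old one. *)
Lemma torus_mix (j : 'I_d) (B : set T) : measurable B ->
  (mu \x mu)%E (mix j @^-1` B) = mu B.
Proof.
move=> mB; rewrite -[LHS]/(distribution (mu \x mu)%E (mix j) B).
apply: measure_box_unique mB => A mA /=.
rewrite /pushforward (_ : mix j @^-1` box A =
  box (fun i => if i == j then setT else A i) `*`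
  box (fun i => if i == j then A i else setT)); last first.
  apply/seteqP; split => [p /= h|p [/= h1 h2] i].
    by split => i /=; have := h i; rewrite tnth_mix; case: (i == j).
  by rewrite tnth_mix; have := h1 i; have := h2 i; case: (i == j).
have m1 i : measurable (if i == j then setT else A i) by case: ifP.
have m2 i : measurable (if i == j then A i else setT) by case: ifP.
rewrite product_measure1E//; try exact: measurable_box.
rewrite [X in (X * _)%E]torus_box// [X in (_ * X)%E]torus_box// [RHS]torus_box//.
rewrite -big_split; apply: eq_bigr => i _ /=.
by case: (i == j); rewrite (probability_setT (uniform_prob _)) ?mul1e ?mule1.
Qed.

End FixDimension.
End TorusMeasure.

Section CharacterIntegrals.
Context {R : realType}.
Local Notation RR := (measurableTypeR R).

Lemma continuous_cos_affine (a c : R) : continuous (fun t : R => cos (a * t + c)).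
Proof.
move=> t; apply: (@continuous_comp _ _ _ (fun t => a * t + c) cos).
  by apply: cvgD; [apply: cvgM; [exact: cvg_cst|exact: cvg_id]|exact: cvg_cst].
exact: continuous_cos.
Qed.

Lemma uniform_cos (a c : R) : a != 0 -> sin (a * (2 * pi) + c) = sin c ->
  (\int[uniform_prob (@twopi_gt0 R)]_t (cos (a * t + c))%:E = 0)%E.
Proof.
move=> a0 sc.
have mc : measurable_fun [set: RR] (fun t : RR => cos (a * t + c)).
  by apply: continuous_measurable_fun; exact: continuous_cos_affine.
have ic : (uniform_prob (@twopi_gt0 R)).-integrable [set: RR]
    (EFin \o (fun t => cos (a * t + c))).
  apply: (integrableR_le mc (integrableR_cst _ 1)) => t; exact: cos_max.
have H : (\int[uniform_prob (@twopi_gt0 R)]_t (1 + cos (a * t + c))%:E = 1)%E.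
  rewrite integral_uniform; first last.
  - by move=> t; rewrite lee_fin -lerBlDl sub0r cos_geN1.
  - by apply/measurable_EFinP; exact: measurable_funD.
  rewrite (@continuous_FTC2 _ _ (fun t => t + sin (a * t + c) / a)) ?twopi_gt0//.
  - rewrite mulr0 !add0r sc -EFinB. rewrite addrK subr0 -EFinM.
    by rewrite mulVf// gt_eqF// twopi_gt0.
  - apply: continuous_subspaceT => t; apply: cvgD; first exact: cvg_cst.
    exact: continuous_cos_affine.
  - have cF : continuous (fun t : R => t + sin (a * t + c) / a).
      move=> t; apply: cvgD; first exact: cvg_id.
      apply: cvgM; last exact: cvg_cst.
      apply: (@continuous_comp _ _ _ (fun t => a * t + c) sin).
        by apply: cvgD; [apply: cvgM; [exact: cvg_cst|exact: cvg_id]|exact: cvg_cst].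
      exact: continuous_sin.
    split.
    + by move=> t _.
    + exact/cvg_at_right_filter/cF.
    + exact/cvg_at_left_filter/cF.
  - move=> t _; rewrite derive1E derive_val.
    by rewrite /GRing.scale/= mulr1 addr0 mulr0 add0r mulrCA mulVf// mulr1.
have : (\int[uniform_prob (@twopi_gt0 R)]_t (1 + cos (a * t + c))%:E =
   1 + \int[uniform_prob (@twopi_gt0 R)]_t (cos (a * t + c))%:E)%E.
  under eq_integral do rewrite EFinD.
  rewrite integralD//; last exact: (integrableR_cst _ 1).
  rewrite integral_cst//. 
  by rewrite [X in (1 * X)%E]probability_setT mule1.
rewrite H => /eqP; rewrite eq_sym -[X in _ == X]adde0.
have := integrable_fin_num measurableT ic.
by rewrite /comp; case: (integral _ _ _) => //= r _; rewrite -!EFinD eqe => /eqP /addrI ->.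
Qed.

Lemma cis_2pi_int (k : int) : cis (k%:~R * (2 * pi)) = 1 :> R[i].
Proof.
have cis2pi : cis (2 * pi) = 1 :> R[i].
  by rewrite /cis mulr_natl cos2pi sin2pi.
have h n : cis (n%:R * (2 * pi)) = 1 :> R[i].
  elim: n => [|n IH]; first by rewrite mul0r cis0.
  by rewrite mulrS mulrDl mul1r cisD cis2pi IH mulr1.
case: k => n; first exact: h.
by rewrite NegzE mulrNz mulNr cisN h conjc1.
Qed.

Lemma sin_2pi_int (k : int) (c : R) : sin (k%:~R * (2 * pi) + c) = sin c.
Proof.
have := cis_2pi_int k; move: (k%:~R * (2 * pi)) => t [ct st].
by rewrite sinD st ct mul0r mul1r add0r.
Qed.

Section FixDimension.
Variable d : nat.
Local Notation T := (d.-tuple RR).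
Local Notation mu := (@torus R d).
Implicit Types (k l : d.-tuple int) (x : T).

Lemma integral_coord (j : 'I_d) (h : RR -> R) : measurable_fun [set: RR] h ->
  (forall t, `|h t| <= 1) ->
  (\int[mu]_x (h (tnth x j))%:E = \int[uniform_prob (@twopi_gt0 R)]_t (h t)%:E)%E.
Proof.
move=> mh h1; pose phi (x : T) : RR := tnth x j.
have mphi : measurable_fun [set: T] phi by exact: measurable_tnth.
have mh' : measurable_fun [set: RR] (fun t => (h t)%:E) by exact/measurable_EFinP.
have ih : mu.-integrable (phi @^-1` setT) ((fun t => (h t)%:E) \o phi).
  apply: (@integrableR_le _ _ _ mu (h \o phi) (fun=> 1)).
  - exact: measurableT_comp.
  - exact: integrableR_cst.
  - by move=> x; exact: h1.
rewrite -[LHS](integral_pushforward mphi mh' ih measurableT).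
apply: eq_measure_integral => A mA _; exact: torus_coord.
Qed.

Lemma cintegral_cis_coord (j : 'I_d) (k : int) : k != 0 ->
  cintegral mu (fun x => cis (k%:~R * (tnth x j : R))) = 0.
Proof.
move=> k0; have k0R : k%:~R != 0 :> R by rewrite intr_eq0.
have mc (c : R) : measurable_fun [set: RR] (fun t : RR => cos (k%:~R * t + c)).
  by apply: continuous_measurable_fun; exact: continuous_cos_affine.
have E (c : R) : \int[mu]_x cos (k%:~R * (tnth x j : R) + c) = 0.
  rewrite /Rintegral (@integral_coord j (fun t => cos (k%:~R * t + c)))//.
    by rewrite uniform_cos// sin_2pi_int.
  by move=> t; exact: cos_max.
apply: complex_eqP => /=.
  by under eq_Rintegral do rewrite -[_ * _]addr0; exact: E.
by under eq_Rintegral do rewrite -cosBpihalf; exact: E.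
Qed.

Definition echar k x : R[i] := cis (\sum_(j < d) (tnth k j)%:~R * (tnth x j : R)).

Lemma fourier_coefE (f : T -> R[i]) k :
  fourier_coef f k = cintegral mu (fun x => f x * (echar k x)^*).
Proof. by []. Qed.

Lemma normc_echar k x : normc (echar k x) = 1.
Proof. exact: normc_cis. Qed.

Lemma cmeas_tnth (h : R -> R[i]) (j : 'I_d) :
  continuous (fun t => complex.Re (h t)) -> continuous (fun t => complex.Im (h t)) ->
  cmeas (fun x : T => h (tnth x j)).
Proof.
move=> c1 c2; split.
  apply: (@measurableT_comp _ _ _ _ _ _ (fun t : RR => complex.Re (h t)));
    [exact: continuous_measurable_fun|exact: measurable_tnth].
apply: (@measurableT_comp _ _ _ _ _ _ (fun t : RR => complex.Im (h t)));
  [exact: continuous_measurable_fun|exact: measurable_tnth].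
Qed.

Lemma cmeas_cis_coord (a : R) (j : 'I_d) : cmeas (fun x : T => cis (a * (tnth x j : R))).
Proof.
apply: (@cmeas_tnth (fun t => cis (a * t))).
  rewrite (_ : (fun t => _) = (fun t : R => cos (a * t + 0))).
    exact: continuous_cos_affine.
  by apply/funext => t; rewrite addr0.
rewrite (_ : (fun t => _) = (fun t : R => cos (a * t + - (pi / 2)))).
  exact: continuous_cos_affine.
by apply/funext => t; rewrite cosBpihalf.
Qed.

Lemma cmeas_echar k : cmeas (echar k).
Proof.
have -> : echar k = fun x => \prod_(j <- index_enum 'I_d) cis ((tnth k j)%:~R * (tnth x j : R)).
  by apply/funext => x; rewrite /echar cis_sum.
elim: (index_enum _) => [|j s IH].
  by under eq_fun do rewrite big_nil; exact: cmeas_cst.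
under eq_fun do rewrite big_cons; apply: cmeasM => //.
exact: cmeas_cis_coord.
Qed.

(** Fubini's theorem after [torus_mix]; it stands in for integration along the
    [j]-th coordinate. *)
Lemma cintegral_mix (j : 'I_d) (g : T -> R[i]) (M : R) : cmeas g ->
  (forall x, normc (g x) <= M) ->
  cintegral mu g = cintegral mu (fun x => cintegral mu (fun z => g (mix j (x, z)))).
Proof.
move=> [g1 g2] gM.
have E (h : T -> R) : measurable_fun [set: T] h -> (forall x, `|h x| <= M) ->
    \int[mu]_x h x = \int[mu]_x \int[mu]_z h (mix j (x, z)).
  move=> mh hM; rewrite /Rintegral; congr fine.
  have ih : mu.-integrable [set: T] (EFin \o h).
    exact: (integrableR_le mh (integrableR_cst _ M)).
  have mh' : measurable_fun [set: T] (EFin \o h) by exact/measurable_EFinP.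
  have ihm : (mu \x mu)%E.-integrable [set: T * T] ((EFin \o h) \o mix j).
    apply/integrableP; split; first exact: measurableT_comp.
    apply: (@le_lt_trans _ _ (\int[(mu \x mu)%E]_x (cst M%:E x))%E).
      apply: ge0_le_integral => //.
      - by apply: measurableT_comp => //; exact: measurableT_comp.
      - by move=> x _ /=; rewrite lee_fin (le_trans _ (hM (mix j x)))// ger0_norm.
    have H1 : (mu \x mu)%E [set: T * T] = 1%E.
      rewrite -setXTT product_measure1E//.
      by have := probability_setT mu => /= ->; rewrite mule1.
    rewrite integral_cst// [X in (_ * X)%E](_ : _ = 1%E); last exact: H1.
    by rewrite mule1 ltry.
  have -> : (\int[mu]_x (h x)%:E = \int[(mu \x mu)%E]_p (h (mix j p))%:E)%E.
    have := integral_pushforward (measurable_mix j) mh' ihm measurableT.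
    rewrite preimage_setT => <-.
    by apply: eq_measure_integral => A mA _; exact/esym/torus_mix.
  rewrite -(integral12_prod_meas1 ihm).
  apply: eq_integral => x _; rewrite fineK//.
  apply: (integrable_fin_num measurableT).
  apply: (@integrableR_le _ _ _ mu (fun z => h (mix j (x, z))) (fun=> M)) => //.
    by apply: measurableT_comp => //; exact: measurableT_comp.
  exact: integrableR_cst.
apply: complex_eqP => /=.
  by apply: E => // x; apply: le_trans (gM x); exact: normc_Re.
by apply: E => // x; apply: le_trans (gM x); exact: normc_Im.
Qed.

Lemma echar_mix (j : 'I_d) k x z : echar k (mix j (x, z)) =
  cis (\sum_(i < d | i != j) (tnth k i)%:~R * (tnth x i : R)) *
  cis ((tnth k j)%:~R * (tnth z j : R)).
Proof.
rewrite /echar (bigD1 j)//= cisD mulrC tnth_mix eqxx; congr (_ * _).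
by congr cis; apply: eq_bigr => i /negPf ij; rewrite tnth_mix ij.
Qed.

(** For [k != l] the integral vanishes already after resampling a coordinate in
    which they differ: the inner integral is a multiple of that of a non-constant
    one-dimensional character. *)
Lemma echar_orthonormal k l :
  cintegral mu (fun x => echar k x * (echar l x)^*) = (k == l)%:R.
Proof.
have [<-|kl] := eqVneq k l.
  by under eq_fun do rewrite cis_conj; rewrite cintegral_cst.
have [j kj] : exists j, tnth k j != tnth l j.
  apply/existsP; apply: contraNT kl => /existsPn h.
  by apply/eqP/eq_from_tnth => j; apply/eqP; have := h j; rewrite negbK.
rewrite (@cintegral_mix j _ 1); first last.
- by move=> x; rewrite normcM normcJ !normc_echar mulr1.
- by apply: cmeasM; [|apply: cmeasJ]; exact: cmeas_echar.
rewrite -[RHS](cintegral_cst mu); congr cintegral; apply/funext => x.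
pose r (k : d.-tuple int) := \sum_(i < d | i != j) (tnth k i)%:~R * (tnth x i : R).
have -> : (fun z => echar k (mix j (x, z)) * (echar l (mix j (x, z)))^*) =
  fun z => (cis (r k) * (cis (r l))^*) * cis ((tnth k j - tnth l j)%:~R * (tnth z j : R)).
  apply/funext => z; rewrite !echar_mix conjcM mulrACA; congr (_ * _).
  by rewrite intrB mulrBl cisD cisN.
rewrite cintegralZ ?cintegral_cis_coord ?mulr0 ?subr_eq0//.
apply: (@cintegrable_bounded _ _ _ mu _ 1); last by apply: nearW => z; rewrite normc_cis.
exact: cmeas_cis_coord.
Qed.

End FixDimension.
End CharacterIntegrals.

(** * Fourier coefficients in L_2 *)

Section LpNorms.
Context d (T : measurableType d) (R : realType).
Variable mu : {measure set T -> \bar R}.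

Lemma L2normE (f : L0 mu) : Lp_norm 2%:E f =
  sqrte (\int[mu]_x (normc (repr f x) ^+ 2)%:E).
Proof.
rewrite /Lp_norm unlock.
under eq_integral => x _.
  rewrite gee0_abs ?lee_fin ?normc_ge0// poweR_EFin powR_mulrn ?normc_ge0//; over.
by rewrite poweR12_sqrt// integral_ge0// => x _; rewrite lee_fin sqr_ge0.
Qed.

Lemma measurable_normc2 (f : cmfun T R) :
  measurable_fun [set: T] (fun x => normc (f x) ^+ 2).
Proof. by apply: measurable_funX; exact: measurable_normc. Qed.

Lemma normc2_ge0 (f : T -> R[i]) : (0 <= \int[mu]_x (normc (f x) ^+ 2)%:E)%E.
Proof. by apply: integral_ge0 => x _; rewrite lee_fin sqr_ge0. Qed.

Lemma L2_predP (f : L0 mu) :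
  (f \in L2_pred mu) = (\int[mu]_x (normc (repr f x) ^+ 2)%:E < +oo)%E.
Proof.
rewrite -[LHS]/(Lp_norm 2%:E f < +oo)%E L2normE.
move: (normc2_ge0 (repr f)); case: (integral _ _ _) => [r| |]//= r0; first by rewrite !ltry.
Qed.

Lemma L2_integrable (y : L2 mu) :
  mu.-integrable [set: T] (EFin \o (fun x => normc (repr (y : L0 mu) x) ^+ 2)).
Proof.
apply/integrableP; split; first exact/measurable_EFinP/measurable_normc2.
have := LpP y; rewrite L2_predP; apply: le_lt_trans.
rewrite le_eqVlt; apply/orP; left; apply/eqP; apply: eq_integral => x _ /=.
by rewrite ger0_norm ?sqr_ge0.
Qed.

Lemma normLp_ge0 p p1 (y : @Lp _ T R mu p p1) : 0 <= normLp y.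
Proof. by rewrite fine_ge0// Lnorm_ge0. Qed.

Lemma normL2_sq (y : L2 mu) :
  normLp y ^+ 2 = \int[mu]_x (normc (repr (y : L0 mu) x) ^+ 2).
Proof.
have := LpP y; rewrite L2_predP /normLp L2normE /Rintegral.
move: (normc2_ge0 (repr (y : L0 mu))); case: (integral _ _ _) => [r| |]//= r0 _.
by rewrite sqr_sqrtr.
Qed.

Lemma normL2_eq_ae (y : L2 mu) (g : T -> R[i]) : cmeas g ->
  (\forall x \ae mu, repr (y : L0 mu) x = g x) ->
  normLp y ^+ 2 = \int[mu]_x (normc (g x) ^+ 2).
Proof.
move=> mg yg; rewrite normL2_sq /Rintegral; congr fine; apply: ae_eq_integral => //.
- exact/measurable_EFinP/measurable_normc2.
- exact/measurable_EFinP/(measurable_normc2 (mkcmfun mg)).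
- by apply: filterS yg => x ->.
Qed.

Lemma normL2_eq0 (y : L2 mu) : normLp y = 0 -> y = 0.
Proof.
move=> y0; have := normL2_sq y; rewrite y0 expr0n /= => /esym I0.
have h : (\int[mu]_x `|(normc (repr (y : L0 mu) x) ^+ 2)%:E| = 0)%E.
  under eq_integral do rewrite gee0_abs ?lee_fin ?sqr_ge0//.
  move: I0; rewrite /Rintegral => I0.
  by rewrite -(fineK (integrable_fin_num measurableT (L2_integrable y))) I0.
have mI : measurable_fun [set: T] (fun x => (normc (repr (y : L0 mu) x) ^+ 2)%:E).
  exact/measurable_EFinP/measurable_normc2.
have h0 := (ae_eq_integral_abs mu measurableT mI).1 h.
apply: val_inj => /=; rewrite -[LHS]reprK -[RHS]reprK.
apply/eqP/L0_eqP.
apply: filterS2 h0 (repr_L0_0 mu) => x /(_ I) [hx] ->.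
by apply/eqP; rewrite -normc_eq0 -sqrf_eq0 hx.
Qed.

Lemma normL2Z (a : R[i]) (y : L2 mu) : normLp (a *: y) = normc a * normLp y.
Proof.
apply/eqP; rewrite -(@eqrXn2 _ 2)// ?mulr_ge0 ?normLp_ge0 ?normc_ge0//; apply/eqP.
have mg : cmeas (fun x => a * repr (y : L0 mu) x).
  by apply: cmeasM; [exact: cmeas_cst|exact: cmeasP].
rewrite (normL2_eq_ae mg); last first.
  have := repr_L0_ZD a (y : L0 mu) 0; rewrite addr0.
  by apply: filterS2 (repr_L0_0 mu) => x -> ->; rewrite addr0.
under eq_Rintegral do rewrite normcM exprMn.
by rewrite RintegralZl ?exprMn ?normL2_sq//; exact: L2_integrable.
Qed.

End LpNorms.

Section EssentiallyBounded.
Context d (T : measurableType d) (R : realType).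
Variable mu : probability T R.
Local Notation muM := (mu : {measure set T -> \bar R}).

Lemma Linf_normE (f : L0 muM) : Lp_norm +oo%E f =
  ess_sup muM (fun x => (normc (repr f x))%:E).
Proof.
rewrite /Lp_norm unlock (_ : (0 < _)%E = true); last first.
  have := probability_setT mu => /= ->; exact: lte01.
by congr ess_sup; apply/funext => x /=; rewrite ger0_norm ?normc_ge0.
Qed.

Lemma Linf_norm_leP (f : L0 muM) (M : R) :
  reflect (\forall x \ae mu, normc (repr f x) <= M) (Lp_norm +oo%E f <= M%:E)%E.
Proof.
rewrite Linf_normE; apply: (iffP idP) => [/ess_supP|h]; last by apply/ess_supP; apply: filterS h => x; rewrite lee_fin.
by apply: filterS => x; rewrite lee_fin.
Qed.

Lemma Linf_norm_ge0 (f : L0 muM) : (0 <= Lp_norm +oo%E f)%E.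
Proof. exact: Lnorm_ge0. Qed.

Lemma Linf_predP (f : L0 muM) : f \in Linfty_pred muM ->
  \forall x \ae mu, normc (repr f x) <= fine (Lp_norm +oo%E f).
Proof.
move=> fi; apply/Linf_norm_leP; rewrite fineK// ge0_fin_numE//.
exact: Linf_norm_ge0.
Qed.

Lemma Linf_pred_bounded (f : L0 muM) (M : R) :
  (\forall x \ae mu, normc (repr f x) <= M) -> f \in Linfty_pred muM.
Proof.
move=> /Linf_norm_leP h; rewrite -[_ \in _]/(Lp_norm +oo%E f < +oo)%E.
by apply: le_lt_trans h _; rewrite ltry.
Qed.

Lemma Linf_sub_L2 (f : L0 muM) : f \in Linfty_pred muM -> f \in L2_pred muM.
Proof.
move=> /Linf_predP; set M := fine _ => fM; rewrite L2_predP.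
apply: (@le_lt_trans _ _ (\int[mu]_x (M ^+ 2)%:E)%E).
  apply: ae_ge0_le_integral => //.
  - by move=> x _; rewrite lee_fin sqr_ge0.
  - exact/measurable_EFinP/measurable_normc2.
  - by move=> x _; rewrite lee_fin sqr_ge0.
  - apply: filterS fM => x h _; rewrite lee_fin ler_pXn2r ?nnegrE ?normc_ge0//.
    exact: le_trans (normc_ge0 _) h.
by rewrite integral_cst// [X in (_ * X)%E]probability_setT mule1 ltry.
Qed.

End EssentiallyBounded.

Section ConjugateIntegral.
Context d (T : measurableType d) (R : realType).
Variable mu : probability T R.

Lemma cintegralJ (f : T -> R[i]) : cintegrable mu f ->
  cintegral mu (fun x => (f x)^*) = (cintegral mu f)^*.
Proof.
move=> [f1 f2]; apply: complex_eqP => /=.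
  by apply: eq_Rintegral => x _; case: (f x).
rewrite -mulN1r -RintegralZl//; apply: eq_Rintegral => x _.
by rewrite mulN1r; case: (f x).
Qed.

Lemma cintegrableJ (f : T -> R[i]) : cintegrable mu f ->
  cintegrable mu (fun x => (f x)^*).
Proof.
move=> fi; have mf := cintegrable_meas fi.
apply: (@cintegrable_ae_le _ _ _ mu _ (fun x => normc (f x))).
- exact: cmeasJ.
- exact: integrable_normc.
- by apply: nearW => x; rewrite normcJ.
Qed.

Lemma Re_cintegral_normc2 (f : T -> R[i]) :
  complex.Re (cintegral mu (fun x => f x * (f x)^*)) = \int[mu]_x (normc (f x) ^+ 2).
Proof. by rewrite /cintegral/=; apply: eq_Rintegral => x _; rewrite ReJM. Qed.

Lemma cintegrable_normc2 (f : T -> R[i]) : cmeas f ->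
  mu.-integrable [set: T] (EFin \o (fun x => normc (f x) ^+ 2)) ->
  cintegrable mu (fun x => f x * (f x)^*).
Proof.
move=> mf fi; apply: (cintegrable_ae_le _ fi).
  by apply: cmeasM => //; exact: cmeasJ.
by apply: nearW => x; rewrite normcM normcJ.
Qed.

Lemma cintegrable_of_normc2 (f : T -> R[i]) : cmeas f ->
  mu.-integrable [set: T] (EFin \o (fun x => normc (f x) ^+ 2)) ->
  cintegrable mu f.
Proof.
move=> mf fi; apply: (@cintegrable_ae_le _ _ _ mu _ (fun x => 1 + normc (f x) ^+ 2)) => //.
  apply: (@integrableD _ _ _ mu _ measurableT (EFin \o (fun=> 1))
    (EFin \o (fun x => normc (f x) ^+ 2))) => //.
  exact: integrableR_cst.
apply: nearW => x; have := normc_ge0 (f x); move: (normc (f x)) => r r0.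
have : 0 <= (r - 1) ^+ 2 := sqr_ge0 _; nra.
Qed.

Lemma cintegrableM_bounded (f g : T -> R[i]) (M : R) : cintegrable mu f ->
  cmeas g -> (forall x, normc (g x) <= M) -> cintegrable mu (fun x => f x * g x).
Proof.
move=> fi mg gM; have mf := cintegrable_meas fi.
apply: (@cintegrable_ae_le _ _ _ mu _ (fun x => M * normc (f x))).
- exact: cmeasM.
- apply: (@integrableZl _ _ _ mu _ measurableT M (EFin \o (fun x => normc (f x)))).
  exact: integrable_normc.
- by apply: nearW => x; rewrite normcM mulrC ler_wpM2r ?normc_ge0.
Qed.

End ConjugateIntegral.

Section FourierL2.
Context {R : realType} (d : nat).
Local Notation RR := (measurableTypeR R).
Local Notation T := (d.-tuple RR).
Local Notation mu := (@torus R d).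
Local Notation muM := (mu : {measure set _ -> \bar R}).
Implicit Types (k l : d.-tuple int) (S : seq (d.-tuple int)) (c : d.-tuple int -> R[i]).

Definition trig S c (x : T) : R[i] := \sum_(k <- S) c k * echar k x.

Lemma cmeas_trig S c : cmeas (trig S c).
Proof.
by apply: cmeas_sum => k; apply: cmeasM; [exact: cmeas_cst|exact: cmeas_echar].
Qed.

Lemma normc_trig_le S c x : normc (trig S c x) <= \sum_(k <- S) normc (c k).
Proof.
apply: (le_trans (normc_sum _ _ _)); rewrite le_eqVlt; apply/orP; left; apply/eqP.
by apply: eq_bigr => k _; rewrite normcM normc_echar mulr1.
Qed.

Lemma cintegrable_echarM (g : T -> R[i]) k : cintegrable mu g ->
  cintegrable mu (fun x => g x * (echar k x)^*).
Proof.
move=> gi; apply: (@cintegrableM_bounded _ _ _ mu _ _ 1) => //.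
  exact/cmeasJ/cmeas_echar.
by move=> x; rewrite normcJ normc_echar.
Qed.

Lemma cintegrable_trig S c : cintegrable mu (trig S c).
Proof.
apply: (cintegrable_bounded (cmeas_trig S c)).
by apply: nearW => x; exact: normc_trig_le.
Qed.

Lemma cintegrable_echar k : cintegrable mu (echar k).
Proof.
apply: (@cintegrable_bounded _ _ _ mu _ 1 (cmeas_echar k)).
by apply: nearW => x; rewrite normc_echar.
Qed.

Lemma sum_delta (S : seq (d.-tuple int)) (F : d.-tuple int -> R[i]) k : uniq S ->
  \sum_(l <- S) F l * (l == k)%:R = if k \in S then F k else 0.
Proof.
move=> uS; case: ifPn => kS.
  rewrite (bigD1_seq k)//= eqxx mulr1 big1 ?addr0// => l /negPf ->.
  by rewrite mulr0.
rewrite big_seq big1// => l lS; case: eqP => [lk|]; last by rewrite mulr0.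
by rewrite -lk lS in kS.
Qed.

Lemma fourier_coef_trig S c k : uniq S ->
  fourier_coef (trig S c) k = if k \in S then c k else 0.
Proof.
move=> uS; rewrite fourier_coefE -sum_delta//.
rewrite [LHS](_ : _ = cintegral mu (fun x => \sum_(l <- S) c l * (echar l x * (echar k x)^*))).
  rewrite cintegral_sum; last first.
    by move=> l; apply: cintegrableZ; apply: cintegrable_echarM; exact: cintegrable_echar.
  apply: eq_bigr => l _; rewrite cintegralZ ?echar_orthonormal//.
  by apply: cintegrable_echarM; exact: cintegrable_echar.
by congr cintegral; apply/funext => x; rewrite mulr_suml; apply: eq_bigr => l _; rewrite mulrA.
Qed.

Lemma cintegral_trigJ (g : T -> R[i]) S c : cintegrable mu g ->
  cintegral mu (fun x => g x * (trig S c x)^*) =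
  \sum_(k <- S) (c k)^* * fourier_coef g k.
Proof.
move=> gi.
rewrite [LHS](_ : _ = cintegral mu (fun x => \sum_(l <- S) (c l)^* * (g x * (echar l x)^*))).
  rewrite cintegral_sum; last by move=> l; apply: cintegrableZ; exact: cintegrable_echarM.
  by apply: eq_bigr => l _; rewrite cintegralZ//; exact: cintegrable_echarM.
congr cintegral; apply/funext => x; rewrite conj_sum mulr_sumr.
by apply: eq_bigr => l _; rewrite conjcM mulrCA.
Qed.

(** Completing the square in the coefficients, by orthonormality. *)
Lemma trig_distance (g : T -> R[i]) S c : uniq S -> cmeas g ->
  mu.-integrable [set: T] (EFin \o (fun x => normc (g x) ^+ 2)) ->
  \int[mu]_x (normc (g x - trig S c x) ^+ 2) =
  \int[mu]_x (normc (g x) ^+ 2) - \sum_(k <- S) normc (fourier_coef g k) ^+ 2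
  + \sum_(k <- S) normc (fourier_coef g k - c k) ^+ 2.
Proof.
move=> uS mg gi2; have gi := cintegrable_of_normc2 mg gi2.
set p := trig S c.
have mp : cmeas p := cmeas_trig S c.
have bp x : normc (p x) <= \sum_(k <- S) normc (c k) by exact: normc_trig_le.
have bpJ x : normc (p x)^* <= \sum_(k <- S) normc (c k) by rewrite normcJ.
have pi_ : cintegrable mu p := cintegrable_trig S c.
have i1 := cintegrable_normc2 mg gi2.
have i2 : cintegrable mu (fun x => g x * (p x)^*).
  exact: (cintegrableM_bounded gi (cmeasJ mp) bpJ).
have i3 : cintegrable mu (fun x => (g x * (p x)^*)^*) by exact: cintegrableJ.
have i4 : cintegrable mu (fun x => p x * (p x)^*).
  exact: (cintegrableM_bounded pi_ (cmeasJ mp) bpJ).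
rewrite -Re_cintegral_normc2.
have -> : (fun x => (g x - p x) * (g x - p x)^*) =
  fun x => (g x * (g x)^* - g x * (p x)^*) - ((g x * (p x)^*)^* - p x * (p x)^*).
  by apply/funext => x; rewrite conjcB conjcM conjcKK; ring.
rewrite cintegralB; [|exact: cintegrableB|exact: cintegrableB].
rewrite !cintegralB// cintegralJ// !cReB Re_cintegral_normc2.
rewrite cintegral_trigJ// cintegral_trigJ//.
rewrite -!addrA; congr (_ + _).
rewrite opprB conj_sum !Re_sum -!sumrN.
rewrite -!big_split/= big_seq [RHS]big_seq; apply: eq_bigr => k kS.
rewrite fourier_coef_trig// kS.
rewrite !normc2E; case: (c k) => a b; case: (fourier_coef g k) => a' b' /=; ring.
Qed.

Lemma trig_normsq S c : uniq S ->
  \int[mu]_x (normc (trig S c x) ^+ 2) = \sum_(k <- S) normc (c k) ^+ 2.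
Proof.
move=> uS; have := @trig_distance (fun=> 0) S c uS (cmeas_cst _ 0).
have h0 k : fourier_coef (fun=> 0 : R[i]) k = 0.
  by rewrite fourier_coefE; under eq_fun do rewrite mul0r; rewrite cintegral_cst.
under eq_Rintegral do rewrite add0r normcN.
move=> -> //; last by rewrite /comp; under eq_fun do rewrite normc0 expr0n/=; exact: integrable0.
under eq_Rintegral do rewrite normc0 expr0n/=.
rewrite Rintegral_cstT add0r big1 ?oppr0 ?add0r; last by move=> k _; rewrite h0 normc0 expr0n.
by apply: eq_bigr => k _; rewrite h0 add0r normcN.
Qed.

Lemma fourier_coef_ae (f g : T -> R[i]) k : cmeas f -> cmeas g ->
  (\forall x \ae mu, f x = g x) -> fourier_coef f k = fourier_coef g k.
Proof.
move=> mf mg fg; rewrite !fourier_coefE; apply: cintegral_ae.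
- by apply: cmeasM => //; exact/cmeasJ/cmeas_echar.
- by apply: cmeasM => //; exact/cmeasJ/cmeas_echar.
- by apply: filterS fg => x ->.
Qed.

Lemma fourier_coefZD (a : R[i]) (f g : T -> R[i]) k :
  cintegrable mu f -> cintegrable mu g ->
  fourier_coef (fun x => a * f x + g x) k = a * fourier_coef f k + fourier_coef g k.
Proof.
move=> fi gi; rewrite !fourier_coefE -cintegralZD; try exact: cintegrable_echarM.
by congr cintegral; apply/funext => x; rewrite mulrDl mulrA.
Qed.

Definition fc k (f : L0 muM) : R[i] := fourier_coef (repr f) k.

Lemma L2_cintegrable (y : L2 muM) : cintegrable mu (repr (y : L0 muM)).
Proof. by apply: cintegrable_of_normc2; [exact: cmeasP|exact: L2_integrable]. Qed.

Lemma fcZD k a (y z : L2 muM) :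
  fc k (a *: (y : L0 muM) + (z : L0 muM)) = a * fc k y + fc k z.
Proof.
rewrite /fc -fourier_coefZD; try exact: L2_cintegrable.
apply: fourier_coef_ae; last exact: repr_L0_ZD.
  exact: cmeasP.
by apply: cmeasD; [apply: cmeasM; [exact: cmeas_cst|exact: cmeasP]|exact: cmeasP].
Qed.

Definition eL0 k : L0 muM := \pi_(L0 muM) (mkcmfun (cmeas_echar k)).

Lemma eL0_L2 k : eL0 k \in L2_pred muM.
Proof.
apply: Linf_sub_L2; apply: (@Linf_pred_bounded _ _ _ mu _ 1).
by apply: filterS (repr_piL0 muM (mkcmfun (cmeas_echar k))) => x ->; rewrite /= normc_echar.
Qed.

Definition eL2 k : L2 muM := MkLp (eL0_L2 k).

Lemma Lp_val_sum (I : Type) (s : seq I) (F : I -> L2 muM) :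
  (\sum_(i <- s) F i : L2 muM) = (\sum_(i <- s) (F i : L0 muM)) :> L0 muM.
Proof. by elim/big_rec2: _ => //= i x y _ <-. Qed.

Lemma repr_sum_ae (I : Type) (s : seq I) (c : I -> R[i]) (F : I -> L0 muM)
    (g : I -> T -> R[i]) :
  (forall i, \forall x \ae mu, repr (F i) x = g i x) ->
  \forall x \ae mu, repr (\sum_(i <- s) c i *: F i) x = \sum_(i <- s) c i * g i x.
Proof.
move=> Fg; elim: s => [|i s IH].
  rewrite big_nil; apply: filterS (repr_L0_0 muM) => x ->.
  by rewrite big_nil.
rewrite big_cons; apply: filterS3 IH (Fg i) (repr_L0_ZD (c i) (F i) (\sum_(j <- s) c j *: F j)) => x e1 e2 ->.
by rewrite e1 e2 big_cons.
Qed.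

Lemma repr_trig S c :
  \forall x \ae mu, repr (\sum_(k <- S) c k *: eL0 k) x = trig S c x.
Proof. by apply: repr_sum_ae => k; exact: repr_piL0. Qed.

Lemma L2_distance S c (y : L2 muM) : uniq S ->
  normLp (y - \sum_(k <- S) c k *: eL2 k) ^+ 2 =
  normLp y ^+ 2 - \sum_(k <- S) normc (fc k y) ^+ 2
  + \sum_(k <- S) normc (fc k y - c k) ^+ 2.
Proof.
move=> uS; rewrite [normLp y ^+ 2]normL2_sq -trig_distance//.
- apply: normL2_eq_ae.
    by apply: cmeasB; [exact: cmeasP|exact: cmeas_trig].
  have -> : Lp_val (y - \sum_(k <- S) c k *: eL2 k) =
     -1 *: (\sum_(k <- S) c k *: eL0 k) + (y : L0 muM).
    by rewrite scaleN1r addrC /= Lp_val_sum.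
  apply: filterS2 (repr_trig S c) (repr_L0_ZD (-1) (\sum_(k <- S) c k *: eL0 k) y) => x e ->.
  by rewrite e mulN1r addrC.
- exact: cmeasP.
- exact: L2_integrable.
Qed.

Lemma bessel S (y : L2 muM) : uniq S ->
  \sum_(k <- S) normc (fc k y) ^+ 2 <= normLp y ^+ 2.
Proof.
move=> uS; have := L2_distance (fc^~ y) y uS; rewrite [X in _ - _ + X]big1; last first.
  by move=> k _; rewrite subrr normc0 expr0n.
by rewrite addr0 => h; rewrite -subr_ge0 -h sqr_ge0.
Qed.

Lemma fc_eL2 k l : fc k (eL2 l) = (l == k)%:R.
Proof.
rewrite /fc -echar_orthonormal -fourier_coefE; apply: fourier_coef_ae.
- exact: cmeasP.
- exact: cmeas_echar.
- exact: repr_piL0.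
Qed.

End FourierL2.

(** * Completeness of the characters *)

Section PowerTrick.
Context {R : realType}.

Lemma onem_exp_ge (v : R) K : 0 <= v <= 1 -> 1 - K%:R * v <= (1 - v) ^+ K.
Proof.
move=> /andP[v0 v1]; elim: K => [|K IH]; first by rewrite mul0r subr0 expr0.
rewrite exprS (le_trans _ (ler_wpM2l _ IH)) ?subr_ge0//.
rewrite -natr1; have : 0 <= K%:R :> R by []. move: (K%:R) => k k0; nra.
Qed.

Lemma onem_exp_le (v : R) K : 0 <= v <= 1 -> (1 - v) ^+ K * (1 + K%:R * v) <= 1.
Proof.
move=> /andP[v0 v1]; elim: K => [|K IH]; first by rewrite mul0r addr0 mulr1 expr0.
apply: le_trans IH; rewrite exprSr -mulrA ler_wpM2l ?exprn_ge0 ?subr_ge0//.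
rewrite -natr1; have : 0 <= K%:R :> R by []. move: (K%:R) => k k0; nra.
Qed.

(** The polynomials [(1 - u^n)^(2^n)] converge boundedly on [[0,1]] to the step at
    [u = 1/2]; they replace the Stone-Weierstrass theorem below. *)
Lemma step_power_cvg1 (u : R) : 0 <= u -> u < 2^-1 ->
  (1 - u ^+ n) ^+ (2 ^ n) @[n --> \oo] --> (1 : R).
Proof.
move=> u0 u2; apply: (@squeeze_cvgr _ _ _ _ (fun n => 1 - (2 * u) ^+ n) (cst 1)).
- apply: nearW => n; have u01 : 0 <= u ^+ n <= 1.
    by rewrite exprn_ge0// exprn_ile1//; lra.
  apply/andP; split; last first.
    by rewrite exprn_ile1//; move: u01 => /andP[? ?]; lra.
  by rewrite exprMn -natrX; exact: onem_exp_ge.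
- rewrite -[X in _ --> X]subr0; apply: cvgB; first exact: cvg_cst.
  by apply: cvg_expr; rewrite ger0_norm; lra.
- exact: cvg_cst.
Qed.

Lemma step_power_cvg0 (u : R) : u <= 1 -> 2^-1 < u ->
  (1 - u ^+ n) ^+ (2 ^ n) @[n --> \oo] --> (0 : R).
Proof.
move=> u1 u2; have u0 : 0 < u by lra.
apply: (@squeeze_cvgr _ _ _ _ (cst 0) (fun n => ((2 * u)^-1) ^+ n)).
- apply: nearW => n; have u01 : 0 <= u ^+ n <= 1.
    by rewrite exprn_ge0// ?exprn_ile1//; lra.
  have h := onem_exp_le (2 ^ n) u01.
  have p0 : 0 <= (1 - u ^+ n) ^+ (2 ^ n).
    by rewrite exprn_ge0//; move: u01 => /andP[? ?]; lra.
  apply/andP; split => //; rewrite exprVn -[leRHS]mul1r ler_pdivlMr; last first.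
    by rewrite exprn_gt0//; lra.
  apply: le_trans h; rewrite ler_wpM2l// exprMn natrX lerDr//.
- exact: cvg_cst.
- by apply: cvg_expr; rewrite ger0_norm ?invr_ge0 ?invf_lt1; lra.
Qed.

End PowerTrick.

Section Completeness.
Context {R : realType} (d : nat).
Local Notation RR := (measurableTypeR R).
Local Notation T := (d.-tuple RR).
Local Notation mu := (@torus R d).
Local Notation muM := (mu : {measure set _ -> \bar R}).

Definition annihilating (psi : T -> R[i]) : Prop :=
  [/\ cmeas psi, exists M, \forall x \ae mu, normc (psi x) <= M &
   forall k, fourier_coef psi k = 0].

(** These multipliers form an algebra which contains the characters and is closed under
    bounded pointwise limits, so it contains the indicators of half-spaces and then
    those of all measurable sets; that is why an annihilating function is null. *)
Definition multiplier (g : T -> R[i]) : Prop :=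
  [/\ cmeas g, exists M, forall x, normc (g x) <= M &
   forall psi, annihilating psi -> annihilating (fun x => g x * psi x)].

Lemma annihilatingZD a f g : annihilating f -> annihilating g ->
  annihilating (fun x => a * f x + g x).
Proof.
move=> [mf [M fM] f0] [mg [N gN] g0]; split.
- by apply: cmeasD => //; apply: cmeasM => //; exact: cmeas_cst.
- exists (normc a * M + N); apply: filterS2 fM gN => x h1 h2.
  by rewrite (le_trans (normcZD_le _ _ _))// lerD// ler_wpM2l ?normc_ge0.
- move=> k; rewrite fourier_coefZD ?f0 ?g0 ?mulr0 ?addr0//.
    exact: (cintegrable_bounded mf fM).
  exact: (cintegrable_bounded mg gN).
Qed.

Lemma multiplier_cst z : multiplier (fun=> z).
Proof.
split; [exact: cmeas_cst|by exists (normc z)|move=> psi hpsi].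
have h0 : annihilating (fun=> 0).
  split; [exact: cmeas_cst|exists 0; apply: nearW => x; by rewrite normc0|move=> k].
  rewrite fourier_coefE.
  by under eq_fun do rewrite mul0r; rewrite cintegral_cst.
have := annihilatingZD z hpsi h0.
by under eq_fun do rewrite addr0.
Qed.

Lemma multiplierM f g : multiplier f -> multiplier g ->
  multiplier (fun x => f x * g x).
Proof.
move=> [mf [M fM] hf] [mg [N gN] hg]; split; first exact: cmeasM.
  exists (M * N) => x; rewrite normcM ler_pM ?normc_ge0//.
move=> psi hpsi; under eq_fun do rewrite -mulrA.
exact/hf/hg.
Qed.

Lemma multiplierD f g : multiplier f -> multiplier g ->
  multiplier (fun x => f x + g x).
Proof.
move=> [mf [M fM] hf] [mg [N gN] hg]; split; first exact: cmeasD.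
  by exists (M + N) => x; rewrite (le_trans (le_normcD _ _))// lerD.
move=> psi hpsi; have := annihilatingZD 1 (hf _ hpsi) (hg _ hpsi).
by under eq_fun do rewrite mul1r -mulrDl.
Qed.

Lemma multiplierB f g : multiplier f -> multiplier g ->
  multiplier (fun x => f x - g x).
Proof.
move=> mf mg; under eq_fun do rewrite -mulN1r.
by apply: multiplierD => //; apply: multiplierM => //; exact: multiplier_cst.
Qed.

Lemma multiplierX f n : multiplier f -> multiplier (fun x => f x ^+ n).
Proof.
move=> mf; elim: n => [|n IH].
  by under eq_fun do rewrite expr0; exact: multiplier_cst.
by under eq_fun do rewrite exprS; exact: multiplierM.
Qed.

Lemma multiplier_lim (F : nat -> T -> R[i]) g (M : R) :
  (forall n, multiplier (F n)) -> (forall n x, normc (F n x) <= M) ->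
  cmeas g -> (forall x, normc (g x) <= M) ->
  (\forall x \ae mu, normc (F n x - g x) @[n --> \oo] --> (0 : R)) -> multiplier g.
Proof.
move=> hF FM mg gM Fg; split => //; first by exists M.
move=> psi hpsi; have [mpsi [N psiN] _] := hpsi; split; first exact: cmeasM.
  exists (M * N); apply: filterS psiN => x h.
  by rewrite normcM ler_pM ?normc_ge0.
move=> k; apply/eqP; rewrite -normc_eq0; apply/eqP.
have mF n : cmeas (F n) by have [] := hF n.
have c : normc (fourier_coef (fun x => F n x * psi x) k
    - fourier_coef (fun x => g x * psi x) k) @[n --> \oo] --> (0 : R).
  have mek : cmeas (fun x : T => (echar k x : R[i])^*) by exact/cmeasJ/cmeas_echar.
  apply: (@bounded_cvg_cintegral _ _ _ mu (fun n x => F n x * psi x * (echar k x)^*)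
     (fun x => g x * psi x * (echar k x)^*) (M * N)).
  - by move=> n; do 2 apply: cmeasM => //.
  - by do 2 apply: cmeasM => //.
  - apply: filterS psiN => x h n.
    by rewrite !normcM normcJ normc_echar mulr1 ler_pM ?normc_ge0.
  - apply: filterS Fg => x h.
    rewrite -[X in _ --> X](mul0r (normc (psi x))).
    under eq_fun => n do rewrite -!mulrBl !normcM normcJ normc_echar mulr1.
    by apply: cvgM => //; exact: cvg_cst.
move: c; under eq_fun => n.
  have [_ _ /(_ psi hpsi)[_ _ ->]] := hF n.
  rewrite sub0r normcN; over.
by move=> /(cvg_unique _ (cvg_cst _)); exact.
Qed.

Lemma multiplier_ae f g : multiplier f -> cmeas g ->
  (exists M, forall x, normc (g x) <= M) -> (\forall x \ae mu, f x = g x) ->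
  multiplier g.
Proof.
move=> hf mg [M gM] fg; have [mf [N fN] _] := hf.
apply: (@multiplier_lim (fun=> f) g (Num.max M N)) => //.
- by move=> n x; rewrite le_max fN orbT.
- by move=> x; rewrite le_max gM.
- by apply: filterS fg => x ->; rewrite subrr normc0; exact: cvg_cst.
Qed.

Definition unit_freq (j : 'I_d) (s : int) : d.-tuple int :=
  [tuple if i == j then s else 0 | i < d].

Lemma echar_unit j s (x : T) : echar (unit_freq j s) x = cis (s%:~R * (tnth x j : R)).
Proof.
rewrite /echar (bigD1 j)//= tnth_mktuple eqxx big1 ?addr0// => i /negPf ij.
by rewrite tnth_mktuple ij mul0r.
Qed.

Lemma echarJ_sub k l (x : T) :
  echar l x * (echar k x)^* = (echar [tuple tnth k j - tnth l j | j < d] x : R[i])^*.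
Proof.
rewrite /echar -!cisN -cisD; congr cis.
rewrite -!sumrN -big_split; apply: eq_bigr => j _ /=.
by rewrite tnth_mktuple intrB mulrBl opprB.
Qed.

Lemma multiplier_echar l : multiplier (echar l : T -> R[i]).
Proof.
split; [exact: cmeas_echar|by exists 1 => x; rewrite normc_echar|].
move=> psi [mpsi [M psiM] h]; split.
- by apply: cmeasM => //; exact: cmeas_echar.
- by exists M; apply: filterS psiM => x; rewrite normcM normc_echar mul1r.
- move=> k; rewrite -(h [tuple tnth k j - tnth l j | j < d]) !fourier_coefE.
  congr cintegral; apply/funext => x.
  by rewrite -echarJ_sub mulrCA mulrA.
Qed.

Lemma multiplier_cos (j : 'I_d) (c : R) :
  multiplier (fun x : T => (cos ((tnth x j : R) - c))%:C).
Proof.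
have -> : (fun x : T => (cos ((tnth x j : R) - c))%:C) =
  fun x => (2^-1)%:C * cis (- c) * echar (unit_freq j 1) x +
           (2^-1)%:C * cis c * echar (unit_freq j (-1)) x.
  apply/funext => x; rewrite !echar_unit -!mulrA -!cisD.
  move: (tnth x j : R) => t.
  rewrite mul1r mulN1r [- c + t]addrC [c - t](_ : _ = - (t - c)); last by ring.
  by apply: complex_eqP => /=; rewrite ?cosN ?sinN; field.
apply: (@multiplierD (fun x => (2^-1)%:C * cis (- c) * echar (unit_freq j 1) x)
  (fun x => (2^-1)%:C * cis c * echar (unit_freq j (-1)) x)).
  by apply: (@multiplierM (fun=> _) (echar _)); [exact: multiplier_cst|exact: multiplier_echar].
by apply: (@multiplierM (fun=> _) (echar _)); [exact: multiplier_cst|exact: multiplier_echar].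
Qed.

(** A cosine shifted and scaled into [[0,1]] whose values at the two ends of the arc
    from [0] to [b] are [1/2]. *)
Definition arc_height (b t : R) : R := 2^-1 + 4^-1 * (cos (t - b / 2) - cos (b / 2)).

Lemma arc_height01 b t : 0 <= arc_height b t <= 1.
Proof.
rewrite /arc_height; have := cos_geN1 (t - b / 2); have := cos_le1 (t - b / 2).
by have := cos_geN1 (b / 2); have := cos_le1 (b / 2); lra.
Qed.

(** The factorisation shows that on [(0, 2 pi)] the arc [t < b] is the superlevel set
    above [1/2]. *)
Lemma arc_heightE (b t : R) :
  arc_height b t = 2^-1 + 2^-1 * sin (t / 2) * sin ((b - t) / 2).
Proof.
rewrite /arc_height.
have -> : t - b / 2 = t / 2 - (b - t) / 2 by field.
have -> : b / 2 = t / 2 + (b - t) / 2 by field.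
by rewrite cosB cosD; field.
Qed.

Lemma arc_height_lt (b t : R) : 0 < t < 2 * pi -> 0 <= b <= 2 * pi -> t < b ->
  2^-1 < arc_height b t.
Proof.
move=> /andP[t0 t1] /andP[b0 b1] tb; rewrite arc_heightE ltrDl.
by rewrite !mulr_gt0 ?invr_gt0// sin_gt0_pi//; lra.
Qed.

Lemma arc_height_gt (b t : R) : 0 < t < 2 * pi -> 0 <= b <= 2 * pi -> b < t ->
  arc_height b t < 2^-1.
Proof.
move=> /andP[t0 t1] /andP[b0 b1] tb; rewrite arc_heightE gtrDl.
rewrite (_ : (b - t) / 2 = - ((t - b) / 2)); last by field.
by rewrite sinN mulrN oppr_lt0 !mulr_gt0 ?invr_gt0// sin_gt0_pi//; lra.
Qed.

Lemma measurable_halfspace (j : 'I_d) (b : R) : measurable [set x : T | (tnth x j : R) < b].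
Proof.
have mb : measurable (`]-oo, b[%classic : set RR) by exact: measurable_itv.
have := @measurable_tnth _ RR d j measurableT _ mb; rewrite setTI.
by congr measurable; apply/seteqP; split => x /=; rewrite in_itv.
Qed.

Lemma torus_coord_neq (j : 'I_d) (b : R) : \forall x \ae mu, (tnth (x : T) j : R) != b.
Proof.
exists [set x : T | (tnth x j : R) = b]; split.
- have := @measurable_tnth _ RR d j measurableT [set b] (measurable_set1 b).
  by rewrite setTI.
- rewrite (torus_coord j (measurable_set1 b)).
  have /null_content_dominatesP h := @dominates_uniform_prob R 0 (2 * pi) twopi_gt0.
  by apply: h; [exact: measurable_set1|exact: lebesgue_measure_set1].
- by move=> x /= /negP; rewrite negbK => /eqP.
Qed.

Lemma torus_coord_cube (j : 'I_d) : \forall x \ae mu, 0 < (tnth (x : T) j : R) < 2 * pi.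
Proof.
have h : \forall x \ae mu, 0 <= (tnth (x : T) j : R) <= 2 * pi.
  have mI : measurable (~` `[0, 2 * pi]%classic : set RR).
    by apply: measurableC; exact: measurable_itv.
  exists [set x : T | (~` `[0, 2 * pi]%classic : set RR) (tnth x j)]; split.
  - by have := @measurable_tnth _ RR d j measurableT _ mI; rewrite setTI.
  - rewrite (torus_coord j mI).
    have := @integral_uniform R _ _ (@twopi_gt0 R)
      (fun t => (\1_(~` `[0, 2 * pi]%classic) t)%:E) _ _.
    rewrite integral_indic// setIT => ->.
    + rewrite (_ : integral _ _ _ = 0)%E ?mule0//.
      apply: integral0_eq => t tI.
      by rewrite indicE memNset// => /(_ tI).
    + exact/measurable_EFinP/measurable_indic.
    + by move=> t; rewrite lee_fin.
  - by move=> x /= xI; rewrite in_itv /= => ?; exact: xI.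
apply: filterS3 h (torus_coord_neq j 0) (torus_coord_neq j (2 * pi)) => x.
by rewrite !le_eqVlt => /andP[/orP[/eqP<-|->]/orP[/eqP->|->]]; rewrite ?eqxx.
Qed.

Definition cindic (A : set T) (x : T) : R[i] := (\1_A x : R)%:C.

Lemma cmeas_cindic A : measurable A -> cmeas (cindic A).
Proof. by move=> mA; split; [exact: measurable_indic|exact: measurable_cst]. Qed.

Lemma normc_cindic A x : normc (cindic A x) <= 1.
Proof. by rewrite normcR indicE ger0_norm ?lern1 ?leq_b1. Qed.

Lemma multiplier_halfspace (j : 'I_d) (b : R) :
  multiplier (cindic [set x : T | (tnth x j : R) < b]).
Proof.
have mA : measurable [set x : T | (tnth x j : R) < b].
  exact: measurable_halfspace.
have mI := cmeas_cindic mA; have bI := normc_cindic [set x : T | (tnth x j : R) < b].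
have [b0|b0] := ltP b 0.
  apply: (multiplier_ae (multiplier_cst 0)) => //; first by exists 1.
  apply: filterS (torus_coord_cube j) => x /andP[t0 _].
  by rewrite /cindic indicE memNset//= => tb; lra.
have [b1|b1] := ltP (2 * pi) b.
  apply: (multiplier_ae (multiplier_cst 1)) => //; first by exists 1.
  apply: filterS (torus_coord_cube j) => x /andP[_ t1].
  by rewrite /cindic indicE mem_set//=; exact: lt_trans b1.
pose u (x : T) : R := arc_height b (tnth x j).
pose F n (x : T) : R[i] := (1 - (1 - u x ^+ n) ^+ (2 ^ n))%:C.
apply: (@multiplier_lim F _ 1) => //.
- move=> n; have mu_ : multiplier (fun x => (u x)%:C).
    rewrite /u /arc_height; under eq_fun do rewrite rmorphD rmorphM rmorphB.
    apply: multiplierD; first exact: multiplier_cst.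
    apply: multiplierM; first exact: multiplier_cst.
    by apply: multiplierB; [exact: multiplier_cos|exact: multiplier_cst].
  rewrite /F; under eq_fun do rewrite !(rmorphB, rmorphXn).
  apply: multiplierB; first exact: multiplier_cst.
  apply: multiplierX; apply: multiplierB; first exact: multiplier_cst.
  exact: multiplierX.
- move=> n x; rewrite normcR; have /andP[u0 u1] := arc_height01 b (tnth x j).
  have v0 : 0 <= 1 - u x ^+ n by rewrite subr_ge0 exprn_ile1.
  have v1 : 1 - u x ^+ n <= 1 by rewrite gerBl exprn_ge0.
  rewrite ger0_norm; first by rewrite gerBl exprn_ge0.
  by rewrite subr_ge0 exprn_ile1.
- apply: filterS2 (torus_coord_cube j) (torus_coord_neq j b) => x t01 tb.
  have /andP[u0 u1] := arc_height01 b (tnth x j).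
  rewrite (_ : (fun n => _) =
    fun n => `|1 - (1 - u x ^+ n) ^+ (2 ^ n) - \1_[set x : T | (tnth x j : R) < b] x|);
    last by apply/funext => n; rewrite -rmorphB normcR.
  rewrite -[X in _ --> X](@normr0 _ R); apply: cvg_norm.
  have [xb|bx|] := ltgtP (tnth x j : R) b; last by move=> e; rewrite e eqxx in tb.
    rewrite indicE mem_set//= -[X in _ --> X](subrr 1); apply: cvgB; last exact: cvg_cst.
    rewrite -[X in _ --> X]subr0; apply: cvgB; first exact: cvg_cst.
    by apply: step_power_cvg0 => //; apply: arc_height_lt => //; apply/andP.
  rewrite indicE memNset/=; last by move=> xb; move: (lt_trans bx xb); rewrite ltxx.
  rewrite -[X in _ --> X](subr0 0); apply: cvgB; last exact: cvg_cst.
  rewrite -[X in _ --> X](subrr 1); apply: cvgB; first exact: cvg_cst.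
  by apply: step_power_cvg1 => //; apply: arc_height_gt => //; apply/andP.
Qed.

Lemma multiplier_sigma_algebra :
  sigma_algebra setT [set A : set T | measurable A /\ multiplier (cindic A)].
Proof.
have hC A : measurable A -> multiplier (cindic A) -> multiplier (cindic (~` A)).
  move=> mA h; have -> : cindic (~` A) = fun x => 1 - cindic A x.
    apply/funext => x; rewrite /cindic !indicE in_setC -rmorphB.
    by case: (x \in A); rewrite /= ?subrr ?subr0.
  by apply: multiplierB => //; exact: multiplier_cst.
split => /=.
- split; first exact: measurable0.
  have -> : cindic set0 = fun=> 0.
    by apply/funext => x; rewrite /cindic indicE in_set0.
  exact: multiplier_cst.
- by move=> A [mA h]; rewrite setTD; split; [exact: measurableC|exact: hC].
- move=> A hA; have mU : measurable (\bigcup_k A k).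
    by apply: bigcup_measurable => k _; have [] := hA k.
  split => //; rewrite -[X in cindic X]setCK; apply: (hC _ _ _); first exact: measurableC.
  pose F n x := \prod_(i < n) cindic (~` A i) x.
  have Fn1 n x : normc (F n x) <= 1.
    rewrite normc_prod; apply: prodr_ile1 => i _.
    by rewrite normc_ge0 normc_cindic.
  apply: (@multiplier_lim F _ 1) => //.
  + rewrite /F; elim => [|n IH].
      by under eq_fun do rewrite big_ord0; exact: multiplier_cst.
    under eq_fun do rewrite big_ord_recr/=.
    by apply: multiplierM => //; have [? ?] := hA n; exact: hC.
  + by apply: cmeas_cindic; exact: measurableC.
  + exact: normc_cindic.
  + apply: nearW => x; apply: cvg_near_cst.
    have [[k _ Akx]|nx] := pselect ((\bigcup_k A k) x).
      exists k.+1 => // n /= kn.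
      rewrite /F (bigD1 (Ordinal kn))//= {1}/cindic indicE memNset; last by move=> /(_ Akx).
      rewrite mul0r sub0r normcN /cindic indicE memNset ?normc0//.
      by move=> h; apply: h; exists k.
    apply: nearW => n; rewrite /F big1 => [|i _].
      by rewrite /cindic indicE mem_set// subrr normc0.
    by rewrite /cindic indicE mem_set//= => Aix; apply: nx; exists i.
Qed.

Lemma multiplier_measurable A : measurable A -> multiplier (cindic A).
Proof.
move=> mA; suff [] : [set A : set T | measurable A /\ multiplier (cindic A)] A by [].
have sA := multiplier_sigma_algebra.
move: A mA; apply: smallest_sub => // A hA.
have [i [B mB <-{A hA}]] : exists i : 'I_d,
    preimage_set_system setT (fun x : T => tnth x i) measurable A.
  by elim/big_ind: _ hA => // [P Q hP hQ [/hP|/hQ]//|i _ hC]; exists i.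
rewrite setTI.
suff : (@measurable _ RR) `<=` [set B | [set A : set T | measurable A /\ multiplier (cindic A)]
    ((fun x : T => tnth x i) @^-1` B)] by move/(_ _ mB).
rewrite [X in X `<=` _](_ : _ = (RGenInftyO.G (R := R)).-sigma.-measurable); last first.
  exact: RGenInftyO.measurableE.
apply: smallest_sub.
  case: sA => s0 sC sU; split => /=.
  - by rewrite preimage_set0; exact: s0.
  - by move=> C /= hC; have := sC _ hC; rewrite !setTD.
  - by move=> C hC; rewrite preimage_bigcup; exact: sU.
move=> _ [b ->].
have E : (fun x : T => tnth x i) @^-1` `]-oo, b[%classic = [set x : T | (tnth x i : R) < b].
  by apply/seteqP; split => x /=; rewrite in_itv.
suff : [set A : set T | measurable A /\ multiplier (cindic A)] [set x : T | (tnth x i : R) < b].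
  by rewrite -E.
by split; [exact: measurable_halfspace|exact: multiplier_halfspace].
Qed.

(** Multiplying by the indicator of the set where the real part is positive leaves the
    mean value zero. *)
Lemma annihilating_Re_le0 psi : annihilating psi ->
  \forall x \ae mu, complex.Re (psi x) <= 0.
Proof.
move=> hpsi; have [mpsi [M psiM] _] := hpsi.
pose A := [set x : T | 0 < complex.Re (psi x)].
have mA : measurable A.
  rewrite (_ : A = setT `&` (fun x => complex.Re (psi x)) @^-1` `]0, +oo[%classic).
    by apply: mpsi.1 => //; exact: measurable_itv.
  by rewrite setTI; apply/seteqP; split => x /=; rewrite in_itv/= andbT.
pose k0 : d.-tuple int := [tuple of nseq d 0].
have [_ _ /(_ _ hpsi)] := multiplier_measurable mA.
move=> [mApsi [M' ApsiM'] /(_ k0) h0].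
have e0 x : echar k0 x = 1 :> R[i].
  rewrite /echar big1 ?cis0// => j _.
  by rewrite (tnth_nth 0) nth_nseq if_same mul0r.
have hint := cintegrable_bounded mApsi ApsiM'.
have I0 : \int[mu]_x complex.Re (cindic A x * psi x) = 0.
  have : complex.Re (fourier_coef (fun x => cindic A x * psi x) k0) = 0.
    by rewrite h0.
  rewrite fourier_coefE (_ : (fun x => _) = (fun x => cindic A x * psi x))//.
  by apply/funext => x; rewrite e0 conjc1 mulr1.
have pos x : 0 <= complex.Re (cindic A x * psi x).
  rewrite /cindic indicE cReM /= mul0r subr0.
  case: (boolP (x \in A)) => [|_]; last by rewrite mul0r.
  by rewrite inE /A/= => /ltW; rewrite mul1r.
have m1 : measurable_fun [set: T] (fun x => (complex.Re (cindic A x * psi x))%:E).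
  by apply/measurable_EFinP; have [] := mApsi.
have I0' : (\int[mu]_x `|(complex.Re (cindic A x * psi x))%:E| = 0)%E.
  under eq_integral do rewrite gee0_abs ?lee_fin//.
  have fi := integrable_fin_num measurableT hint.1.
  by move: I0; rewrite /Rintegral -[in X in _ -> X](fineK fi) => ->.
have := (ae_eq_integral_abs mu measurableT m1).1 I0'.
apply: filterS => x /(_ I) [].
rewrite /cindic indicE cReM /= mul0r subr0.
case: (boolP (x \in A)) => [_|].
  by rewrite mul1r => ->.
by rewrite notin_setE /A/= => /negP; rewrite -leNgt.
Qed.

Lemma annihilating_ae0 psi : annihilating psi -> \forall x \ae mu, psi x = 0.
Proof.
move=> h; have hz z : annihilating (fun x => z * psi x).
  by have [_ _] := multiplier_cst z; exact.
have := annihilating_Re_le0 (hz 1); have := annihilating_Re_le0 (hz (-1)).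
have := annihilating_Re_le0 (hz 'i); have := annihilating_Re_le0 (hz (- 'i)).
move=> h1 h2 h3 h4.
apply: filterS2 (filterI h1 h2) (filterI h3 h4) => x [] + + [].
case: (psi x) => a b /= k1 k2 k3 k4.
by apply: complex_eqP => /=; lra.
Qed.

End Completeness.

(** * Removing the frequencies outside the nonzero ones *)

Section RemoveFrequencies.
Context {R : realType} (d : nat).
Local Notation RR := (measurableTypeR R).
Local Notation T := (d.-tuple RR).
Local Notation mu := (@torus R d).

Lemma measurable_partial_integral (j : 'I_d) (h : T -> R) (M : R) :
  measurable_fun [set: T] h -> (forall x, `|h x| <= M) ->
  measurable_fun [set: T] (fun x => \int[mu]_z h (mix j (x, z))).
Proof.
move=> mh hM.
have mhm : measurable_fun [set: T * T] (fun p => h (mix j p)) by exact: measurableT_comp.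
have ihm : (mu \x mu)%E.-integrable [set: T * T] (EFin \o (fun p => h (mix j p))).
  have H1 : (mu \x mu)%E [set: T * T] = 1%E.
    rewrite -setXTT product_measure1E//.
    by have := probability_setT mu => /= ->; rewrite mule1.
  apply: measurable_bounded_integrable => //.
    by rewrite [X in (X < _)%E](_ : _ = 1%E) ?ltry//; exact: H1.
  by exists M; split; [exact: num_real|move=> M' MM' p _; apply: le_trans (hM _) _; exact: ltW].
by apply: (measurableT_comp (@fine_measurable R _ measurableT)) (measurable_fubini_F ihm).
Qed.

Lemma truncate_bounded (phi : T -> R[i]) (M : R) : cmeas phi ->
  (\forall x \ae mu, normc (phi x) <= M) -> 0 <= M ->
  exists g, [/\ cmeas g, forall x, normc (g x) <= M & \forall x \ae mu, g x = phi x].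
Proof.
move=> mphi phiM M0; pose A := [set x : T | normc (phi x) <= M].
have mA : measurable A.
  rewrite (_ : A = setT `&` (fun x => normc (phi x)) @^-1` `]-oo, M]%classic).
    by apply: (cmeas_normc mphi) => //; exact: measurable_itv.
  by rewrite setTI; apply/seteqP; split => x /=; rewrite in_itv.
exists (fun x => cindic A x * phi x); split.
- by apply: cmeasM => //; exact: cmeas_cindic.
- move=> x; rewrite normcM normcR indicE.
  case: (boolP (x \in A)) => [|_]; last by rewrite normr0 mul0r.
  by rewrite inE normr1 mul1r.
- apply: filterS phiM => x h.
  by rewrite /cindic indicE mem_set// mul1r.
Qed.

(** Subtracting the average over the [j]-th coordinate kills exactly the
    frequencies [k] with [k_j = 0]. *)
Lemma remove_zero_coord (phi : T -> R[i]) (M : R) (j : 'I_d) : cmeas phi ->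
  (\forall x \ae mu, normc (phi x) <= M) ->
  exists psi, [/\ cmeas psi, exists M', \forall x \ae mu, normc (psi x) <= M' &
    forall k, fourier_coef psi k = if tnth k j != 0 then fourier_coef phi k else 0].
Proof.
move=> mphi phiM.
have [||g [mg gM gphi]] := @truncate_bounded phi `|M| mphi; last 1 first.
- (* The average over the [j]-th coordinate. *)
  pose h x := cintegral mu (fun z => g (mix j (x, z))).
  have mgx x : cmeas (fun z => g (mix j (x, z))).
    have mm : measurable_fun [set: T] (fun z => mix j (x, z)) by exact: measurableT_comp.
    by have [m1 m2] := mg; split; [exact: (measurableT_comp m1 mm)|exact: (measurableT_comp m2 mm)].
  have hM x : normc (h x) <= `|M|.
    by apply: normc_cintegral_ae_le => //; apply: nearW => z.
  have mh : cmeas h.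
    have [g1 g2] := mg; split.
      apply: (@measurable_partial_integral j (fun x => complex.Re (g x)) `|M| g1) => x.
      by rewrite (le_trans (normc_Re _)).
    apply: (@measurable_partial_integral j (fun x => complex.Im (g x)) `|M| g2) => x.
    by rewrite (le_trans (normc_Im _)).
  have ig : cintegrable mu g by apply: (@cintegrable_bounded _ _ _ mu g `|M| mg); exact: nearW.
  have ih : cintegrable mu h by apply: (@cintegrable_bounded _ _ _ mu h `|M| mh); exact: nearW.
  have mek k : cmeas (fun x : T => (echar k x : R[i])^*) by exact/cmeasJ/cmeas_echar.
  have hk k : fourier_coef h k = if tnth k j != 0 then 0 else fourier_coef phi k.
    rewrite -(fourier_coef_ae k mg mphi gphi).
    case: eqVneq => kj /=; rewrite !fourier_coefE.
      rewrite [RHS](@cintegral_mix _ _ j _ `|M|); first last.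
      - by move=> x; rewrite normcM normcJ normc_echar mulr1.
      - exact: cmeasM.
      congr cintegral; apply/funext => x.
      rewrite mulrC -cintegralZ; last by apply: (cintegrable_bounded (mgx x)); apply: nearW => z; exact: gM.
      congr cintegral; apply/funext => z; rewrite mulrC; congr (_ * _^*).
      rewrite echar_mix kj mul0r cis0 mulr1 /echar (bigD1 j)//= kj mul0r add0r//.
    rewrite (@cintegral_mix _ _ j _ `|M|); first last.
    - by move=> x; rewrite normcM normcJ normc_echar mulr1.
    - exact: cmeasM.
    rewrite -[RHS](cintegral_cst mu); congr cintegral; apply/funext => x.
    have hmix z : h (mix j (x, z)) = h x.
      congr cintegral; apply/funext => w; congr g.
      by apply: eq_from_tnth => i; rewrite !tnth_mix/=; case: (i == j).
    under eq_fun do rewrite hmix echar_mix conjcM mulrA.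
    rewrite cintegralZ.
      rewrite cintegralJ ?cintegral_cis_coord ?conjc0 ?mulr0//.
      apply: (@cintegrable_bounded _ _ _ mu _ 1 (cmeas_cis_coord _ _)).
      by apply: nearW => z; rewrite normc_cis.
    apply: (@cintegrable_bounded _ _ _ mu _ 1 (cmeasJ (cmeas_cis_coord _ _))).
    by apply: nearW => z; rewrite normcJ normc_cis.
  exists (fun x => -1 * h x + g x); split.
  + by apply: cmeasD => //; apply: cmeasM => //; exact: cmeas_cst.
  + exists (normc (-1) * `|M| + `|M|); apply: nearW => x.
    by rewrite (le_trans (normcZD_le _ _ _))// lerD// ler_wpM2l ?normc_ge0.
  + move=> k; rewrite (@fourier_coefZD _ _ (-1) h g k ih ig) hk (fourier_coef_ae k mg mphi gphi).
    by case: (tnth k j != 0); rewrite ?mulr0 ?add0r ?mulN1r ?addNr.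
- by apply: filterS phiM => x h; rewrite (le_trans h)// ler_norm.
- by [].
Qed.

Lemma remove_frequencies (phi : T -> R[i]) (M : R) : cmeas phi ->
  (\forall x \ae mu, normc (phi x) <= M) ->
  exists psi, [/\ cmeas psi, exists M', \forall x \ae mu, normc (psi x) <= M' &
    forall k, fourier_coef psi k =
      if [forall j, tnth k j != 0] then fourier_coef phi k else 0].
Proof.
move=> mphi phiM.
suff [psi [m1 m2 h]] : exists psi, [/\ cmeas psi,
    exists M', \forall x \ae mu, normc (psi x) <= M' &
    forall k, fourier_coef psi k =
      if all (fun j => tnth k j != 0) (enum 'I_d) then fourier_coef phi k else 0].
  exists psi; split => // k; rewrite h; congr (if _ then _ else _).
  apply/allP/forallP => [hk j|hk j _]; last exact: hk.
  by apply: hk; rewrite mem_enum.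
elim: (enum _) => [|j s [psi [m1 [M' m2] IH]]].
  by exists phi; split => //; exists M.
have [psi' [m1' m2' h]] := remove_zero_coord j m1 m2.
exists psi'; split => // k; rewrite h IH /=.
by case: (tnth k j != 0).
Qed.

End RemoveFrequencies.

(** * The Bernoulli kernel *)

Section BernoulliSeries.
Context {R : realType}.
Implicit Types (m N : nat) (t : R).

Lemma inv_sq_le_telescope N : (N.+2%:R ^- 2 : R) <= N.+1%:R^-1 - N.+2%:R^-1.
Proof.
rewrite -[N.+2%:R]natr1; have N0 : 0 < N.+1%:R :> R by [].
set a := N.+1%:R in N0 *; rewrite -subr_ge0.
have -> : a^-1 - (a + 1)^-1 - (a + 1) ^- 2 = a^-1 * (a + 1) ^- 2.
  by field; rewrite !gt_eqF// addr_gt0.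
by rewrite mulr_ge0// invr_ge0 ?exprn_ge0 ?addr_ge0 ?ltW.
Qed.

Lemma sum_inv_sq_le N : \sum_(i < N) (i.+1%:R ^- 2 : R) <= 2.
Proof.
case: N => [|N]; first by rewrite big_ord0.
suff : \sum_(i < N.+1) (i.+1%:R ^- 2 : R) <= 2 - N.+1%:R^-1.
  by move/le_trans; apply; rewrite gerBl invr_ge0.
elim: N => [|N IH]; first by rewrite big_ord1 expr1n invr1; lra.
rewrite big_ord_recr/=; have := inv_sq_le_telescope N; move: IH.
by set a := \sum_(i < _) _; set b := _ ^-1; set c := _ ^-1; set e := _ ^-1; lra.
Qed.

Lemma cvg_series_inv_sq (u : nat -> R) : (forall i, `|u i| <= i.+1%:R ^- 2) ->
  cvgn (series u).
Proof.
move=> hu; apply: normed_cvg.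
apply: (@series_le_cvg _ _ (fun i => i.+1%:R ^- 2)) => //.
  by move=> n; exact: normr_ge0.
apply: nondecreasing_is_cvgn.
  by apply/nondecreasing_series => n _ _; rewrite invr_ge0 exprn_ge0.
exists 2 => _ [N _ <-].
by rewrite /series/= big_mkord sum_inv_sq_le.
Qed.

Definition bern_sum m N t : R :=
  \sum_(i < N) (i.+1%:R ^- m * cos (i.+1%:R * t - m%:R * pi / 2)).

Lemma cis_natmul n t : cis (n%:R * t) = cis t ^+ n.
Proof.
elim: n => [|n IH]; first by rewrite mul0r cis0 expr0.
by rewrite mulrS mulrDl mul1r cisD IH exprS.
Qed.

(** For [m = 1] the series is only conditionally convergent: after multiplication
    by [2 sin (t/2)], summation by parts turns it into an absolutely convergent one. *)
Lemma cvg_bern_sum m t : (0 < m)%N -> cvgn (bern_sum m ^~ t).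
Proof.
have bE u N : bern_sum u N t = series (fun i => i.+1%:R ^- u * cos (i.+1%:R * t - u%:R * pi / 2)) N.
  by rewrite /series/= big_mkord.
case: m => [//|[_|m _]]; last first.
  under eq_fun do rewrite bE; apply: cvg_series_inv_sq => i.
  rewrite normrM ger0_norm ?invr_ge0 ?exprn_ge0//.
  rewrite (le_trans (ler_wpM2l _ (cos_max _))) ?invr_ge0 ?exprn_ge0// mulr1.
  rewrite lef_pV2 ?posrE ?exprn_gt0// ler_weXn2l//.
  by rewrite ler1n.
have E N : bern_sum 1 N t = \sum_(i < N) (i.+1%:R^-1 * sin (i.+1%:R * t)).
  by apply: eq_bigr => i _; rewrite expr1 mul1r cosBpihalf.
have [s0|s0] := eqVneq (sin (t / 2)) 0.
  have c1 : cis t = 1.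
    have t2 : t = t / 2 + t / 2 by field.
    have := cos2Dsin2 (t / 2); rewrite s0 expr0n addr0 expr2 => cc.
    by rewrite t2 /cis cosD sinD s0 cc !(mul0r, mulr0) subr0 addr0.
  under eq_fun => N.
    rewrite E big1; last first.
      move=> i _; have := cis_natmul i.+1 t; rewrite c1 expr1n => -[_ ->].
      by rewrite mulr0.
    over.
  exact: is_cvg_cst.
(* [2 sin (t/2) sin (k t)] is the difference [C (k - 1) - C k]. *)
pose C i := cos ((i%:R + 2^-1) * t).
pose A N := series (fun i => C i.+1 * (i.+1%:R^-1 - i.+2%:R^-1)) N.
have main N : 2 * sin (t / 2) * bern_sum 1 N t = C 0%N - C N / N.+1%:R - A N.
  rewrite E mulr_sumr /A /series/= big_mkord.
  elim: N => [|N IH]; first by rewrite !big_ord0 divr1 subrr subr0.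
  rewrite !big_ord_recr/= IH.
  have -> : 2 * sin (t / 2) * (N.+1%:R^-1 * sin (N.+1%:R * t)) = (C N - C N.+1) / N.+1%:R.
    rewrite /C.
    have -> : (N%:R + 2^-1) * t = N.+1%:R * t - t / 2 by rewrite -natr1; field.
    have -> : (N.+1%:R + 2^-1) * t = N.+1%:R * t + t / 2 by field.
    by rewrite cosB cosD; ring.
  ring.
have -> : bern_sum 1 ^~ t = fun N => (2 * sin (t / 2))^-1 * (C 0%N - C N / N.+1%:R - A N).
  by apply/funext => N; rewrite -main mulKf// mulf_neq0// pnatr_eq0.
apply: is_cvgMr; apply: is_cvgB; first apply: is_cvgB.
- exact: is_cvg_cst.
- apply/cvg_ex; exists 0; apply/cvgr0Pnorm_le => e e0.
  have := @cvg_harmonic R; move/cvgr0Pnorm_le => /(_ e e0).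
  apply: filterS => N /=; apply: le_trans.
  rewrite normrM -[leRHS]mul1r [`|_^-1|]ger0_norm ?invr_ge0//.
  by rewrite ler_wpM2r ?invr_ge0// cos_max.
- apply: cvg_series_inv_sq => i.
  have i0 : 0 < i.+1%:R :> R by [].
  rewrite normrM -[i.+2%:R]natr1; set a := i.+1%:R in i0 *.
  have -> : a^-1 - (a + 1)^-1 = (a * (a + 1))^-1.
    by field; rewrite !gt_eqF// addr_gt0.
  have p0 : 0 <= (a * (a + 1))^-1 by rewrite invr_ge0 mulr_ge0 ?addr_ge0 ?ltW.
  rewrite [`|_^-1|]ger0_norm// (le_trans (ler_wpM2r p0 (cos_max _)))// mul1r.
  rewrite lef_pV2 ?posrE ?mulr_gt0 ?addr_gt0//.
  by rewrite expr2 ler_pM2l// lerDl.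
Qed.

End BernoulliSeries.

Section NonzeroBoxes.
Variable d : nat.
Implicit Types (k : d.-tuple int) (N : nat).

Definition signed_index N (p : 'I_N * bool) : int :=
  if p.2 then (p.1.+1)%:Z else - (p.1.+1)%:Z.

Lemma signed_index_inj N : injective (@signed_index N).
Proof.
move=> [i b] [i' b'] e.
have ei : i = i'.
  apply/ord_inj/succn_inj; have := congr1 absz e.
  by rewrite /signed_index/=; case: b {e}; case: b'; rewrite ?abszN.
move: e; rewrite ei /signed_index/=.
by case: b; case: b' => // /eqP; rewrite ?[_ == - _]eq_sym -subr_eq0 ?opprK; case: (i') => /=; lia.
Qed.

Lemma absz_signed_index N (p : 'I_N * bool) : `|signed_index p|%N = p.1.+1.
Proof. by rewrite /signed_index; case: ifP => _; rewrite ?abszN. Qed.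

Lemma signed_index_surj N (z : int) : z != 0 -> (`|z| <= N)%N ->
  exists p : 'I_N * bool, signed_index p = z.
Proof.
case: z => [[|n]|n] //= _ nN; first by exists (Ordinal nN, true).
by exists (Ordinal nN, false); rewrite /signed_index/= NegzE.
Qed.

Definition nonzero_box N : seq (d.-tuple int) :=
  [seq [tuple signed_index (f j) | j < d]
    | f : {ffun 'I_d -> 'I_N * bool} <- enum {ffun 'I_d -> 'I_N * bool}].

Lemma nonzero_box_uniq N : uniq (nonzero_box N).
Proof.
rewrite map_inj_uniq ?enum_uniq// => f g /(congr1 (fun t => tnth t)) fg.
by apply/ffunP => j; apply: signed_index_inj; have := congr1 (@^~ j) fg; rewrite !tnth_mktuple.
Qed.

Lemma mem_nonzero_box N k :
  (k \in nonzero_box N) = [forall j, (tnth k j != 0) && (`|tnth k j| <= N)%N].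
Proof.
apply/mapP/forallP => [[f _ ->] j|h].
  rewrite tnth_mktuple absz_signed_index ltn_ord andbT.
  by rewrite -absz_eq0 absz_signed_index.
have hp j : exists p : 'I_N * bool, signed_index p == tnth k j.
  by have /andP[h0 h1] := h j; have [p <-] := signed_index_surj h0 h1; exists p.
exists [ffun j => xchoose (hp j)]; first by rewrite mem_enum.
by apply: eq_from_tnth => j; rewrite tnth_mktuple ffunE (eqP (xchooseP (hp j))).
Qed.

Lemma nonzero_box_mono N M : (N <= M)%N -> {subset nonzero_box N <= nonzero_box M}.
Proof.
move=> NM k; rewrite !mem_nonzero_box => /forallP h; apply/forallP => j.
by have /andP[-> h1] := h j; exact: leq_trans NM.
Qed.

Lemma nonzero_boxP k : nonzero_freq k ->
  exists N0, forall N, (N0 <= N)%N -> k \in nonzero_box N.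
Proof.
move=> hk; exists (\max_(j < d) `|tnth k j|%N) => N hN.
rewrite mem_nonzero_box; apply/forallP => j; apply/andP; split; first exact: hk.
by apply: leq_trans hN; exact: (@leq_bigmax _ (fun j => `|tnth k j|%N)).
Qed.

(** Turns the product of one-dimensional partial sums into a sum over a box of
    frequencies. *)
Lemma sum_nonzero_box (C : comNzSemiRingType) N (F : 'I_d -> int -> C) :
  \sum_(k <- nonzero_box N) \prod_(j < d) F j (tnth k j) =
  \prod_(j < d) \sum_(p : 'I_N * bool) F j (signed_index p).
Proof.
rewrite big_map bigA_distr_bigA/= big_enum/=; apply: eq_bigr => f _.
by apply: eq_bigr => j _; rewrite tnth_mktuple.
Qed.

End NonzeroBoxes.

Section BernoulliKernel.
Context {R : realType} (d m : nat).
Hypothesis m_gt0 : (0 < m)%N.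
Local Notation RR := (measurableTypeR R).
Local Notation T := (d.-tuple RR).
Local Notation mu := (@torus R d).
Implicit Types (k : d.-tuple int) (N : nat).

Definition lam1 (z : int) : R[i] :=
  (`|z|%N%:R ^- m)%:C * cis (- ((sgz z)%:~R * (m%:R * pi / 2))).

(** The Fourier coefficients of the Bernoulli kernel. *)
Definition lam k : R[i] := \prod_(j < d) lam1 (tnth k j).

Lemma normc_lam1 z : normc (lam1 z) = `|z|%N%:R ^- m.
Proof.
by rewrite normcM normc_cis mulr1 normcR ger0_norm// invr_ge0 exprn_ge0.
Qed.

Lemma normc_lam k : normc (lam k) = (omega m k)^-1.
Proof.
rewrite normc_prod /omega -prodfV; apply: eq_bigr => j _.
by rewrite normc_lam1 -intr_norm -abszE.
Qed.

Lemma omega_gt0 k : nonzero_freq k -> 0 < omega (R := R) m k.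
Proof.
move=> hk; apply: prodr_gt0 => j _; rewrite exprn_gt0// normr_gt0 intr_eq0; exact: hk.
Qed.

Lemma lam_neq0 k : nonzero_freq k -> lam k != 0.
Proof. by move=> hk; rewrite -normc_eq0 normc_lam invr_eq0 gt_eqF// omega_gt0. Qed.

Lemma bern_sum_cis N (t : R) : (2 * bern_sum m N t)%:C =
  \sum_(p : 'I_N * bool) lam1 (signed_index p) * cis ((signed_index p)%:~R * t).
Proof.
rewrite -(pair_big xpredT xpredT (fun i b =>
  lam1 (signed_index (i, b)) * cis ((signed_index (i, b))%:~R * t)))/=.
rewrite /bern_sum mulr_sumr rmorph_sum; apply: eq_bigr => i _.
rewrite big_bool /lam1 /signed_index /=.
rewrite sgzN gtr0_sgz// mul1r mulN1r opprK mulrNz mulNr.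
set th := m%:R * pi / 2; set s := i.+1%:~R * t.
rewrite -!mulrA -!cisD -mulrDr rmorphM rmorphM mulrCA; congr (_ * _).
rewrite -[th - s]opprB [- th + s]addrC.
by apply: complex_eqP; rewrite /= ?cosN ?sinN; ring.
Qed.

Lemma echar_sub k (x y : T) :
  echar k x * (echar k y)^* = \prod_(j < d) cis ((tnth k j)%:~R * ((tnth x j : R) - tnth y j)) :> R[i].
Proof.
rewrite /echar -cisN -cisD -sumrN -big_split -cis_sum; congr cis.
by apply: eq_bigr => j _ /=; rewrite mulrBr.
Qed.

Definition kernel_sum N (t : 'I_d -> R) : R := \prod_(j < d) (2 * bern_sum m N (t j)).

Lemma kernel_sumE N (x y : T) :
  (kernel_sum N (fun j => (tnth x j : R) - tnth y j))%:C =
  \sum_(k <- nonzero_box d N) lam k * (echar k x * (echar k y)^*).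
Proof.
rewrite /kernel_sum rmorph_prod.
under eq_bigr do rewrite /= bern_sum_cis.
rewrite -(sum_nonzero_box N (fun j z => lam1 z * cis (z%:~R * ((tnth x j : R) - tnth y j)))).
by apply: eq_bigr => k _; rewrite big_split/= echar_sub.
Qed.

Lemma cvg_kernel_sum (t : 'I_d -> R) :
  kernel_sum N t @[N --> \oo] --> bernoulli_kernel m t.
Proof.
have E N : \sum_(k : d.-tuple 'I_N) \prod_(j < d)
    (((tnth k j).+1%:R ^- m) * cos ((tnth k j).+1%:R * t j - m%:R * pi / 2)) =
    \prod_(j < d) bern_sum m N (t j).
  rewrite bigA_distr_bigA/=.
  rewrite (reindex (fun f : {ffun 'I_d -> 'I_N} => [tuple f j | j < d])) /=.
    by apply: eq_bigr => f _; apply: eq_bigr => j _; rewrite tnth_mktuple.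
  exists (fun k : d.-tuple 'I_N => [ffun j => tnth k j]) => [f _|k _].
    by apply/ffunP => j; rewrite ffunE tnth_mktuple.
  by apply: eq_from_tnth => j; rewrite tnth_mktuple ffunE.
have c : (fun N => \prod_(j < d) bern_sum m N (t j)) @ \oo -->
    \prod_(j < d) limn (bern_sum m ^~ (t j)).
  elim: (index_enum _) => [|j s IH].
    by under eq_fun do rewrite big_nil; rewrite big_nil; exact: cvg_cst.
  rewrite big_cons; under eq_fun do rewrite big_cons.
  by apply: cvgM => //; exact: cvg_bern_sum.
rewrite /bernoulli_kernel [limn _](_ : _ = \prod_(j < d) limn (bern_sum m ^~ (t j))); last first.
  rewrite -(cvg_lim _ c)//; congr (lim (_ @ \oo)); apply/funext => N; exact: E.
rewrite /kernel_sum; under eq_fun do rewrite big_split/= prodr_const card_ord.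
by apply: cvgM => //; exact: cvg_cst.
Qed.

End BernoulliKernel.

Lemma le0_of_cvg0 (R : realType) (a : R) (u : nat -> R) N0 :
  (forall N, (N0 <= N)%N -> a <= u N) -> u @ \oo --> (0 : R) -> a <= 0.
Proof.
move=> au u0; apply/ler_addgt0Pr => e e0; rewrite add0r.
have [N _ h] := cvgr_lt _ u0 e e0.
exact: le_trans (au _ (leq_maxl N0 N)) (ltW (h _ (leq_maxr N0 N))).
Qed.

Section MeanSquare.
Context d (T : measurableType d) (R : realType).
Variable mu : probability T R.

Lemma Rintegral_sq_le (h : T -> R) :
  mu.-integrable [set: T] (EFin \o h) ->
  mu.-integrable [set: T] (EFin \o (fun x => h x ^+ 2)) ->
  (\int[mu]_x h x) ^+ 2 <= \int[mu]_x (h x ^+ 2).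
Proof.
move=> ih ih2; set a := \int[mu]_x h x.
have i1 : mu.-integrable [set: T] (EFin \o (fun x => - 2 * a * h x)).
  exact: (@integrableZl _ _ _ mu _ measurableT (- 2 * a) (EFin \o h)).
have i2 : mu.-integrable [set: T] (EFin \o (fun x => h x ^+ 2 + - 2 * a * h x)).
  exact: (@integrableD _ _ _ mu _ measurableT _ _ ih2 i1).
have : 0 <= \int[mu]_x (h x ^+ 2 + - 2 * a * h x + a ^+ 2).
  by apply: Rintegral_ge0 => x _; have := sqr_ge0 (h x - a); nra.
rewrite RintegralD//; last exact: (integrableR_cst mu).
rewrite RintegralD// RintegralZl// Rintegral_cstT -/a.
by set b := \int[mu]_x _; nra.
Qed.

End MeanSquare.

Section Convolution.
Context {R : realType} (d m : nat).
Hypothesis m_gt0 : (0 < m)%N.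
Local Notation RR := (measurableTypeR R).
Local Notation T := (d.-tuple RR).
Local Notation mu := (@torus R d).
Local Notation muM := (mu : {measure set _ -> \bar R}).
Local Notation lam := (lam (R := R) m (d := d)).
Implicit Types (k : d.-tuple int) (N : nat) (x y : T).

Definition kernel x y : R[i] :=
  (bernoulli_kernel m (fun j => (tnth x j : R) - (tnth y j : R)))%:C.

Definition kernel_coef x k : R[i] := (lam k * echar k x)^*.

Lemma trig_kernel N x y : trig (nonzero_box d N) (kernel_coef x) y =
  (kernel_sum m N (fun j => (tnth x j : R) - tnth y j))%:C.
Proof.
rewrite -[RHS]conjc_real kernel_sumE// conj_sum; apply: eq_bigr => k _.
by rewrite mulrA conjcM conjcKK.
Qed.

Lemma cvg_trig_kernel x y :
  normc (trig (nonzero_box d N) (kernel_coef x) y - kernel x y) @[N --> \oo] --> (0 : R).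
Proof.
rewrite (_ : (fun N => _) = fun N => `|kernel_sum m N (fun j => (tnth x j : R) - tnth y j)
   - bernoulli_kernel m (fun j => (tnth x j : R) - (tnth y j : R))|); last first.
  by apply/funext => N; rewrite trig_kernel -rmorphB normcR.
rewrite -[X in _ --> X](@normr0 _ R); apply: cvg_norm.
rewrite -[X in _ --> X](subrr (bernoulli_kernel m (fun j => (tnth x j : R) - (tnth y j : R)))).
by apply: cvgB; [exact: cvg_kernel_sum|exact: cvg_cst].
Qed.

Definition energy N : R := \sum_(k <- nonzero_box d N) normc (lam k) ^+ 2.

Lemma energy_mono : nondecreasing_seq energy.
Proof.
move=> N M NM; rewrite /energy.
rewrite [leRHS](bigID (mem (nonzero_box d N)))/= -[leLHS]addr0 lerD//; last first.
  by apply: sumr_ge0 => k _; rewrite sqr_ge0.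
rewrite -[in leRHS]big_filter le_eqVlt; apply/orP; left; apply/eqP; apply: perm_big.
apply: uniq_perm; rewrite ?filter_uniq ?nonzero_box_uniq// => k.
by rewrite mem_filter; case: (boolP (k \in nonzero_box d N)) => //= /(nonzero_box_mono NM) ->.
Qed.

Lemma energy_le N : energy N <= 4 ^+ d.
Proof.
rewrite /energy.
under eq_bigr => k _ do rewrite normc_prod -prodrXl.
rewrite (sum_nonzero_box N (fun (j : 'I_d) z => normc (lam1 m z : R[i]) ^+ 2)).
rewrite -[in leRHS](card_ord d) -prodr_const; apply: ler_prod => j _.
rewrite sumr_ge0/=; last by move=> p _; rewrite sqr_ge0.
rewrite -(pair_big xpredT xpredT (fun i b => normc (lam1 m (signed_index (i, b)) : R[i]) ^+ 2))/=.
rewrite (@le_trans _ _ (\sum_(i < N) 2 * i.+1%:R ^- 2))//; last first.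
  have -> : (4 : R) = 2 * 2 by rewrite -natrM.
  by rewrite -mulr_sumr ler_wpM2l// sum_inv_sq_le.
apply: ler_sum => i _; rewrite big_bool !normc_lam1 !absz_signed_index/=.
have : (i.+1%:R ^- m) ^+ 2 <= i.+1%:R ^- 2 :> R.
  rewrite -exprVn -exprM exprVn lef_pV2 ?posrE ?exprn_gt0//.
  by rewrite ler_weXn2l ?ler1n// mulnC leq_pmulr.
by move=> h; rewrite mulr_natl mulr2n lerD.
Qed.

Definition tail N : R := limn energy - energy N.

Lemma cvg_energy : energy @ \oo --> limn energy.
Proof.
apply: nondecreasing_is_cvgn; first exact: energy_mono.
by exists (4 ^+ d) => _ [N _ <-]; exact: energy_le.
Qed.

Lemma energy_le_lim N : energy N <= limn energy.
Proof. by apply: nondecreasing_cvgn_le; [exact: energy_mono|exact: cvg_energy]. Qed.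

Lemma cvg_sqrt_tail : Num.sqrt (tail N) @[N --> \oo] --> (0 : R).
Proof.
rewrite -[X in _ --> X](@sqrtr0 R).
have ct : tail @ \oo --> (0 : R).
  rewrite /tail -[X in _ --> X](subrr (limn energy)).
  by apply: cvgB; [exact: cvg_cst|exact: cvg_energy].
exact: (cvg_comp _ _ ct (@sqrt_continuous R 0)).
Qed.

Lemma cmeas_lim (F : nat -> T -> R[i]) f : (forall n, cmeas (F n)) ->
  (forall x, normc (F n x - f x) @[n --> \oo] --> (0 : R)) -> cmeas f.
Proof.
move=> mF Ff.
have c (p : R[i] -> R) : (forall z w, `|p z - p w| <= normc (z - w)) ->
    forall x, p (F n x) @[n --> \oo] --> p (f x).
  move=> hp x; apply/cvgrPdist_lt => e e0.
  by apply: filterS (cvgr_lt _ (Ff x) e e0) => n; apply: le_lt_trans; rewrite distrC.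
split.
  apply: (@measurable_fun_cvg _ _ _ _ (fun n x => complex.Re (F n x))).
    by move=> n; have [] := mF n.
  by move=> x _; apply: c => z w; rewrite -cReB normc_Re.
apply: (@measurable_fun_cvg _ _ _ _ (fun n x => complex.Im (F n x))).
  by move=> n; have [] := mF n.
by move=> x _; apply: c => z w; rewrite -cImB normc_Im.
Qed.

Lemma cmeas_kernel x : cmeas (kernel x).
Proof.
by apply: (@cmeas_lim (fun N => trig (nonzero_box d N) (kernel_coef x)));
  [move=> N; exact: cmeas_trig|exact: cvg_trig_kernel].
Qed.

Lemma normc_kernel_coef x k : normc (kernel_coef x k) = normc (lam k).
Proof. by rewrite normcJ normcM normc_echar mulr1. Qed.

(** Two partial sums differ by an orthogonal sum of energy at most the tail, and
    Fatou's lemma passes to the pointwise limit. The bound is uniform in [x]. *)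
Lemma kernel_tail N x :
  (\int[mu]_y (normc (kernel x y - trig (nonzero_box d N) (kernel_coef x) y) ^+ 2)%:E
   <= (tail N)%:E)%E.
Proof.
set tN := trig (nonzero_box d N) (kernel_coef x).
pose g M := trig (nonzero_box d (N + M)) (kernel_coef x).
have mg M : cmeas (g M) by exact: cmeas_trig.
apply: (@fatou_normc2 _ _ _ mu (fun M y => g M y - tN y)).
- by move=> M; apply: cmeasB => //; exact: cmeas_trig.
- by apply: cmeasB; [exact: cmeas_kernel|exact: cmeas_trig].
- move=> M.
  have bg y : normc (g M y - tN y) <= \sum_(k <- nonzero_box d (N + M)) normc (kernel_coef x k) +
     \sum_(k <- nonzero_box d N) normc (kernel_coef x k).
    by rewrite (le_trans (le_normcD _ _))// normcN lerD// normc_trig_le.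
  have ig2 (f : T -> R[i]) B : cmeas f -> (forall y, normc (f y) <= B) ->
      mu.-integrable [set: T] (EFin \o (fun y => normc (f y) ^+ 2)).
    move=> mf fB; apply: (@integrableR_le _ _ _ mu _ (fun=> B ^+ 2)).
    - by apply: measurable_funX; exact: cmeas_normc.
    - exact: integrableR_cst.
    - move=> y; rewrite ger0_norm ?sqr_ge0// ler_pXn2r ?nnegrE ?normc_ge0//.
      exact: le_trans (normc_ge0 _) (fB y).
  have i2 := ig2 _ _ (cmeasB (mg M) (cmeas_trig _ _)) bg.
  rewrite -(fineK (integrable_fin_num measurableT i2)) lee_fin.
  rewrite -[fine _]/(\int[mu]_y (normc (g M y - tN y) ^+ 2)).
  rewrite trig_distance ?nonzero_box_uniq//; last first.
    exact: (ig2 _ _ (mg M) (normc_trig_le _ _)).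
  rewrite trig_normsq ?nonzero_box_uniq//.
  have fg k : k \in nonzero_box d N -> fourier_coef (g M) k = kernel_coef x k.
    move=> kN; rewrite fourier_coef_trig ?nonzero_box_uniq//.
    by rewrite (nonzero_box_mono (leq_addr _ _) kN).
  rewrite [X in _ + X]big1_seq ?addr0; last first.
    by move=> k /andP[_ kN]; rewrite fg// subrr normc0 expr0n.
  have e1 : \sum_(k <- nonzero_box d N) normc (fourier_coef (g M) k) ^+ 2 = energy N.
    by apply: eq_big_seq => k kN; rewrite fg// normc_kernel_coef.
  rewrite e1 /tail lerD2r (le_trans _ (energy_le_lim (N + M)))// /energy.
  rewrite le_eqVlt; apply/orP; left; apply/eqP; apply: eq_bigr => k _.
  by rewrite normc_kernel_coef.
- move=> y; have h := cvg_trig_kernel x y; rewrite -(cvg_shiftn N) in h.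
  rewrite (_ : (fun n => _) = fun n =>
    normc (trig (nonzero_box d (n + N)) (kernel_coef x) y - kernel x y)); first exact: h.
  by apply/funext => n; rewrite opprB addrA subrK /g addnC.
Qed.

Lemma kernel_normc2_integrable x :
  mu.-integrable [set: T] (EFin \o (fun y => normc (kernel x y) ^+ 2)).
Proof.
have mk := cmeas_kernel x.
have m2 f : cmeas f -> measurable_fun [set: T] (fun y => (normc (f y : R[i]) ^+ 2)%:E).
  by move=> mf; apply/measurable_EFinP; apply: measurable_funX; exact: cmeas_normc.
pose t0 := trig (nonzero_box d 0) (kernel_coef x).
pose B := \sum_(k <- nonzero_box d 0) normc (kernel_coef x k).
have md := cmeasB mk (cmeas_trig (nonzero_box d 0) (kernel_coef x)).
have i1 : mu.-integrable [set: T] (EFin \o (fun y => 2 * normc (kernel x y - t0 y) ^+ 2)).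
  apply: (@integrableZl _ _ _ mu _ measurableT 2 (EFin \o (fun y => normc (kernel x y - t0 y) ^+ 2))) => //.
  apply/integrableP; split; first exact: m2.
  apply: (@le_lt_trans _ _ (tail 0)%:E); last by rewrite ltry.
  apply: le_trans (kernel_tail 0 x); rewrite le_eqVlt; apply/orP; left; apply/eqP.
  by apply: eq_integral => y _ /=; rewrite ger0_norm ?sqr_ge0.
have i2 : mu.-integrable [set: T] (EFin \o (fun y => 2 * normc (kernel x y - t0 y) ^+ 2 + 2 * B ^+ 2)).
  exact: (@integrableD _ _ _ mu _ measurableT _ (EFin \o (fun=> 2 * B ^+ 2)) i1 (integrableR_cst mu _)).
apply: (integrableR_le _ i2).
  by apply: measurable_funX; exact: cmeas_normc.
move=> y; rewrite ger0_norm ?sqr_ge0//.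
rewrite -[kernel x y](subrK (t0 y)) (le_trans (normcDsq _ _))// addrK lerD2l ler_pM2l//.
have h : normc (t0 y) <= B by exact: normc_trig_le.
by rewrite ler_pXn2r ?nnegrE ?normc_ge0// (le_trans (normc_ge0 _) h).
Qed.

Section OfBoundedFunction.
Variables (phi : T -> R[i]) (C : R).
Hypotheses (mphi : cmeas phi) (phiC : \forall x \ae mu, normc (phi x) <= C) (C0 : 0 <= C).

Lemma kernel_product_integrable x : cintegrable mu (fun y => phi y * kernel x y).
Proof.
have ik := cintegrable_of_normc2 (cmeas_kernel x) (kernel_normc2_integrable x).
apply: (@cintegrable_ae_le _ _ _ mu _ (fun y => C * normc (kernel x y))).
- by apply: cmeasM => //; exact: cmeas_kernel.
- apply: (@integrableZl _ _ _ mu _ measurableT C (EFin \o (fun x0 => normc (kernel x x0)))) => //.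
  exact: integrable_normc.
- by apply: filterS phiC => y h; rewrite normcM ler_wpM2r ?normc_ge0.
Qed.

Definition convolution x : R[i] := cintegral mu (fun y => phi y * kernel x y).

Definition conv_coef k : R[i] := lam k * fourier_coef phi k.

(** Cauchy-Schwarz against [kernel_tail]: the convolution is the uniform limit of the
    partial sums of its Fourier series. *)
Lemma convolution_approx N x :
  normc (convolution x - trig (nonzero_box d N) conv_coef x) <= C * Num.sqrt (tail N).
Proof.
set tN := trig (nonzero_box d N) (kernel_coef x).
have ip : cintegrable mu phi by exact: (cintegrable_bounded mphi phiC).
have ik := cintegrable_of_normc2 (cmeas_kernel x) (kernel_normc2_integrable x).
have ikt : cintegrable mu (fun y => kernel x y - tN y).
  by apply: cintegrableB => //; exact: cintegrable_trig.
have mkt := cintegrable_meas ikt.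
have tNJ y : (tN y)^* = tN y by rewrite /tN trig_kernel conjc_real.
have bt y : normc (tN y) <= \sum_(k <- nonzero_box d N) normc (kernel_coef x k).
  exact: normc_trig_le.
have -> : trig (nonzero_box d N) conv_coef x = cintegral mu (fun y => phi y * tN y).
  transitivity (cintegral mu (fun y => phi y * (tN y)^* )); last first.
    by congr cintegral; apply/funext => y; rewrite tNJ.
  rewrite cintegral_trigJ//; apply: eq_bigr => k _.
  by rewrite conjcKK mulrAC.
rewrite -cintegralB; first last.
- exact: (cintegrableM_bounded ip (cmeas_trig _ _) bt).
- exact: kernel_product_integrable.
rewrite (_ : (fun y => _) = fun y => phi y * (kernel x y - tN y)); last first.
  by apply/funext => y; rewrite mulrBr.
have i1 : mu.-integrable [set: T] (EFin \o (fun y => C * normc (kernel x y - tN y))).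
  apply: (@integrableZl _ _ _ mu _ measurableT C (EFin \o (fun y => normc (kernel x y - tN y)))) => //.
  exact: integrable_normc.
have ig : cintegrable mu (fun y => phi y * (kernel x y - tN y)).
  apply: (cintegrable_ae_le _ i1); first exact: cmeasM.
  by apply: filterS phiC => y h; rewrite normcM ler_wpM2r ?normc_ge0.
apply: (le_trans (normc_cintegral ig)).
apply: (@le_trans _ _ (\int[mu]_y (C * normc (kernel x y - tN y)))).
  rewrite -lee_fin !fineK.
  - apply: ae_ge0_le_integral => //.
    + by move=> y _; rewrite lee_fin normc_ge0.
    + by apply/measurable_EFinP; apply: cmeas_normc; exact: cmeasM.
    + by move=> y _; rewrite lee_fin mulr_ge0 ?normc_ge0.
    + by have /integrableP[] := i1.
    + by apply: filterS phiC => y h _; rewrite lee_fin normcM ler_wpM2r ?normc_ge0.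
  - exact: (integrable_fin_num measurableT i1).
  - exact: (integrable_fin_num measurableT (integrable_normc ig)).
have inkt := integrable_normc ikt.
rewrite RintegralZl// ler_wpM2l//.
have i2 : mu.-integrable [set: T] (EFin \o (fun y => normc (kernel x y - tN y) ^+ 2)).
  apply/integrableP; split.
    by apply/measurable_EFinP; apply: measurable_funX; exact: cmeas_normc.
  apply: (@le_lt_trans _ _ (tail N)%:E); last by rewrite ltry.
  apply: le_trans (kernel_tail N x); rewrite le_eqVlt; apply/orP; left; apply/eqP.
  by apply: eq_integral => y _ /=; rewrite ger0_norm ?sqr_ge0.
have h0 : 0 <= \int[mu]_y normc (kernel x y - tN y).
  by apply: Rintegral_ge0 => y _; exact: normc_ge0.
rewrite -[leLHS]ger0_norm// -sqrtr_sqr ler_wsqrtr//.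
apply: (le_trans (Rintegral_sq_le inkt i2)).
by rewrite -lee_fin fineK; [exact: kernel_tail|exact: (integrable_fin_num measurableT i2)].
Qed.

Lemma cvg_convolution x :
  normc (trig (nonzero_box d N) conv_coef x - convolution x) @[N --> \oo] --> (0 : R).
Proof.
apply: (@squeeze_cvgr _ _ _ _ (cst 0) (fun N => C * Num.sqrt (tail N))).
- by apply: nearW => N; rewrite [X in X <= _]/cst normc_ge0/= normc_distC convolution_approx.
- exact: cvg_cst.
- rewrite -[X in _ --> X](mulr0 C); apply: cvgM; [exact: cvg_cst|exact: cvg_sqrt_tail].
Qed.

Lemma cmeas_convolution : cmeas convolution.
Proof.
by apply: (@cmeas_lim (fun N => trig (nonzero_box d N) conv_coef));
  [move=> N; exact: cmeas_trig|exact: cvg_convolution].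
Qed.

Lemma convolution_bounded : exists B, forall x, normc (convolution x) <= B.
Proof.
exists (C * Num.sqrt (tail 0) + \sum_(k <- nonzero_box d 0) normc (conv_coef k)) => x.
rewrite -[convolution x](subrK (trig (nonzero_box d 0) conv_coef x)).
by rewrite (le_trans (le_normcD _ _))// lerD ?convolution_approx ?normc_trig_le.
Qed.

Lemma cintegrable_convolution : cintegrable mu convolution.
Proof.
have [B hB] := convolution_bounded.
by apply: (cintegrable_bounded cmeas_convolution); apply: nearW; exact: hB.
Qed.

Lemma fourier_convolution k : nonzero_freq k ->
  fourier_coef convolution k = lam k * fourier_coef phi k.
Proof.
move=> hk; apply/eqP; rewrite -subr_eq0 -normc_eq0; apply/eqP.
have [N0 hN0] := nonzero_boxP hk.
have h N : (N0 <= N)%N ->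
    normc (fourier_coef convolution k - lam k * fourier_coef phi k) <= C * Num.sqrt (tail N).
  move=> NN; have kN := hN0 _ NN.
  have -> : lam k * fourier_coef phi k = fourier_coef (trig (nonzero_box d N) conv_coef) k.
    by rewrite fourier_coef_trig ?nonzero_box_uniq// kN.
  have ic := cintegrable_convolution.
  have it := cintegrable_trig (nonzero_box d N) conv_coef.
  rewrite !fourier_coefE -cintegralB; try exact: cintegrable_echarM.
  apply: normc_cintegral_ae_le.
  - by rewrite mulr_ge0// sqrtr_ge0.
  - by apply: cintegrable_meas; apply: cintegrableB; exact: cintegrable_echarM.
  - apply: nearW => x; rewrite -mulrBl normcM normcJ normc_echar mulr1.
    exact: convolution_approx.
apply/eqP; rewrite eq_le normc_ge0 andbT; apply: (le0_of_cvg0 h).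
by rewrite -[X in _ --> X](mulr0 C); apply: cvgM; [exact: cvg_cst|exact: cvg_sqrt_tail].
Qed.

End OfBoundedFunction.

(** Both sides are limits of the same partial sums. *)
Lemma convolution_unique (phi psi : T -> R[i]) (C D : R) : cmeas phi -> cmeas psi ->
  (\forall x \ae mu, normc (phi x) <= C) -> (\forall x \ae mu, normc (psi x) <= D) ->
  0 <= C -> 0 <= D ->
  (forall k, nonzero_freq k -> fourier_coef phi k = fourier_coef psi k) ->
  convolution phi =1 convolution psi.
Proof.
move=> m1 m2 b1 b2 C0 D0 h x; apply/eqP; rewrite -subr_eq0 -normc_eq0; apply/eqP.
apply/eqP; rewrite eq_le normc_ge0 andbT.
apply: (@le0_of_cvg0 _ _ (fun N => C * Num.sqrt (tail N) + D * Num.sqrt (tail N)) 0) => [N _|].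
  rewrite (le_trans (normc_tri _ (trig (nonzero_box d N) (conv_coef phi) x) _))//.
  rewrite lerD ?convolution_approx//.
  rewrite (_ : trig _ _ x = trig (nonzero_box d N) (conv_coef psi) x).
    by rewrite normc_distC convolution_approx.
  rewrite /trig big_seq [RHS]big_seq; apply: eq_bigr => k.
  rewrite mem_nonzero_box => /forallP hk; congr (_ * _); rewrite /conv_coef h// => j.
  by have /andP[] := hk j.
have c (A : R) : A * Num.sqrt (tail N) @[N --> \oo] --> (0 : R).
  by rewrite -[X in _ --> X](mulr0 A); apply: cvgM; [exact: cvg_cst|exact: cvg_sqrt_tail].
by rewrite -[X in _ --> X](addr0 0); apply: cvgD; exact: c.
Qed.

End Convolution.

(** * The mixed derivative and the norm of the Sobolev class *)

Section SobolevClass.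
Context {R : realType} (d m : nat).
Hypothesis m_gt0 : (0 < m)%N.
Local Notation RR := (measurableTypeR R).
Local Notation T := (d.-tuple RR).
Local Notation mu := (@torus R d).
Local Notation muM := (mu : {measure set _ -> \bar R}).
Local Notation lam := (lam (R := R) m (d := d)).
Local Notation SW := (@SW R d m).
Implicit Types (k : d.-tuple int) (f g : SW) (phi psi : cmfun T R).

Definition ae_bounded (phi : T -> R[i]) : Prop :=
  exists2 C, 0 <= C & \forall x \ae mu, normc (phi x) <= C.

Lemma essentially_boundedP phi : essentially_bounded phi <-> ae_bounded phi.
Proof.
split=> [/Linf_predP h|[C C0 hC]].
  exists (fine (Lp_norm +oo%E (\pi_(L0 muM) phi))).
    by rewrite fine_ge0// Linf_norm_ge0.
  by apply: filterS2 h (repr_piL0 muM phi) => x + <-.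
apply: (@Linf_pred_bounded _ _ _ mu _ C).
by apply: filterS2 hC (repr_piL0 muM phi) => x + ->.
Qed.

Lemma is_convP phi (f : L0 muM) : ae_bounded phi ->
  is_conv m phi f <-> \forall x \ae mu, repr f x = convolution m phi x.
Proof.
move=> [C C0 hC]; split; first by apply: filterS => x [].
apply: filterS => x e; split; last exact: e.
exact: (kernel_product_integrable m_gt0 (cmeasP phi) hC x).
Qed.

Definition is_derivative phi (f : L0 muM) : Prop :=
  [/\ essentially_bounded phi, is_conv m phi f &
    forall k, ~ nonzero_freq k -> fourier_coef phi k = 0].

Lemma mixed_derivativeP f : is_derivative (mixed_derivative f) f.
Proof.
suff ex : exists phi, is_derivative phi f.
  exact: (@xgetPex _ 0 (fun phi : cmfun T R => is_derivative phi f) ex).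
have /andP[_ /asboolP[phi phib fphi]] := SWP f.
have bphi := (essentially_boundedP phi).1 phib; have [C C0 hC] := bphi.
have [psi [mpsi [M psiM] hpsi]] := remove_frequencies (cmeasP phi) hC.
have bpsi : ae_bounded (mkcmfun mpsi).
  by exists `|M| => //; apply: filterS psiM => x h; rewrite (le_trans h)// ler_norm.
exists (mkcmfun mpsi); split.
- exact/essentially_boundedP.
- apply/is_convP => //; have/is_convP := fphi => /(_ bphi).
  apply: filterS => x ->; have [D D0 hD] := bpsi.
  apply: (convolution_unique m_gt0 (cmeasP phi) mpsi hC hD C0 D0) => k hk.
  rewrite /= hpsi ifT//; apply/forallP => j; exact: hk.
- move=> k hk; rewrite /= hpsi ifF//; apply/negP => /forallP h; apply: hk => j; exact: h.
Qed.

Lemma mixed_derivative_bounded f : ae_bounded (mixed_derivative f).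
Proof. by have [/essentially_boundedP] := mixed_derivativeP f. Qed.

Lemma fc_is_derivative phi (f : L0 muM) k : is_derivative phi f -> nonzero_freq k ->
  fc k f = lam k * fourier_coef phi k.
Proof.
move=> [/essentially_boundedP bphi hc _] hk; have [C C0 hC] := bphi.
rewrite -(fourier_convolution m_gt0 (cmeasP phi) hC C0 hk); apply: fourier_coef_ae.
- exact: cmeasP.
- exact: (cmeas_convolution m_gt0 (cmeasP phi) hC C0).
- exact/is_convP.
Qed.

(** By completeness of the characters, a class has at most one mixed derivative. *)
Lemma derivative_unique phi psi (f : L0 muM) :
  is_derivative phi f -> is_derivative psi f -> \forall x \ae mu, phi x = psi x.
Proof.
move=> hphi hpsi; have [bphi _ zphi] := hphi; have [bpsi _ zpsi] := hpsi.
have [C C0 hC] := (essentially_boundedP _).1 bphi.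
have [D D0 hD] := (essentially_boundedP _).1 bpsi.
have : annihilating (fun x => -1 * psi x + phi x).
  split.
  - by apply: cmeasD; [apply: cmeasM; [exact: cmeas_cst|]|]; exact: cmeasP.
  - exists (normc (-1 : R[i]) * D + C); apply: filterS2 hC hD => x h1 h2.
    by rewrite (le_trans (normcZD_le _ _ _))// lerD// ler_wpM2l ?normc_ge0.
  - move=> k; rewrite fourier_coefZD; first last.
    + exact: cintegrable_bounded (cmeasP _) hC.
    + exact: cintegrable_bounded (cmeasP _) hD.
    have [hk|hk] := pselect (nonzero_freq k); last by rewrite zphi// zpsi// mulr0 addr0.
    have := fc_is_derivative hphi hk; rewrite (fc_is_derivative hpsi hk).
    by move/(mulfI (lam_neq0 m hk)) => ->; rewrite mulN1r addNr.
move=> /annihilating_ae0; apply: filterS => x.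
by rewrite mulN1r addrC => /eqP; rewrite subr_eq0 => /eqP.
Qed.

Lemma normSW_ge0 f : 0 <= normSW f.
Proof. by rewrite fine_ge0// Linf_norm_ge0. Qed.

Lemma normSW_bound f : \forall x \ae mu, normc (mixed_derivative f x) <= normSW f.
Proof.
have [/Linf_predP h _ _] := mixed_derivativeP f.
by apply: filterS2 h (repr_piL0 muM (mixed_derivative f)) => x + <-.
Qed.

Lemma normSW_le f phi (M : R) : is_derivative phi f ->
  (\forall x \ae mu, normc (phi x) <= M) -> normSW f <= M.
Proof.
move=> hphi phiM; have hD := mixed_derivativeP f.
have h : (Lp_norm +oo%E (\pi_(L0 muM) (mixed_derivative f)) <= M%:E)%E.
  apply/(@Linf_norm_leP _ _ _ mu).
  apply: filterS3 phiM (derivative_unique hD hphi) (repr_piL0 muM (mixed_derivative f)).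
  by move=> x h e ->; rewrite e.
rewrite -lee_fin fineK// ge0_fin_numE ?Linf_norm_ge0//.
by apply: le_lt_trans h _; rewrite ltry.
Qed.

Lemma is_derivativeZD a phi psi (f g : L0 muM) :
  is_derivative phi f -> is_derivative psi g ->
  is_derivative (a *: phi + psi) (a *: f + g).
Proof.
move=> [b1 c1 z1] [b2 c2 z2]; split.
- by rewrite /essentially_bounded -L0_piD -L0_piZ rpredD ?rpredZ.
- exact: is_integral_transformZD.
- have [C C0 hC] := (essentially_boundedP _).1 b1.
  have [D D0 hD] := (essentially_boundedP _).1 b2.
  move=> k hk; have := @fourier_coefZD _ _ a _ _ k (cintegrable_bounded (cmeasP phi) hC)
     (cintegrable_bounded (cmeasP psi) hD).
  by rewrite z1// z2// mulr0 addr0.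
Qed.

Lemma is_derivative0 : is_derivative 0 0.
Proof.
split.
- by rewrite /essentially_bounded L0_pi0 rpred0.
- exact: is_integral_transform0.
- move=> k _; rewrite fourier_coefE (_ : (fun x => _) = fun=> 0) ?cintegral_cst//.
  by apply/funext => x; exact: mul0r.
Qed.

Lemma is_derivative_sum (I : Type) (s : seq I) (a : I -> R[i]) (phi : I -> cmfun T R)
    (F : I -> SW) : (forall i, is_derivative (phi i) (F i)) ->
  is_derivative (\sum_(i <- s) a i *: phi i) (\sum_(i <- s) a i *: F i : SW).
Proof.
move=> h; elim: s => [|i s IH]; first by rewrite !big_nil; exact: is_derivative0.
by rewrite !big_cons; exact: is_derivativeZD.
Qed.

Lemma cmfun_sumE (I : Type) (s : seq I) (a : I -> R[i]) (phi : I -> cmfun T R) x :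
  (\sum_(i <- s) a i *: phi i) x = \sum_(i <- s) a i * phi i x.
Proof. by elim/big_rec2: _ => //= i z y _ <-. Qed.

Lemma normSWZ a f : normSW (a *: f) = normc a * normSW f.
Proof.
have le b g : normSW (b *: g) <= normc b * normSW g.
  have := is_derivativeZD b (mixed_derivativeP g) is_derivative0.
  rewrite !addr0 => /(normSW_le (f := b *: g)); apply.
  apply: filterS (normSW_bound g) => x h.
  by rewrite [X in normc X](_ : _ = b * mixed_derivative g x)// normcM ler_wpM2l ?normc_ge0.
apply/eqP; rewrite eq_le le/=.
have [->|a0] := eqVneq a 0; first by rewrite normc0 mul0r normSW_ge0.
have na : 0 < normc a by rewrite lt_neqAle normc_ge0 eq_sym normc_eq0 a0.
rewrite mulrC -ler_pdivlMr// mulrC -normcV -{1}[f](scale1r).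
by rewrite -(mulVf a0) -scalerA le.
Qed.

Definition coefD k f : R[i] := fourier_coef (mixed_derivative f) k.

Lemma fc_SW k f : nonzero_freq k -> fc k (SW_id f) = lam k * coefD k f.
Proof. by move=> hk; exact: fc_is_derivative (mixed_derivativeP f) hk. Qed.

Lemma bounded_normc2_integrable phi : ae_bounded phi ->
  mu.-integrable [set: T] (EFin \o (fun x => normc (phi x) ^+ 2)).
Proof.
move=> [C C0 hC]; apply: (@integrableR_ae_le _ _ _ mu _ (fun=> C ^+ 2)).
- exact: measurable_normc2.
- exact: integrableR_cst.
- apply: filterS hC => x h; rewrite ger0_norm ?sqr_ge0//.
  by rewrite ler_pXn2r ?nnegrE ?normc_ge0.
Qed.

Lemma bessel_bounded phi (S : seq (d.-tuple int)) : uniq S -> ae_bounded phi ->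
  \sum_(k <- S) normc (fourier_coef phi k) ^+ 2 <= \int[mu]_x (normc (phi x) ^+ 2).
Proof.
move=> uS bphi.
have := trig_distance (fourier_coef phi) uS (cmeasP phi) (bounded_normc2_integrable bphi).
rewrite [X in _ - _ + X]big1; last by move=> k _; rewrite subrr normc0 expr0n.
rewrite addr0 => h; rewrite -subr_ge0 -h.
by apply: Rintegral_ge0 => x _; rewrite sqr_ge0.
Qed.

Lemma Rintegral_ae_le_cst (h : T -> R) (C : R) : 0 <= C -> (forall x, 0 <= h x) ->
  mu.-integrable [set: T] (EFin \o h) -> (\forall x \ae mu, h x <= C) ->
  \int[mu]_x h x <= C.
Proof.
move=> C0 h0 ih hC; rewrite -[leRHS](Rintegral_cstT mu).
rewrite -lee_fin !fineK.
- apply: ae_ge0_le_integral => //.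
  + by move=> x _; rewrite lee_fin h0.
  + by have /integrableP[] := ih.
  + by apply: filterS hC => x; rewrite lee_fin.
- exact: (integrable_fin_num measurableT (integrableR_cst mu C)).
- exact: (integrable_fin_num measurableT ih).
Qed.

Lemma normc2_mixed_derivative_le f :
  \int[mu]_x (normc (mixed_derivative f x) ^+ 2) <= normSW f ^+ 2.
Proof.
apply: Rintegral_ae_le_cst.
- by rewrite sqr_ge0.
- by move=> x; rewrite sqr_ge0.
- exact/bounded_normc2_integrable/mixed_derivative_bounded.
- apply: filterS (normSW_bound f) => x h.
  by rewrite ler_pXn2r ?nnegrE ?normc_ge0 ?normSW_ge0.
Qed.

(** Bessel's inequality for the mixed derivative, each coefficient outside [S] being
    multiplied by at most [tau]. *)
Lemma tail_bound f (S : seq (d.-tuple int)) (tau : R) : uniq S ->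
  {in S, forall k, nonzero_freq k} -> 0 <= tau ->
  (forall k, nonzero_freq k -> k \notin S -> normc (lam k) <= tau) ->
  normLp (SW_id f - \sum_(k <- S) fc k (SW_id f) *: eL2 k) ^+ 2 <= tau ^+ 2 * normSW f ^+ 2.
Proof.
move=> uS nS tau0 htau.
have hD := mixed_derivativeP f; have bD := mixed_derivative_bounded f.
have [C C0 hC] := bD; set phi := mixed_derivative f in hD bD hC *.
have [_ hconv _] := hD; have {hconv} := (is_convP _ bD).1 hconv => hconv.
pose cc := conv_coef m phi.
have ccE k : nonzero_freq k -> fc k (SW_id f) = cc k by move=> hk; rewrite fc_SW.
pose g x := convolution m phi x - trig S cc x.
have mg : cmeas g.
  by apply: cmeasB; [exact: (cmeas_convolution m_gt0 (cmeasP phi) hC C0)|exact: cmeas_trig].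
have yg : \forall x \ae mu,
    repr ((SW_id f - \sum_(k <- S) fc k (SW_id f) *: eL2 k) : L0 muM) x = g x.
  have -> : Lp_val (SW_id f - \sum_(k <- S) fc k (SW_id f) *: eL2 k) =
     -1 *: (\sum_(k <- S) fc k (SW_id f) *: eL0 k) + (f : L0 muM).
    by rewrite scaleN1r addrC /= Lp_val_sum.
  apply: filterS3 hconv (repr_trig S (fun k => fc k (SW_id f)))
    (repr_L0_ZD (-1) (\sum_(k <- S) fc k (SW_id f) *: eL0 k) (f : L0 muM)).
  move=> x e1 e2 ->; rewrite e1 e2 mulN1r addrC /g; congr (_ - _).
  by rewrite /trig big_seq [RHS]big_seq; apply: eq_bigr => k kS; rewrite ccE//; exact: nS.
rewrite (normL2_eq_ae mg yg).
suff h : (\int[mu]_x (normc (g x) ^+ 2)%:E <= (tau ^+ 2 * normSW f ^+ 2)%:E)%E.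
  have h0 : (0 <= \int[mu]_x (normc (g x) ^+ 2)%:E)%E by exact: normc2_ge0.
  rewrite -lee_fin fineK// ge0_fin_numE//; exact: le_lt_trans h (ltry _).
have [N0 hN0] : exists N0, forall N, (N0 <= N)%N -> {subset S <= nonzero_box d N}.
  elim: (S) nS => [|k s IH] nS; first by exists 0%N.
  have [|N1 h1] := IH; first by move=> l ls; apply: nS; rewrite inE ls orbT.
  have [N2 h2] := nonzero_boxP (nS k (mem_head _ _)).
  exists (maxn N1 N2) => N; rewrite geq_max => /andP[n1 n2] l.
  by rewrite inE => /orP[/eqP ->|/h1]; [exact: h2|exact].
apply: (@fatou_normc2 _ _ _ mu (fun N x => trig (nonzero_box d (N + N0)) cc x - trig S cc x)) => //.
- by move=> N; apply: cmeasB; exact: cmeas_trig.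
- move=> N; set B := nonzero_box d (N + N0).
  have uB : uniq B := nonzero_box_uniq _ _.
  have bt (c : _ -> R[i]) S' : ae_bounded (mkcmfun (cmeas_trig S' c)).
    exists (\sum_(k <- S') normc (c k)); first by apply: sumr_ge0 => k _; exact: normc_ge0.
    by apply: nearW => x; exact: normc_trig_le.
  have ibd : mu.-integrable [set: T] (EFin \o (fun x => normc (trig B cc x - trig S cc x) ^+ 2)).
    pose h := mkcmfun (cmeasB (cmeas_trig B cc) (cmeas_trig S cc)).
    apply: (@bounded_normc2_integrable h).
    exists (\sum_(k <- B) normc (cc k) + \sum_(k <- S) normc (cc k)).
      by rewrite addr_ge0// sumr_ge0// => k _; exact: normc_ge0.
    by apply: nearW => x; rewrite (le_trans (le_normcD _ _))// normcN lerD// normc_trig_le.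
  rewrite -(fineK (integrable_fin_num measurableT ibd)) lee_fin.
  rewrite -[fine _]/(\int[mu]_x (normc (trig B cc x - trig S cc x) ^+ 2)).
  rewrite (trig_distance cc uS (cmeas_trig B cc) (bounded_normc2_integrable (bt cc B))).
  have fS k : k \in S -> fourier_coef (trig B cc) k = cc k.
    by move=> kS; rewrite fourier_coef_trig// (hN0 _ (leq_addl _ _) _ kS).
  rewrite [X in _ + X]big1_seq ?addr0; last first.
    by move=> k /andP[_ kS]; rewrite fS// subrr normc0 expr0n.
  have e2 : \sum_(k <- S) normc (fourier_coef (trig B cc) k) ^+ 2 =
      \sum_(k <- S) normc (cc k) ^+ 2.
    by apply: eq_big_seq => k kS; rewrite fS.
  rewrite trig_normsq// e2 (bigID (mem S))/= -[X in X + _ - _]big_filter.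
  have pS : perm_eq [seq k <- B | k \in S] S.
    apply: uniq_perm; rewrite ?filter_uniq// => k; rewrite mem_filter.
    by case: (boolP (k \in S)) => //= kS; exact: (hN0 _ (leq_addl _ _) _ kS).
  rewrite (perm_big _ pS)/= addrAC subrr add0r.
  apply: (@le_trans _ _ (tau ^+ 2 * \sum_(k <- B) normc (fourier_coef phi k) ^+ 2)).
    rewrite mulr_sumr [leRHS](bigID (mem S))/= -[leLHS]add0r lerD//.
      by apply: sumr_ge0 => k _; rewrite mulr_ge0 ?sqr_ge0.
    rewrite big_seq_cond [leRHS]big_seq_cond; apply: ler_sum => k /andP[kB kS].
    rewrite /cc /conv_coef normcM exprMn ler_wpM2r ?sqr_ge0//.
    rewrite ler_pXn2r ?nnegrE ?normc_ge0// htau// => j.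
    by move: kB; rewrite mem_nonzero_box => /forallP/(_ j)/andP[].
  rewrite ler_wpM2l ?sqr_ge0// (le_trans (bessel_bounded uB bD))//.
  exact: normc2_mixed_derivative_le.
- move=> x; have h := cvg_convolution m_gt0 (cmeasP phi) hC C0 x.
  rewrite -(cvg_shiftn N0) in h.
  rewrite (_ : (fun n => _) = fun n =>
    normc (trig (nonzero_box d (n + N0)) cc x - convolution m phi x)); first exact: h.
  by apply/funext => n; rewrite /g opprB addrA subrK.
Qed.

End SobolevClass.

Section CountableAe.
Context d (T : measurableType d) (R : realType).
Variable mu : {measure set T -> \bar R}.

Lemma ae_forall_countable (I : countType) (P : I -> T -> Prop) :
  (forall i, \forall x \ae mu, P i x) -> \forall x \ae mu, forall i, P i x.
Proof.
move=> h.
have : \forall x \ae mu, forall n, if (unpickle n : option I) is Some i then P i x else True.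
  apply: ae_foralln => n; case: (unpickle n : option I) => [i|]; first exact: h.
  exact: nearW.
by apply: filterS => x hx i; have := hx (pickle i); rewrite pickleK.
Qed.

End CountableAe.

Section GaussianIntegers.
Context {R : realType}.

Definition gauss (z : int * int) : R[i] := z.1%:~R +i* z.2%:~R.

Definition cfloor (w : R[i]) : int * int :=
  (Num.floor (complex.Re w), Num.floor (complex.Im w)).

Lemma cfloor_dist w : normc (w - gauss (cfloor w)) <= 2.
Proof.
have h (t : R) : `|t - (Num.floor t)%:~R| <= 1.
  have h1 := floor_le_tmp t; have h2 := lt_succ_floor t.
  rewrite ger0_norm ?subr_ge0// lerBlDl ltW//.
  by move: h2; rewrite intrD.
rewrite (le_trans (normc_le_ReIm _))// cReB cImB /=.
by rewrite (le_trans (lerD (h _) (h _))).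
Qed.

(** Scale the conjugate of [w] up and round it to Gaussian integers. Having to test only
    countably many points turns inequalities valid almost everywhere for each
    coefficient vector into one valid almost everywhere for all of them. *)
Lemma gauss_dual_bound n (w : 'I_n -> R[i]) (C : R) : 0 <= C ->
  (forall z : {ffun 'I_n -> int * int},
     normc (\sum_i gauss (z i) * w i) ^+ 2 <= C * \sum_i normc (gauss (z i)) ^+ 2) ->
  \sum_i normc (w i) ^+ 2 <= C.
Proof.
move=> C0 h; set s := \sum_i normc (w i) ^+ 2.
have s0 : 0 <= s by apply: sumr_ge0 => i _; rewrite sqr_ge0.
set A := \sum_i normc (w i).
have A0 : 0 <= A by apply: sumr_ge0 => i _; rewrite normc_ge0.
(* [B / K] collects the rounding errors after scaling [w] by [K]. *)
pose B := C * (4 * A + 4 * n%:R) + 4 * A * s.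
have key (K : nat) : s ^+ 2 <= C * s + B * K.+1%:R^-1.
  set e : R := K.+1%:R^-1; have e0 : 0 < e by rewrite invr_gt0.
  have e1 : e <= 1 by rewrite invf_le1// ler1n.
  have [sA|sA] := ltP s (2 * A * e).
    rewrite expr2 (le_trans (ler_wpM2r s0 (ltW sA)))// /B.
    have p1 : 0 <= C * s by rewrite mulr_ge0.
    have p2 : 0 <= C * (4 * A + 4 * n%:R) by rewrite mulr_ge0// addr_ge0// mulr_ge0.
    have p3 : 0 <= C * (4 * A + 4 * n%:R) * e by rewrite mulr_ge0// ltW.
    have p4 : 0 <= A * s * e by rewrite !mulr_ge0// ltW.
    by move: p1 p3 p4; rewrite mulrDl; nra.
  pose Kw i : R[i] := K.+1%:R%:C * (w i)^*.
  pose z : {ffun 'I_n -> int * int} := [ffun i => cfloor (Kw i)].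
  have hz i : normc (Kw i - gauss (z i)) <= 2 by rewrite ffunE cfloor_dist.
  have nK i : normc (Kw i) = K.+1%:R * normc (w i).
    by rewrite normcM normcJ normcR ger0_norm.
  have hs : K.+1%:R * s = normc (\sum_i Kw i * w i).
    rewrite (eq_bigr (fun i => (K.+1%:R * normc (w i) ^+ 2)%:C)); last first.
      by move=> i _; rewrite /Kw -mulrA [_^* * _]mulrC -normc2_conj [RHS]rmorphM.
    rewrite -rmorph_sum normcR -mulr_sumr ger0_norm// mulr_ge0//.
  have low : K.+1%:R * s - 2 * A <= normc (\sum_i gauss (z i) * w i).
    rewrite lerBlDr hs -[X in normc X <= _](subrK (\sum_i gauss (z i) * w i)) addrC.
    rewrite (le_trans (le_normcD _ _))// lerD2l -sumrB (le_trans (normc_sum _ _ _))//.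
    rewrite /A mulr_sumr; apply: ler_sum => i _.
    by rewrite -mulrBl normcM ler_wpM2r ?normc_ge0.
  have up : \sum_i normc (gauss (z i)) ^+ 2 <=
      K.+1%:R ^+ 2 * s + 4 * K.+1%:R * A + 4 * n%:R.
    rewrite /s /A !mulr_sumr.
    have -> : 4 * n%:R = \sum_(i < n) 4 :> R by rewrite sumr_const card_ord mulr_natr.
    rewrite -!big_split/=; apply: ler_sum => i _.
    have g : normc (gauss (z i)) <= K.+1%:R * normc (w i) + 2.
      rewrite -nK -[gauss (z i)](subrK (Kw i)) addrC (le_trans (le_normcD _ _))//.
      by rewrite lerD2l normc_distC.
    have g0 := normc_ge0 (gauss (z i)).
    have : normc (gauss (z i)) ^+ 2 <= (K.+1%:R * normc (w i) + 2) ^+ 2.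
      by rewrite ler_pXn2r// nnegrE// (le_trans g0 g).
    by move/le_trans; apply; rewrite le_eqVlt; apply/orP; left; apply/eqP; ring.
  have K0 : 0 < K.+1%:R :> R by [].
  have eK : e * K.+1%:R = 1 by rewrite mulVf// gt_eqF.
  have low0 : 0 <= s - 2 * A * e by rewrite subr_ge0.
  have lowe : s - 2 * A * e <= e * normc (\sum_i gauss (z i) * w i).
    have := ler_wpM2l (ltW e0) low; rewrite mulrBr mulrA eK mul1r.
    by rewrite [e * (2 * A)]mulrC.
  have step1 : (s - 2 * A * e) ^+ 2 <= e ^+ 2 * normc (\sum_i gauss (z i) * w i) ^+ 2.
    by rewrite -exprMn ler_pXn2r// nnegrE// mulr_ge0 ?normc_ge0// ltW.
  have step2 : e ^+ 2 * normc (\sum_i gauss (z i) * w i) ^+ 2 <=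
      C * (s + 4 * e * A + 4 * e ^+ 2 * n%:R).
    apply: (@le_trans _ _ (e ^+ 2 * (C * (K.+1%:R ^+ 2 * s + 4 * K.+1%:R * A + 4 * n%:R)))).
      rewrite ler_wpM2l ?sqr_ge0// (le_trans (h z))// ler_wpM2l//.
    rewrite le_eqVlt; apply/orP; left; apply/eqP.
    have -> : e ^+ 2 * (C * (K.+1%:R ^+ 2 * s + 4 * K.+1%:R * A + 4 * n%:R)) =
      C * ((e * K.+1%:R) ^+ 2 * s + 4 * e * (e * K.+1%:R) * A + 4 * e ^+ 2 * n%:R) by ring.
    by rewrite eK; ring.
  have := le_trans step1 step2.
  have q1 : 0 <= C * n%:R * e * (1 - e).
    by rewrite !mulr_ge0 ?subr_ge0// ltW.
  have q2 : 0 <= (A * e) ^+ 2 := sqr_ge0 _.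
  rewrite /B => hh.
  have -> : s ^+ 2 = (s - 2 * A * e) ^+ 2 + 4 * A * e * s - 4 * (A * e) ^+ 2 by ring.
  move: hh q1 q2; set X := (s - _) ^+ 2.
  have -> : C * (s + 4 * e * A + 4 * e ^+ 2 * n%:R) =
    C * s + C * (4 * A + 4 * n%:R) * e - 4 * (C * n%:R * e * (1 - e)) by ring.
  have -> : (C * (4 * A + 4 * n%:R) + 4 * A * s) * e =
    C * (4 * A + 4 * n%:R) * e + 4 * A * e * s by ring.
  by set Y := C * n%:R * e * _; set Z := (A * e) ^+ 2; lra.
have : s ^+ 2 - C * s <= 0.
  apply: (@le0_of_cvg0 _ _ (fun K => B * K.+1%:R^-1) 0%N) => [K _|].
    by rewrite lerBlDl.
  by rewrite -[X in _ --> X](mulr0 B); apply: cvgM; [exact: cvg_cst|exact: cvg_harmonic].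
rewrite subr_le0 expr2 => ss.
have [->//|sn] := eqVneq s 0.
by rewrite -(ler_pM2r (x := s))// lt_neqAle eq_sym sn.
Qed.

End GaussianIntegers.

Section SobolevInterface.
Context {R : realType} (d m : nat).
Hypothesis m_gt0 : (0 < m)%N.
Local Notation RR := (measurableTypeR R).
Local Notation T := (d.-tuple RR).
Local Notation mu := (@torus R d).
Local Notation muM := (mu : {measure set _ -> \bar R}).
Local Notation lam := (lam (R := R) m (d := d)).
Local Notation SW := (@SW R d m).
Implicit Types (k : d.-tuple int) (f g : SW) (phi psi : cmfun T R).

(** Almost everywhere in [x], the form [a |-> \sum_i a_i phi_i(x)] on the mixed
    derivatives [phi_i] of the [F i] is bounded by the uniform norm, so that
    [\sum_i |phi_i(x)|^2 <= C]; integrate and use Bessel's inequality. In operator terms,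
    an operator from [l_2] into bounded functions is Hilbert-Schmidt into [L_2], with
    no loss in the norm. *)
Lemma hilbert_schmidt_bound n (F : 'I_n -> SW) (C : R) (S : seq (d.-tuple int)) :
  0 <= C -> uniq S ->
  (forall a : 'I_n -> R[i], normSW (\sum_i a i *: F i) ^+ 2 <= C * \sum_i normc (a i) ^+ 2) ->
  \sum_i \sum_(k <- S) normc (coefD k (F i)) ^+ 2 <= C.
Proof.
move=> C0 uS hF; pose phi i := mixed_derivative (F i).
have hphi i : is_derivative m (phi i) (F i) := mixed_derivativeP m_gt0 (F i).
have ae1 : \forall x \ae mu, forall z : {ffun 'I_n -> int * int},
    normc (\sum_i gauss (z i) * phi i x) ^+ 2 <= C * \sum_i normc (gauss (z i) : R[i]) ^+ 2.
  apply: ae_forall_countable => z.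
  have hs := is_derivative_sum (index_enum 'I_n) (fun i => gauss (z i)) hphi.
  have hD := mixed_derivativeP m_gt0 (\sum_i gauss (z i) *: F i).
  apply: filterS2 (derivative_unique m_gt0 hD hs) (normSW_bound m_gt0 (\sum_i gauss (z i) *: F i)).
  move=> x -> /=; rewrite cmfun_sumE => h.
  apply: le_trans (hF (fun i => gauss (z i))).
  by rewrite ler_pXn2r ?nnegrE ?normc_ge0 ?normSW_ge0.
have ae2 : \forall x \ae mu, \sum_i normc (phi i x) ^+ 2 <= C.
  by apply: filterS ae1 => x; exact: gauss_dual_bound.
have bphi i : ae_bounded (phi i) := mixed_derivative_bounded m_gt0 (F i).
have iphi i := bounded_normc2_integrable (bphi i).
apply: (@le_trans _ _ (\sum_i \int[mu]_x (normc (phi i x) ^+ 2))).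
  by apply: ler_sum => i _; exact: (bessel_bounded uS (bphi i)).
have [E iE] : \sum_i \int[mu]_x (normc (phi i x) ^+ 2) =
    \int[mu]_x \sum_i normc (phi i x) ^+ 2 /\
    mu.-integrable [set: T] (EFin \o (fun x => \sum_i normc (phi i x) ^+ 2)).
  elim: (index_enum _) => [|i s [IH1 IH2]].
    rewrite big_nil; under [in RHS]eq_Rintegral do rewrite big_nil.
    rewrite Rintegral_cstT; split => //.
    rewrite (_ : (fun x => _) = fun=> 0); first exact: (integrableR_cst mu 0).
    by apply/funext => x; rewrite big_nil.
  rewrite big_cons IH1 -RintegralD//; split.
    by apply: eq_Rintegral => x _; rewrite big_cons.
  rewrite (_ : (fun x => _) = fun x => normc (phi i x) ^+ 2 + \sum_(j <- s) normc (phi j x) ^+ 2).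
    exact: (@integrableD _ _ _ mu _ measurableT _ _ (iphi i) IH2).
  by apply/funext => x; rewrite big_cons.
rewrite E; apply: Rintegral_ae_le_cst => // x.
by apply: sumr_ge0 => i _; rewrite sqr_ge0.
Qed.

Definition echar_cmfun k : cmfun T R := mkcmfun (cmeas_echar k).

Lemma echar_primitive_exists k : nonzero_freq k ->
  exists f : SW, is_derivative m (echar_cmfun k) f.
Proof.
move=> hk; have h1 : \forall x \ae mu, normc (echar_cmfun k x) <= 1.
  by apply: nearW => x; rewrite /= normc_echar.
have mc := cmeas_convolution m_gt0 (cmeasP (echar_cmfun k)) h1 ler01.
have [B hB] := convolution_bounded m_gt0 (cmeasP (echar_cmfun k)) h1 ler01.
pose f0 : L0 muM := \pi_(L0 muM) (mkcmfun mc).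
have rf : \forall x \ae mu, repr f0 x = convolution m (echar_cmfun k) x.
  exact: (repr_piL0 muM (mkcmfun mc)).
have bd : ae_bounded (echar_cmfun k) by exists 1.
have hc : is_conv m (echar_cmfun k) f0 by exact/is_convP.
have fSW : f0 \in SW_pred m.
  apply/andP; split.
    by apply: (@Linf_pred_bounded _ _ _ mu _ B); apply: filterS rf => x ->.
  by apply/asboolP; exists (echar_cmfun k) => //; exact/essentially_boundedP.
exists (MkSW fSW); split => //; first exact/essentially_boundedP.
move=> l hl; rewrite fourier_coefE echar_orthonormal.
by case: eqP => // kl; rewrite -kl in hl; case: (hl hk).
Qed.

(** The primitive in the class of the character of index [k]. *)
Definition gX k : SW := xget 0 [set f : SW | is_derivative m (echar_cmfun k) f].

Lemma gXP k : nonzero_freq k -> is_derivative m (echar_cmfun k) (gX k).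
Proof. by move=> /echar_primitive_exists ex; exact: (xgetPex 0 ex). Qed.

Lemma fc_gX k l : nonzero_freq k -> nonzero_freq l ->
  fc l (SW_id (gX k)) = lam l * (k == l)%:R.
Proof.
move=> hk hl; rewrite (fc_is_derivative m_gt0 (gXP hk) hl).
by congr (_ * _); exact: echar_orthonormal.
Qed.

Lemma normSW_gX_sum n (e : 'I_n -> d.-tuple int) (c : 'I_n -> R[i]) :
  (forall i, nonzero_freq (e i)) ->
  normSW (\sum_i c i *: gX (e i)) <= \sum_i normc (c i).
Proof.
move=> he; have h := is_derivative_sum (index_enum 'I_n) c (fun i => gXP (he i)).
apply: (normSW_le m_gt0 h); apply: nearW => x; rewrite cmfun_sumE.
rewrite (le_trans (normc_sum _ _ _))// ler_sum// => i _.
by rewrite normcM normc_echar mulr1.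
Qed.

Lemma fc_sum k n (c : 'I_n -> R[i]) (y : 'I_n -> L2 muM) :
  fc k (\sum_i c i *: y i : L2 muM) = \sum_i c i * fc k (y i).
Proof.
elim: (index_enum _) => [|i s IH].
  rewrite !big_nil; have := fcZD k (-1) (0 : L2 muM) 0.
  by rewrite scaler0 addr0 mulN1r addNr.
by rewrite !big_cons -IH; exact: fcZD.
Qed.

Lemma fc_gX_sum n (e : 'I_n -> d.-tuple int) (c : 'I_n -> R[i]) i :
  injective e -> (forall i, nonzero_freq (e i)) ->
  fc (e i) (SW_id (\sum_i c i *: gX (e i))) = lam (e i) * c i.
Proof.
move=> ie he; rewrite linear_sum; under eq_bigr do rewrite linearZ/=.
rewrite fc_sum (bigD1 i)//= fc_gX// eqxx mulr1 big1 ?addr0 1?mulrC// => j ji.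
by rewrite fc_gX// (inj_eq ie) (negPf ji) !mulr0.
Qed.

End SobolevInterface.

Local Open Scope sesquilinear_scope.

(** * Matrices: orthonormal rows and the Frobenius norm *)

(** Pythagoras' theorem: [V^* V] is an orthogonal projection. *)
Lemma trace_projection_complement (C : numClosedFieldType) p q r
    (V : 'M[C]_(p, q)) (B : 'M[C]_(q, r)) : V \is unitarymx ->
  \tr ((B - V^t* *m V *m B) *m (B - V^t* *m V *m B)^t*) =
  \tr (B *m B^t*) - \tr (V *m B *m (V *m B)^t*).
Proof.
move=> /unitarymxP VV; set P := V^t* *m V; set X := B *m B^t*.
have ctr p' q' r' (A : 'M[C]_(p', q')) (D : 'M[C]_(q', r')) :
    (A *m D)^t* = D^t* *m A^t* by rewrite trmx_mul map_mxM.
have hP : P^t* = P by rewrite /P ctr trmxCK.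
have PP : P *m P = P by rewrite /P mulmxA -(mulmxA _ V) VV mulmx1.
have -> : (B - P *m B)^t* = B^t* - B^t* *m P.
  by rewrite linearB/= map_mxB ctr hP.
have -> : (B - P *m B) *m (B^t* - B^t* *m P) = X - X *m P - (P *m X - P *m X *m P).
  by rewrite mulmxBl !mulmxBr /X !mulmxA.
have -> : \tr (V *m B *m (V *m B)^t*) = \tr (P *m X).
  by rewrite ctr mulmxA mxtrace_mulC /P /X !mulmxA.
have e1 : \tr (X *m P) = \tr (P *m X) := mxtrace_mulC X P.
have e2 : \tr (P *m X *m P) = \tr (P *m X) by rewrite mxtrace_mulC mulmxA PP.
have trB (A D : 'M[C]_q) : \tr (A - D) = \tr A - \tr D.
  by rewrite /mxtrace -sumrB; apply: eq_bigr => i _; rewrite !mxE.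
by rewrite !trB e1 e2 subrr subr0.
Qed.

Section Frobenius.
Context {R : realType}.
Local Notation C := R[i].

Definition fro p q (A : 'M[C]_(p, q)) : R := \sum_i \sum_j normc (A i j) ^+ 2.

Lemma fro_ge0 p q (A : 'M[C]_(p, q)) : 0 <= fro A.
Proof. by apply: sumr_ge0 => i _; apply: sumr_ge0 => j _; rewrite sqr_ge0. Qed.

Lemma normc2_conjC (z : C) : (normc z ^+ 2)%:C = z * Num.conj z.
Proof. exact: normc2_conj. Qed.

Lemma fro_trace p q (A : 'M[C]_(p, q)) : (fro A)%:C = \tr (A *m A^t*).
Proof.
rewrite /fro /mxtrace rmorph_sum; apply: eq_bigr => i _.
rewrite mxE rmorph_sum; apply: eq_bigr => j _.
by rewrite !mxE; exact: normc2_conjC.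
Qed.

Lemma fro_row p q (A : 'M[C]_(p, q)) i : (\sum_j normc (A i j) ^+ 2)%:C = (A *m A^t*) i i.
Proof.
by rewrite mxE rmorph_sum; apply: eq_bigr => j _; rewrite !mxE; exact: normc2_conjC.
Qed.

Lemma ctrM p q r (A : 'M[C]_(p, q)) (B : 'M[C]_(q, r)) : (A *m B)^t* = B^t* *m A^t*.
Proof. by rewrite trmx_mul map_mxM. Qed.

Lemma fro_unitary_row p q (V : 'M[C]_(p, q)) i : V \is unitarymx ->
  \sum_j normc (V i j) ^+ 2 = 1.
Proof.
move=> /unitarymxP VV; apply: (@complexI R); rewrite fro_row VV mxE eqxx.
by [].
Qed.

Lemma fro_unitary p q (V : 'M[C]_(p, q)) : V \is unitarymx -> fro V = p%:R.
Proof.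
move=> uV; rewrite /fro (eq_bigr (fun=> 1)); last by move=> i _; exact: fro_unitary_row.
by rewrite sumr_const card_ord.
Qed.

(** Bessel's inequality for the orthonormal rows of [V]. *)
Lemma fro_mul_unitary p q r (V : 'M[C]_(p, q)) (B : 'M[C]_(q, r)) : V \is unitarymx ->
  fro (V *m B) <= fro B.
Proof.
move=> uV; rewrite -subr_ge0.
have -> : fro B - fro (V *m B) = fro (B - V^t* *m V *m B).
  apply: (@complexI R); rewrite rmorphB/= !fro_trace; apply/esym.
  exact: trace_projection_complement.
exact: fro_ge0.
Qed.

Lemma unitary_col_le1 p q (V : 'M[C]_(p, q)) j : V \is unitarymx ->
  \sum_i normc (V i j) ^+ 2 <= 1.
Proof.
move=> uV; have := fro_mul_unitary (delta_mx j (0 : 'I_1)) uV.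
rewrite [X in _ <= X](_ : _ = 1); last first.
  rewrite /fro (bigD1 j)//= big_ord1 mxE !eqxx normc1 expr1n big1 ?addr0// => i ij.
  by rewrite big_ord1 mxE (negPf ij) /= normc0 expr0n.
apply: le_trans; rewrite le_eqVlt; apply/orP; left; apply/eqP; apply: eq_bigr => i _.
rewrite big_ord1 mxE (bigD1 j)//= mxE !eqxx mulr1 big1 ?addr0// => l lj.
by rewrite mxE (negPf lj) mulr0.
Qed.

Lemma fro_mulr_unitary p q r (A : 'M[C]_(r, p)) (V : 'M[C]_(p, q)) : V \is unitarymx ->
  fro (A *m V) = fro A.
Proof.
move=> /unitarymxP VV; apply: (@complexI R); rewrite !fro_trace ctrM.
by rewrite -mulmxA (mulmxA V) VV mul1mx.
Qed.

(** Orthonormal rows spanning the kernel of [Y] see [1 - Y] as the identity, and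
    compressing to them does not increase the norm. *)
Lemma fro_rank_deficit N p (Y : 'M[C]_N) : (\rank Y <= p)%N ->
  (N%:R - p%:R : R) <= fro (1%:M - Y).
Proof.
move=> rY; pose W := schmidt (row_base (kermx Y)).
have uW : W \is unitarymx by rewrite schmidt_unitarymx// rank_leq_col.
have WY : W *m Y = 0.
  apply/sub_kermxP; rewrite /W eqmx_schmidt_free ?row_base_free//.
  by rewrite eq_row_base.
have := fro_mul_unitary (1%:M - Y) uW.
rewrite mulmxBr WY subr0 mulmx1 fro_unitary//; apply: le_trans.
by rewrite mxrank_ker natrB ?rank_leq_row// lerD2l lerN2 ler_nat.
Qed.

(** The bathtub principle: weights at most one can do no better than to fill the
    smallest values first. *)
Lemma weighted_sum_ge M n (w tau : nat -> R) : (0 < n <= M)%N ->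
  (forall k, (k < M)%N -> 0 <= w k <= 1) -> \sum_(k < M) w k = n%:R ->
  (forall i j, (i <= j)%N -> tau i <= tau j) ->
  \sum_(k < n) tau k <= \sum_(k < M) w k * tau k.
Proof.
move=> /andP[n0 nM] w01 sw mt; set t := tau n.-1.
have split_sum (F : nat -> R) : \sum_(k < n) F k = \sum_(k < M) (k < n)%:R * F k.
  rewrite (big_ord_widen M F nM) big_mkcond; apply: eq_bigr => k _.
  by case: ifP => _; rewrite ?mul1r ?mul0r.
have E := split_sum tau.
have E1 : \sum_(k < M) (k < n)%:R = n%:R :> R.
  under eq_bigr do rewrite -[_%:R]mulr1.
  by rewrite -(split_sum (fun=> 1)) sumr_const card_ord.
rewrite E -subr_ge0 -sumrB.
have -> : \sum_(k < M) (w k * tau k - (k < n)%:R * tau k) =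
   \sum_(k < M) (w k - (k < n)%:R) * (tau k - t) + (\sum_(k < M) (w k - (k < n)%:R)) * t.
  by rewrite mulr_suml -big_split; apply: eq_bigr => k _ /=; ring.
rewrite sumrB sw E1 subrr mul0r addr0; apply: sumr_ge0 => k _.
have /andP[w0 w1] := w01 k (ltn_ord k).
case: (ltnP k n) => kn /=.
  rewrite mulr_le0// ?subr_le0// mt//.
  by rewrite -ltnS prednK.
by rewrite subr0 mulr_ge0// subr_ge0 mt// (leq_trans _ kn)// leq_pred.
Qed.

(** The columns of a matrix with orthonormal rows have norm at most one. *)
Lemma unitary_weighted_ge M n (V : 'M[C]_(n, M)) (tau : nat -> R) : (0 < n <= M)%N ->
  V \is unitarymx -> (forall i j, (i <= j)%N -> tau i <= tau j) ->
  \sum_(k < n) tau k <= \sum_i \sum_(k < M) normc (V i k) ^+ 2 * tau k.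
Proof.
move=> nM uV mt; pose w k := if insub k is Some j then \sum_i normc (V i j) ^+ 2 else 0.
have wE (j : 'I_M) : w j = \sum_i normc (V i j) ^+ 2 by rewrite /w valK.
rewrite exchange_big/=.
rewrite (eq_bigr (fun k : 'I_M => w k * tau k)); last first.
  by move=> k _; rewrite wE mulr_suml.
apply: weighted_sum_ge => //.
  move=> k kM; rewrite -[k]/(val (Ordinal kM)) wE unitary_col_le1// andbT.
  by apply: sumr_ge0 => i _; rewrite sqr_ge0.
under eq_bigr do rewrite wE.
by rewrite exchange_big -(fro_unitary uV).
Qed.

End Frobenius.

(** * Square-summable sequences *)

Lemma CauchySchwarz_sum (R : realType) n (a b : 'I_n -> R) :
  (\sum_i a i * b i) ^+ 2 <= (\sum_i a i ^+ 2) * \sum_i b i ^+ 2.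
Proof.
set A := \sum_i a i ^+ 2; set B := \sum_i b i ^+ 2; set D := \sum_i a i * b i.
have [B0|B0] := eqVneq B 0.
  have b0 i : b i = 0.
    have /allP/(_ i) : all (fun i => b i ^+ 2 == 0) (index_enum 'I_n).
      by move: (B0) => /eqP; rewrite psumr_eq0// => j _; rewrite sqr_ge0.
    by rewrite mem_index_enum sqrf_eq0 => /(_ isT)/eqP.
  by rewrite B0 mulr0 /D big1 ?expr0n// => i _; rewrite b0 mulr0.
have {}B0 : 0 < B by rewrite lt_neqAle eq_sym B0 sumr_ge0// => i _; rewrite sqr_ge0.
have : 0 <= \sum_i (B * a i - D * b i) ^+ 2 by apply: sumr_ge0 => i _; rewrite sqr_ge0.
have -> : \sum_i (B * a i - D * b i) ^+ 2 = B * (A * B - D ^+ 2).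
  have sqE i : (B * a i - D * b i) ^+ 2 =
    B ^+ 2 * a i ^+ 2 + (- 2 * B * D) * (a i * b i) + D ^+ 2 * b i ^+ 2 by ring.
  under eq_bigr do rewrite sqE.
  rewrite !big_split/= -!mulr_sumr -/A -/B -/D; ring.
by rewrite pmulr_rge0// subr_ge0.
Qed.

Lemma CauchySchwarz_normc (R : realType) n (a b : 'I_n -> R[i]) :
  normc (\sum_i a i * b i) ^+ 2 <= (\sum_i normc (a i) ^+ 2) * \sum_i normc (b i) ^+ 2.
Proof.
apply: le_trans (CauchySchwarz_sum (fun i => normc (a i)) (fun i => normc (b i))).
rewrite ler_pXn2r ?nnegrE ?normc_ge0 ?sumr_ge0//; last first.
  by move=> i _; rewrite mulr_ge0 ?normc_ge0.
by apply: le_trans (normc_sum _ _ _) _; apply: ler_sum => i _; rewrite normcM.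
Qed.

Section Ell2.
Context {R : realType}.
Local Notation C := R[i].
Local Notation ell2 := (@ell2 R).
Local Notation nE := (@norm_ell2 R).
Local Notation cnt := (@counting nat R).

Lemma ae_counting (P : nat -> Prop) : (\forall x \ae cnt, P x) -> forall x, P x.
Proof.
move=> [N [mN N0 hN]] x; apply/not_notP => nP.
have Nx : N x by apply: hN.
have : (cnt [set x] <= cnt N)%E by apply: le_measure; rewrite ?inE// => _ ->.
rewrite N0 /counting asboolT ?finite_set1//.
by rewrite fset_set1 finmap.cardfs1 lee_fin ler10.
Qed.

Definition co (i : nat) (v : ell2) : C := repr (v : L0 cnt) i.

Lemma coZD i a (v w : ell2) : co i (a *: v + w) = a * co i v + co i w.
Proof. exact: (ae_counting (repr_L0_ZD a (v : L0 cnt) (w : L0 cnt))). Qed.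

Lemma co0 i : co i 0 = 0.
Proof. exact: (ae_counting (repr_L0_0 cnt)). Qed.

Lemma coZ i a (v : ell2) : co i (a *: v) = a * co i v.
Proof. by have := coZD i a v 0; rewrite addr0 co0 addr0. Qed.

Lemma coD i (v w : ell2) : co i (v + w) = co i v + co i w.
Proof. by have := coZD i 1 v w; rewrite scale1r mul1r. Qed.

Lemma coB i (v w : ell2) : co i (v - w) = co i v - co i w.
Proof. by rewrite -scaleN1r coD coZ mulN1r. Qed.

Lemma co_sum i n (a : 'I_n -> C) (v : 'I_n -> ell2) :
  co i (\sum_j a j *: v j) = \sum_j a j * co i (v j).
Proof.
apply: (big_ind2 (fun x y => co i x = y)) => //; first exact: co0.
  by move=> x1 x2 y1 y2 <- <-; exact: coD.
by move=> j _; exact: coZ.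
Qed.

Lemma norm_ell2_series (v : ell2) :
  ((nE v ^+ 2)%:E = \sum_(0 <= i <oo) (normc (co i v) ^+ 2)%:E)%E.
Proof.
rewrite [nE v ^+ 2](normL2_sq v) /Rintegral fineK; last first.
  exact: (integrable_fin_num measurableT (L2_integrable v)).
by rewrite ge0_integral_count// => k; rewrite lee_fin sqr_ge0.
Qed.

Lemma norm_ell2_fin N (v : ell2) : (forall i, (N <= i)%N -> co i v = 0) ->
  nE v ^+ 2 = \sum_(i < N) normc (co i v) ^+ 2.
Proof.
move=> hv; apply: EFin_inj; rewrite norm_ell2_series.
rewrite (nneseries_split 0 N) ?add0n; last by move=> k _; rewrite lee_fin sqr_ge0.
rewrite (@eseries0 _ _ N); last by move=> i Ni _; rewrite hv// normc0 expr0n.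
by rewrite adde0 big_mkord sumEFin.
Qed.

Lemma norm_ell2_partial N (v : ell2) : \sum_(i < N) normc (co i v) ^+ 2 <= nE v ^+ 2.
Proof.
rewrite -lee_fin norm_ell2_series -sumEFin -(big_mkord xpredT (fun i => (normc (co i v) ^+ 2)%:E)).
by apply: nneseries_lim_ge => i _ _; rewrite lee_fin sqr_ge0.
Qed.

Definition delta_fun (i : nat) : nat -> C := fun j => (i == j)%:R.

Lemma cmeas_delta i : cmeas (delta_fun i).
Proof. by split. Qed.

Lemma delta_in_ell2 i : \pi_(L0 cnt) (mkcmfun (cmeas_delta i)) \in L2_pred cnt.
Proof.
rewrite L2_predP ge0_integral_count; last by move=> k; rewrite lee_fin sqr_ge0.
rewrite (nneseries_split 0 i.+1) ?add0n; last by move=> k _; rewrite lee_fin sqr_ge0.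
have E j : repr (\pi_(L0 cnt) (mkcmfun (cmeas_delta i))) j = (i == j)%:R.
  exact: (ae_counting (repr_piL0 _ _)).
rewrite (@eseries0 _ _ i.+1); last first.
  by move=> j ij _; rewrite E (ltn_eqF ij) normc0 expr0n.
by rewrite adde0 sumEFin ltry.
Qed.

Definition delta i : ell2 := MkLp (delta_in_ell2 i).

Lemma co_delta j i : co j (delta i) = (i == j)%:R.
Proof. exact: (ae_counting (repr_piL0 cnt (mkcmfun (cmeas_delta i)))). Qed.

Lemma co_fin N (a : 'I_N -> C) (j : 'I_N) : co j (\sum_i a i *: delta i) = a j.
Proof.
rewrite co_sum (bigD1 j)//= co_delta eqxx mulr1 big1 ?addr0// => i ij.
by rewrite co_delta [i == j :> nat](_ : _ = (i == j))// (negPf ij) mulr0.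
Qed.

Lemma norm_fin N (a : 'I_N -> C) :
  nE (\sum_i a i *: delta i) ^+ 2 = \sum_i normc (a i) ^+ 2.
Proof.
rewrite (@norm_ell2_fin N); first by apply: eq_bigr => i _; rewrite co_fin.
move=> j Nj; rewrite co_sum big1// => i _.
by rewrite co_delta ltn_eqF ?mulr0// (leq_trans _ Nj).
Qed.

Definition trunc N (v : ell2) : ell2 := \sum_(i < N) co i v *: delta i.

Lemma co_trunc N v j : co j (trunc N v) = if (j < N)%N then co j v else 0.
Proof.
have [jN|Nj] := ltnP; first by rewrite /trunc -[j]/(val (Ordinal jN)) (co_fin (fun i => co i v)).
rewrite co_sum big1// => i _.
by rewrite co_delta ltn_eqF ?mulr0// (leq_trans _ Nj).
Qed.

Lemma trunc_tail v (e : R) : 0 < e -> exists N0, forall N, (N0 <= N)%N ->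
  nE (v - trunc N v) <= e.
Proof.
move=> e0.
have fin : (\sum_(0 <= i <oo) (normc (co i v) ^+ 2)%:E < +oo)%E.
  by rewrite -norm_ell2_series ltry.
have nn k : true -> (0 <= (normc (co k v) ^+ 2)%:E)%E by rewrite lee_fin sqr_ge0.
have := nneseries_tail_cvg (P := xpredT) fin nn.
move=> /fine_cvgP[_ /cvgrPdist_le /(_ (e ^+ 2))].
rewrite exprn_gt0// => /(_ isT) [N0 _ hN]; exists N0 => N NN.
rewrite -(ler_pXn2r (n := 2)) ?nnegrE ?normLp_ge0 ?(ltW e0)//.
have tailE : ((nE (v - trunc N v) ^+ 2)%:E = \sum_(N <= i <oo) (normc (co i v) ^+ 2)%:E)%E.
  rewrite norm_ell2_series (nneseries_split 0 N) ?add0n; last by move=> k _; rewrite lee_fin sqr_ge0.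
  rewrite big_nat big1 ?add0e; last first.
    by move=> i /andP[_ iN]; rewrite coB co_trunc iN subrr normc0 expr0n.
  rewrite eseries_cond [in RHS]eseries_cond; apply: eq_eseriesr => i /= Ni.
  by rewrite coB co_trunc ltnNge Ni subr0.
have := hN N NN; rewrite sub0r normrN /= -tailE /= => /ler_normlP[_].
by apply.
Qed.

(** Testing [l] on finite combinations with conjugate coefficients shows that the
    squares of its values on the unit vectors are summable; finite combinations are
    dense. *)
Lemma functional_tail (l : ell2 -> C) (K eta : R) :
  (forall a v w, l (a *: v + w) = a * l v + l w) ->
  (forall v, normc (l v) <= K * nE v) -> 0 < eta ->
  exists N0, forall N, (N0 <= N)%N -> forall v, normc (l (v - trunc N v)) <= eta * nE v.
Proof.
move=> ll lK eta0; pose a i := l (delta i).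
have l0 : l 0 = 0 by have := ll (-1) 0 0; rewrite scaler0 addr0 mulN1r addNr.
have lD v w : l (v + w) = l v + l w by have := ll 1 v w; rewrite scale1r mul1r.
have lZ b v : l (b *: v) = b * l v by have := ll b v 0; rewrite addr0 l0 addr0.
have lS n (b : 'I_n -> C) : l (\sum_i b i *: delta i) = \sum_i b i * a i.
  by apply: (big_ind2 (fun x y => l x = y)) => // x1 x2 y1 y2 <- <-.
pose u N := \sum_(i < N) normc (a i) ^+ 2.
have u0 N : 0 <= u N by apply: sumr_ge0 => i _; rewrite sqr_ge0.
have uK N : u N <= K ^+ 2.
  have := lK (\sum_(i < N) (a i)^* *: delta i); rewrite lS.
  have -> : \sum_(i < N) (a i)^* * a i = (u N)%:C.
    by rewrite /u rmorph_sum; apply: eq_bigr => i _; rewrite mulrC -normc2_conj.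
  rewrite normcR ger0_norm// => h.
  have := ler_pXn2r (n := 2) isT => /(_ R (u N) (K * nE (\sum_(i < N) (a i)^* *: delta i))).
  have Kn : 0 <= K * nE (\sum_(i < N) (a i)^* *: delta i) := le_trans (u0 N) h.
  rewrite !nnegrE => /(_ (u0 N) Kn); rewrite h exprMn norm_fin.
  under eq_bigr do rewrite normcJ.
  rewrite -/(u N) expr2; have [->|uN] := eqVneq (u N) 0; first by rewrite sqr_ge0.
  by rewrite ler_pM2r// lt_neqAle eq_sym uN u0.
have umono N N' : (N <= N')%N -> u N <= u N'.
  move=> NN; rewrite /u (big_ord_widen N' (fun i => normc (a i) ^+ 2) NN).
  by rewrite [leRHS](bigID (fun i : 'I_N' => (i < N)%N))/= lerDl sumr_ge0// => i _; rewrite sqr_ge0.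
have us : has_sup (range u).
  by split; [exists (u 0%N), 0%N|exists (K ^+ 2) => _ [N _ <-]].
(* From [N0] on, the squared values on the unit vectors add up to at most [eta ^+ 2]. *)
have [_ [N0 _ <-] hN0] := sup_adherent (exprn_gt0 2 eta0) us.
exists N0 => N NN v; have nv := normLp_ge0 v.
have tailP N' : (N <= N')%N -> normc (l (trunc N' v - trunc N v)) <= eta * nE v.
  move=> NN'; pose y i := if (N <= i)%N then a i else 0.
  have -> : l (trunc N' v - trunc N v) = \sum_(i < N') co i v * y i.
    rewrite -scaleN1r lD lZ mulN1r !lS.
    rewrite [X in _ - X](big_ord_widen N' (fun i => co i v * a i) NN').
    rewrite [X in _ - X]big_mkcond -sumrB.
    apply: eq_bigr => i _; rewrite /y; case: (ltnP i N) => _ /=.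
      by rewrite subrr mulr0.
    by rewrite subr0.
  rewrite -(ler_pXn2r (n := 2)) ?nnegrE ?normc_ge0 ?mulr_ge0 ?(ltW eta0)//.
  apply: (le_trans (CauchySchwarz_normc _ _)); rewrite exprMn mulrC ler_pM//.
  - by apply: sumr_ge0 => i _; rewrite sqr_ge0.
  - by apply: sumr_ge0 => i _; rewrite sqr_ge0.
  - have -> : \sum_(i < N') normc (y i) ^+ 2 = u N' - u N.
      rewrite /u [X in _ - X](big_ord_widen N' (fun i => normc (a i) ^+ 2) NN').
      rewrite [X in _ - X]big_mkcond -sumrB.
      apply: eq_bigr => i _; rewrite /y; case: (ltnP i N) => _ /=.
        by rewrite subrr normc0 expr0n.
      by rewrite subr0.
    have h1 : u N' <= sup (range u) by apply: ub_le_sup; [exact: us.2|exists N'].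
    have h2 := umono _ _ NN.
    rewrite lerBlDr (le_trans h1)// addrC -lerBlDr (le_trans (ltW hN0))//.
  - exact: norm_ell2_partial.
apply/ler_addgt0Pr => e e0.
have K1 : 0 < `|K| + 1 by rewrite ltr_pwDr.
have [N1 hN1] := trunc_tail v (divr_gt0 e0 K1).
pose N' := maxn N N1.
have -> : v - trunc N v = (v - trunc N' v) + (trunc N' v - trunc N v) by rewrite addrA subrK.
rewrite lD (le_trans (le_normcD _ _))// addrC lerD ?tailP ?leq_maxl//.
apply: (le_trans (lK _)); have h := hN1 N' (leq_maxr _ _).
have nn := normLp_ge0 (v - trunc N' v).
have h3 : K * nE (v - trunc N' v) <= (`|K| + 1) * nE (v - trunc N' v).
  by rewrite ler_wpM2r// (le_trans (ler_norm K))// lerDl.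
by apply: (le_trans h3); rewrite mulrC -ler_pdivlMr.
Qed.

End Ell2.

(** * Singular values of finite matrices *)

Section OrthogonalRows.
Context {R : realType}.
Local Notation C := R[i].

(** Diagonalise the Gram matrix [L L^*]. *)
Lemma orthogonalize_rows M N (L : 'M[C]_(M, N)) : exists2 U : 'M[C]_M,
  U \is unitarymx & is_diag_mx ((U *m L) *m (U *m L)^t*).
Proof.
pose H := L *m L^t*; exists (spectralmx H); first exact: spectral_unitarymx.
have nH : H \is normalmx.
  by apply/normalmxP; rewrite /H ctrM trmxCK.
have HE := orthomx_spectralP nH.
have uU := spectral_unitarymx H.
rewrite ctrM -mulmxA (mulmxA L) -/H mulmxA.
rewrite [X in _ *m X *m _]HE -(invmx_unitary uU) mulmxA.
rewrite -!mulmxA mulmxV ?unitarymx_unit// mulmx1 !mulmxA mulmxV ?unitarymx_unit// mul1mx.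
exact: diag_mx_is_diag.
Qed.

Lemma fro_row_mx N (r : 'rV[C]_N) : fro r = \sum_j normc (r 0 j) ^+ 2.
Proof. by rewrite /fro big_ord1. Qed.

Lemma fro_col_mx N (w : 'cV[C]_N) : fro w = \sum_j normc (w j 0) ^+ 2.
Proof. by apply: eq_bigr => i _; rewrite big_ord1. Qed.

Lemma fro_orthogonal_rows p q (G : 'M[C]_(p, q)) (r : 'rV[C]_p) :
  is_diag_mx (G *m G^t*) ->
  fro (r *m G) = \sum_i normc (r 0 i) ^+ 2 * \sum_j normc (G i j) ^+ 2.
Proof.
move=> /is_diag_mxP dG; apply: (@complexI R); rewrite fro_trace ctrM.
rewrite -mulmxA (mulmxA G) /mxtrace big_ord1 mxE rmorph_sum; apply: eq_bigr => i _.
rewrite rmorphM/= fro_row normc2_conjC mxE (bigD1 i)//= big1 ?addr0.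
  by rewrite !mxE -mulrA; congr (_ * _); rewrite mulrC.
by move=> j ji; rewrite dG ?mul0r// eq_sym.
Qed.

(** Cauchy-Schwarz applied to [|G w|^2 = <G^* G w, w>]. *)
Lemma fro_mul_col_le p q (G : 'M[C]_(p, q)) (D : R) : 0 <= D ->
  (forall r : 'rV[C]_p, fro (r *m G) <= D * fro r) ->
  forall w : 'cV[C]_q, fro (G *m w) <= D * fro w.
Proof.
move=> D0 hG w; set z := G *m w; pose r : 'rV[C]_p := z^t*.
have rz : fro r = fro z.
  by rewrite fro_row_mx fro_col_mx; apply: eq_bigr => i _; rewrite !mxE normcJ.
have zE : (fro z)%:C = \sum_j (r *m G) 0 j * w j 0.
  have rE i : r 0 i = Num.conj (z i 0) by rewrite /r mxE mxE.
  rewrite fro_col_mx rmorph_sum; transitivity ((r *m z) 0 0).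
    by rewrite mxE; apply: eq_bigr => i _; rewrite rE mulrC; exact: normc2_conjC.
  by rewrite /z mulmxA mxE.
have : fro z ^+ 2 <= D * fro z * fro w.
  have -> : fro z ^+ 2 = normc ((fro z)%:C : C) ^+ 2 by rewrite normcR ger0_norm ?fro_ge0.
  rewrite zE; apply: le_trans (CauchySchwarz_normc _ _) _.
  by rewrite -fro_row_mx -fro_col_mx ler_wpM2r ?fro_ge0// -rz.
have [->|z0] := eqVneq (fro z) 0; last first.
  rewrite expr2 [D * fro z]mulrC -mulrA ler_pM2l//.
  by rewrite lt_neqAle eq_sym z0 fro_ge0.
by rewrite mulr_ge0 ?fro_ge0.
Qed.

End OrthogonalRows.

(** * The s-numbers in terms of the ordered multiplier *)

Section LinearAlgebra.
Context {K : fieldType} {V : lmodType K}.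

Lemma lin_span_sum k (e : 'I_k -> V) n (a : 'I_n -> K) (v : 'I_n -> V) :
  (forall i, lin_span e (v i)) -> lin_span e (\sum_i a i *: v i).
Proof.
move=> hv; have /choice[c hc] := hv.
exists (fun j => \sum_i a i * c i j).
under eq_bigr do rewrite hc scaler_sumr.
rewrite exchange_big; apply: eq_bigr => j _; rewrite scaler_suml.
by apply: eq_bigr => i _; rewrite scalerA.
Qed.

Lemma lin_span_dependent k (e : 'I_k -> V) n (v : 'I_n -> V) : (k < n)%N ->
  (forall i, lin_span e (v i)) ->
  exists2 a : 'I_n -> K, (exists i, a i != 0) & \sum_i a i *: v i = 0.
Proof.
move=> kn hv; have /choice[c hc] := hv.
pose B : 'M[K]_(n, k) := \matrix_(i, j) c i j.
have : kermx B != 0.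
  rewrite -mxrank_eq0 mxrank_ker -lt0n subn_gt0.
  exact: leq_ltn_trans (rank_leq_col B) kn.
move/rowV0Pn => [a /sub_kermxP aB a0].
exists (fun i => a 0 i).
  exact/rV0Pn.
under eq_bigr do rewrite hc scaler_sumr.
rewrite exchange_big big1// => j _.
under eq_bigr do rewrite scalerA.
rewrite -scaler_suml (_ : \sum_i _ = 0) ?scale0r//.
have := congr1 (fun A : 'rV_k => A 0 j) aB; rewrite !mxE => aBj.
by rewrite -[RHS]aBj; apply: eq_bigr => i _; rewrite mxE.
Qed.

(** Take a linearly independent family in [L] of maximal size. *)
Lemma subspace_has_dim p (e : 'I_p -> V) (L : set V) :
  (forall n (a : 'I_n -> K) (v : 'I_n -> V), (forall i, L (v i)) -> L (\sum_i a i *: v i)) ->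
  L `<=` lin_span e -> exists2 k, (k <= p)%N & has_dim L k.
Proof.
move=> hL Le.
pose P k := `[< exists2 v : 'I_k -> V, lin_indep v & forall i, L (v i) >].
have P0 : exists k, P k.
  by exists 0%N; apply/asboolP; exists (fun=> 0) => [c _ []|[]].
have Pp k : P k -> (k <= p)%N.
  move=> /asboolP[v iv Lv]; rewrite leqNgt; apply/negP => pk.
  have [a [i ai] av] := lin_span_dependent pk (fun i => Le _ (Lv i)).
  by rewrite (iv _ av i) eqxx in ai.
have [k /asboolP[v iv Lv] kmax] := ex_maxnP P0 Pp.
exists k; first by apply: Pp; apply/asboolP; exists v.
exists v => //; apply/seteqP; split; last by move=> _ [c ->]; exact: hL.
move=> x Lx; apply/not_notP => nx.
suff /kmax : P k.+1 by rewrite ltnn.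
pose v' (i : 'I_k.+1) := if unlift ord0 i is Some j then v j else x.
apply/asboolP; exists v'; last first.
  by move=> i; rewrite /v'; case: (unlift ord0 i).
move=> c; rewrite big_ord_recl /v' unlift_none.
under eq_bigr do rewrite liftK.
move=> h0.
have c0 : c ord0 = 0.
  apply/eqP; apply/negP => /negP c0; apply: nx.
  exists (fun i => - (c ord0)^-1 * c (lift ord0 i)).
  under eq_bigr do rewrite -scalerA.
  rewrite -scaler_sumr scaleNr; move/eqP: h0; rewrite addrC addr_eq0 => /eqP ->.
  by rewrite scalerN opprK scalerA mulVf// scale1r.
move: h0; rewrite c0 scale0r add0r => /iv h i.
by case: (unliftP ord0 i) => [j ->|->].
Qed.

End LinearAlgebra.

Lemma lt_sub_half (R : realFieldType) (x y : R) : x < y -> x < y - (y - x) / 2.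
Proof. lra. Qed.

Section Enumeration.
Context {R : realType} (d m : nat).
Hypothesis m_gt0 : (0 < m)%N.
Local Notation RR := (measurableTypeR R).
Local Notation T := (d.-tuple RR).
Local Notation mu := (@torus R d).
Local Notation muM := (mu : {measure set _ -> \bar R}).
Local Notation lam := (lam (R := R) m (d := d)).
Local Notation X := (@SW R d m).
Local Notation Y := (L2 muM).
Local Notation nX := (@normSW R d m).
Local Notation nY := (@norm_L2 R d).
Local Notation Id := (@SW_id R d m : {linear X -> Y}).
Local Notation gX := (@gX R d m).
Implicit Types (n p N M : nat).

Variable E : nat -> d.-tuple int.
Hypothesis E_inj : injective E.
Hypothesis E_nz : forall i, nonzero_freq (E i).
Hypothesis E_surj : forall k, nonzero_freq k -> exists i, E i = k.
Hypothesis E_mono : forall i j, (i <= j)%N -> omega (R := R) m (E i) <= omega m (E j).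
Hypothesis E_unbounded : forall B : R, exists i, B <= omega m (E i).

Definition sig i : R := (omega m (E i))^-1.
Definition tau i : R := omega m (E i) ^+ 2.
Definition Ssum n : R := \sum_(i < n) tau i.

Lemma om_gt0 i : 0 < omega (R := R) m (E i). Proof. exact: omega_gt0. Qed.

Lemma sig_gt0 i : 0 < sig i. Proof. by rewrite invr_gt0 om_gt0. Qed.

Lemma tau_gt0 i : 0 < tau i. Proof. by rewrite exprn_gt0// om_gt0. Qed.

Lemma sig_tau i : sig i ^+ 2 * tau i = 1.
Proof. by rewrite /sig /tau -exprMn mulVf ?expr1n// gt_eqF// om_gt0. Qed.

Lemma tau_mono i j : (i <= j)%N -> tau i <= tau j.
Proof. by move=> /E_mono h; rewrite ler_pXn2r ?nnegrE// ltW// om_gt0. Qed.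

Lemma sig_anti i j : (i <= j)%N -> sig j <= sig i.
Proof. by move=> /E_mono h; rewrite lef_pV2 ?posrE ?om_gt0. Qed.

Lemma Ssum_gt0 n : (0 < n)%N -> 0 < Ssum n.
Proof.
case: n => // n _; rewrite /Ssum big_ord_recl ltr_pwDl ?tau_gt0//.
by apply: sumr_ge0 => i _; rewrite ltW// tau_gt0.
Qed.

Lemma normc_lamE i : normc (lam (E i)) = sig i.
Proof. exact: normc_lam. Qed.

Definition firstE n : seq (d.-tuple int) := [seq E i | i <- iota 0 n].

Lemma firstE_uniq n : uniq (firstE n).
Proof. by rewrite map_inj_uniq// iota_uniq. Qed.

Lemma firstE_nz n : {in firstE n, forall k, nonzero_freq k}.
Proof. by move=> _ /mapP[i _ ->]. Qed.

Lemma sum_firstE (V : nmodType) n (F : d.-tuple int -> V) :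
  \sum_(k <- firstE n) F k = \sum_(i < n) F (E i).
Proof. by rewrite big_map -[in iota 0 n](subn0 n) big_mkord. Qed.

Lemma not_firstE n k : nonzero_freq k -> k \notin firstE n -> normc (lam k) <= sig n.
Proof.
move=> /E_surj[i <-] hi; rewrite normc_lamE sig_anti// leqNgt.
by apply: contra hi => ni; apply/mapP; exists i => //; rewrite mem_iota.
Qed.

Lemma tail_boundE n (f : X) :
  nY (Id f - \sum_(i < n) fc (E i) (SW_id f) *: eL2 (E i)) ^+ 2 <= sig n ^+ 2 * nX f ^+ 2.
Proof.
rewrite -(sum_firstE n (fun k => fc k (SW_id f) *: eL2 k)).
apply: tail_bound => //; [exact: firstE_uniq|exact: firstE_nz|exact/ltW/sig_gt0|].
by move=> k; exact: not_firstE.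
Qed.

Lemma besselE n (y : Y) : \sum_(i < n) normc (fc (E i) y) ^+ 2 <= nY y ^+ 2.
Proof.
rewrite -(sum_firstE n (fun k => normc (fc k y) ^+ 2)).
by apply: bessel; exact: firstE_uniq.
Qed.

Lemma distanceE n (c : 'I_n -> R[i]) (y : Y) :
  nY (y - \sum_(i < n) c i *: eL2 (E i)) ^+ 2 = nY y ^+ 2
    - \sum_(i < n) normc (fc (E i) y) ^+ 2 + \sum_(i < n) normc (fc (E i) y - c i) ^+ 2.
Proof.
pose c' k := if [pick i : 'I_n | E i == k] is Some i then c i else 0.
have c'E (i : 'I_n) : c' (E i) = c i.
  rewrite /c'; case: pickP => [j /eqP/E_inj/ord_inj -> //|/(_ i)].
  by rewrite eqxx.
have := L2_distance c' y (firstE_uniq n).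
rewrite !sum_firstE.
have -> : \sum_(i < n) c' (E i) *: eL2 (E i) = \sum_(i < n) c i *: (eL2 (E i) : Y).
  by apply: eq_bigr => i _; rewrite c'E.
by move=> ->; congr (_ + _); apply: eq_bigr => i _; rewrite c'E.
Qed.

Lemma split_norm n (f : X) : nY (Id f) ^+ 2 <=
  \sum_(i < n) normc (fc (E i) (SW_id f)) ^+ 2 + sig n ^+ 2 * nX f ^+ 2.
Proof.
have := tail_boundE n f; rewrite distanceE [X in _ + X]big1 ?addr0; last first.
  by move=> i _; rewrite subrr normc0 expr0n.
by rewrite lerBlDl.
Qed.

Lemma coefDE i (f : X) : normc (coefD (E i) f) ^+ 2 = tau i * normc (fc (E i) (SW_id f)) ^+ 2.
Proof.
rewrite (fc_SW m_gt0 f (E_nz i)) normcM exprMn normc_lamE mulrA [tau i * _]mulrC.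
by rewrite sig_tau mul1r.
Qed.

Lemma fcB k (y z : Y) : fc k (y - z : Y) = fc k y - fc k z.
Proof. by rewrite [y - z]addrC -scaleN1r [LHS]fcZD mulN1r [RHS]addrC. Qed.

Lemma fc0 k : fc k (0 : Y) = 0.
Proof. by have := fcB k 0 0; rewrite !subrr. Qed.

(** ** Bernstein numbers *)

Lemma gX_span_indep n : lin_indep (fun i : 'I_n => gX (E i)).
Proof.
move=> c h i.
have := fc_gX_sum m_gt0 c i (inj_comp E_inj (@ord_inj n)) (fun i => E_nz i).
rewrite (_ : \sum_i0 _ = 0)// linear0 fc0.
by move/esym/eqP; rewrite mulf_eq0 (negPf (lam_neq0 m (E_nz i))) => /eqP.
Qed.

(** On combinations of primitives of characters the norm of the class is at most the
    [l_1] norm of the coefficients, the [L_2] norm is a weighted [l_2] norm, and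
    Cauchy-Schwarz compares the two. *)
Lemma bernstein_lower n : (0 < n)%N ->
  (((Num.sqrt (Ssum n))^-1)%:E <= bernstein_number nX nY Id n)%E.
Proof.
move=> n0; have S0 := Ssum_gt0 n0.
apply: le_ereal_sup_tmp; eexists.
  exists (lin_span (fun i : 'I_n => gX (E i))) => //.
  by exists (fun i : 'I_n => gX (E i)) => //; exact: gX_span_indep.
apply: le_ereal_inf_tmp => _ [_ [[c ->] /andP[x0 x1]] <-].
set x := \sum_i _ in x0 x1 *; rewrite lee_fin ler_pdivlMr// mulrC ler_pdivrMr ?sqrtr_gt0//.
have h1 : nX x <= \sum_i normc (c i) by apply: normSW_gX_sum.
have h2 : \sum_(i < n) (sig i * normc (c i)) ^+ 2 <= nY (SW_id x) ^+ 2.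
  apply: le_trans (besselE n _); apply: ler_sum => i _.
  rewrite (fc_gX_sum m_gt0 c i (inj_comp E_inj (@ord_inj n)) (fun i => E_nz i)).
  by rewrite normcM normc_lamE.
have h3 : (\sum_i normc (c i)) ^+ 2 <= (\sum_(i < n) (sig i * normc (c i)) ^+ 2) * Ssum n.
  have -> : \sum_i normc (c i) = \sum_(i < n) (sig i * normc (c i)) * (sig i)^-1.
    by apply: eq_bigr => i _; rewrite mulrAC divff ?mul1r// gt_eqF// sig_gt0.
  have -> : Ssum n = \sum_(i < n) (sig i)^-1 ^+ 2.
    by apply: eq_bigr => i _; rewrite invrK.
  exact: CauchySchwarz_sum.
have nY0 : 0 <= nY (SW_id x) := normLp_ge0 _.
rewrite (le_trans h1)// -(ler_pXn2r (n := 2))// ?nnegrE.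
- rewrite exprMn sqr_sqrtr ?(ltW S0)//; apply: (le_trans h3).
  by rewrite ler_wpM2r// ltW.
- by apply: sumr_ge0 => i _; exact: normc_ge0.
- by rewrite mulr_ge0// sqrtr_ge0.
Qed.

Lemma sig_small (e : R) : 0 < e -> exists M0, forall M, (M0 <= M)%N -> sig M <= e.
Proof.
move=> e0; have [M0 hM] := E_unbounded e^-1.
exists M0 => M MM; rewrite (le_trans (sig_anti MM))// /sig.
by rewrite -[leRHS]invrK lef_pV2 ?posrE ?om_gt0 ?invr_gt0.
Qed.

(** The source of the constant [Ssum n]. The derivatives of the [h i] have coefficients
    [V i k] divided by the multiplier, and [hilbert_schmidt_bound] bounds the sum of
    their squares by [C]; by [unitary_weighted_ge] that sum is at least [Ssum n]. *)
Lemma orthonormal_family_bound n M (V : 'M[R[i]]_(n, M)) (h : 'I_n -> X) (C : R) :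
  (0 < n <= M)%N -> V \is unitarymx -> 0 <= C ->
  (forall i (k : 'I_M), V i k = fc (E k) (SW_id (h i))) ->
  (forall a : 'I_n -> R[i], nX (\sum_i a i *: h i) ^+ 2 <= C * \sum_i normc (a i) ^+ 2) ->
  Ssum n <= C.
Proof.
move=> nM uV C0 hV hX.
have := hilbert_schmidt_bound m_gt0 C0 (firstE_uniq M) hX; apply: le_trans.
apply: (le_trans (unitary_weighted_ge nM uV tau_mono)).
rewrite le_eqVlt; apply/orP; left; apply/eqP; apply: eq_bigr => i _.
by rewrite sum_firstE; apply: eq_bigr => k _; rewrite coefDE hV mulrC.
Qed.

Lemma fc_lincomb k p (a : 'I_p -> R[i]) (f : 'I_p -> X) :
  fc k (SW_id (\sum_i a i *: f i)) = \sum_i a i * fc k (SW_id (f i)).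
Proof.
rewrite linear_sum; under eq_bigr do rewrite linearZ/=.
exact: fc_sum.
Qed.

Lemma SW_id_inj (f : X) : SW_id f = 0 -> f = 0.
Proof. by move=> /(congr1 val) h; apply: val_inj. Qed.

(** Write [s] for the claimed bound. If [Id] were bounded below by [b > s] on an
    [n]-dimensional space, so would be, up to a small loss, its truncation to finitely
    many frequencies. Orthonormalising the Fourier coefficients of a basis gives a family
    as in [orthonormal_family_bound] with a constant close to [b^-2], which is less than
    [s^-2 = Ssum n]. *)
Lemma bernstein_upper n : (0 < n)%N ->
  (bernstein_number nX nY Id n <= ((Num.sqrt (Ssum n))^-1)%:E)%E.
Proof.
move=> n0; have S0 := Ssum_gt0 n0; set s := (Num.sqrt (Ssum n))^-1.
have s0 : 0 < s by rewrite invr_gt0 sqrtr_gt0.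
have s2 : s ^+ 2 * Ssum n = 1.
  by rewrite exprVn sqr_sqrtr ?ltW// mulVf// gt_eqF.
apply: ge_ereal_sup => _ [L [f f_indep ->] <-].
rewrite leNgt; apply/negP => sinf.
have [b sb hb] : exists2 b : R, s < b &
    forall x : X, lin_span f x -> b * nX x <= nY (SW_id x).
  have [b sb binf] : exists2 b : R, s < b & (b%:E <= ereal_inf [set (nY (Id x) / nX x)%:E |
      x in [set x | lin_span f x /\ (0 < nX x <= 1)%R]])%E.
    move: sinf; set I := ereal_inf _; case: I => [r| |] //; first by exists r.
    by move=> _; exists (s + 1); [rewrite ltrDl|rewrite leey].
  exists b => // x [c xc].
  have [x0|x0] := eqVneq (nX x) 0; first by rewrite x0 mulr0 normLp_ge0.
  have xp : 0 < nX x by rewrite lt_neqAle eq_sym x0 normSW_ge0.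
  pose z := (nX x)^-1%:C *: x.
  have nz : normc ((nX x)^-1%:C : R[i]) = (nX x)^-1.
    by rewrite normcR ger0_norm// invr_ge0 ltW.
  have zX : nX z = 1 by rewrite normSWZ// nz mulVf// gt_eqF.
  have zL : lin_span f z.
    exists (fun i => (nX x)^-1%:C * c i); rewrite /z xc scaler_sumr.
    by apply: eq_bigr => i _; rewrite scalerA.
  have : (b%:E <= (nY (Id z) / nX z)%:E)%E.
    apply: le_trans binf _; apply: ereal_inf_lbound; exists z => //.
    by split => //; rewrite zX ltr01 lexx.
  have -> : nY (Id z) = (nX x)^-1 * nY (Id x).
    by rewrite -[X in X * _]nz -[RHS]normL2Z; congr (nY _); exact: linearZ.
  rewrite lee_fin zX divr1 mulrC.
  by rewrite ler_pdivlMr.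
(* Discarding the frequencies beyond [M] costs at most [e^2], which leaves
   [q = b^2 - e^2] above [s^2]. *)
pose e := Num.sqrt ((b ^+ 2 - s ^+ 2) / 2).
have bs : s ^+ 2 < b ^+ 2 by rewrite ltr_pXn2r// nnegrE ltW// (lt_trans s0).
have e2 : e ^+ 2 = (b ^+ 2 - s ^+ 2) / 2.
  by rewrite sqr_sqrtr// divr_ge0// subr_ge0 ltW.
have e0 : 0 < e by rewrite sqrtr_gt0 divr_gt0// subr_gt0.
have [M0 hM0] := sig_small e0.
pose M := maxn M0 n; have sM : sig M <= e := hM0 _ (leq_maxl _ _).
pose q := b ^+ 2 - e ^+ 2.
have qs : s ^+ 2 < q by rewrite /q e2 lt_sub_half.
have q0 : 0 < q by rewrite (lt_trans _ qs)// exprn_gt0.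
have b0 : 0 <= b by rewrite ltW// (lt_trans s0).
have low x : lin_span f x -> q * nX x ^+ 2 <= \sum_(k < M) normc (fc (E k) (SW_id x)) ^+ 2.
  move=> /hb h; have := split_norm M x; rewrite -lerBlDr; apply: le_trans.
  have X0 := normSW_ge0 x.
  have h2 : b ^+ 2 * nX x ^+ 2 <= nY (Id x) ^+ 2.
    by rewrite -exprMn ler_pXn2r ?nnegrE ?mulr_ge0 ?normLp_ge0.
  have h3 : sig M ^+ 2 * nX x ^+ 2 <= e ^+ 2 * nX x ^+ 2.
    by rewrite ler_wpM2r ?sqr_ge0// ler_pXn2r ?nnegrE// ltW// sig_gt0.
  by rewrite /q mulrBl lerB.
pose F : 'M[R[i]]_(n, M) := \matrix_(i, k) fc (E k) (SW_id (f i)).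
have fF : row_free F.
  apply: inj_row_free => a aF.
  have x0 : \sum_i a 0 i *: f i = 0.
    set x := \sum_i _; have xL : lin_span f x by exists (a 0).
    have z (k : nat) : fc (E k) (SW_id x) = 0 \/ (M <= k)%N.
      have [kM|] := ltnP k M; [left|by right].
      rewrite fc_lincomb; have := congr1 (fun A : 'rV_M => A 0 (Ordinal kM)) aF.
      rewrite !mxE => aFk; rewrite -[RHS]aFk.
      by apply: eq_bigr => i _; rewrite mxE.
    have nX0 : nX x = 0.
      have := low x xL; rewrite big1; last first.
        by move=> k _; have [->|] := z k; rewrite ?normc0 ?expr0n// leqNgt ltn_ord.
      rewrite pmulr_rle0// => h; apply/eqP; rewrite -sqrf_eq0 eq_le h sqr_ge0//.
    apply: SW_id_inj; apply: normL2_eq0; apply/eqP; rewrite -sqrf_eq0 eq_le sqr_ge0 andbT.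
    apply: le_trans (split_norm M x) _; rewrite nX0 expr0n mulr0 addr0 big1// => k _.
    by have [->|] := z k; rewrite ?normc0 ?expr0n// leqNgt ltn_ord.
  by apply/rowP => i; rewrite (f_indep _ x0) mxE.
have nM : (0 < n <= M)%N by rewrite n0 leq_maxr.
pose V := schmidt F; have uV : V \is unitarymx by rewrite schmidt_unitarymx// leq_maxr.
pose B := V *m pinvmx F.
have VB : B *m F = V by rewrite mulmxKpV// (eqmx_schmidt_free fF).
pose h i := \sum_j B i j *: f j.
have hL (a : 'I_n -> R[i]) : lin_span f (\sum_i a i *: h i).
  by apply: lin_span_sum => i; exists (B i).
have hV i (k : 'I_M) : V i k = fc (E k) (SW_id (h i)).
  have := congr1 (fun A : 'M[R[i]]_(n, M) => A i k) VB; rewrite mxE fc_lincomb => VBik.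
  by rewrite -[LHS]VBik; apply: eq_bigr => j _; rewrite [F j k]mxE.
have : Ssum n <= q^-1.
  apply: (orthonormal_family_bound nM uV) => //; first by rewrite invr_ge0 ltW.
  move=> a; rewrite mulrC ler_pdivlMr// mulrC; apply: le_trans (low _ (hL a)) _.
  have -> : \sum_(k < M) normc (fc (E k) (SW_id (\sum_i a i *: h i))) ^+ 2 =
      fro ((\row_i a i) *m V).
    rewrite /fro big_ord1; apply: eq_bigr => k _; rewrite fc_lincomb mxE.
    by congr (normc _ ^+ 2); apply: eq_bigr => i _; rewrite hV mxE.
  rewrite (_ : \sum_i normc (a i) ^+ 2 = fro (\row_i a i)).
    by rewrite fro_mulr_unitary.
  by rewrite /fro big_ord1; apply: eq_bigr => i _; rewrite mxE.
rewrite -[X in _ <= X]mul1r ler_pdivlMr// mulrC -s2 ler_pM2r//.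
by rewrite leNgt qs.
Qed.

(** ** Approximation and Kolmogorov numbers *)

(** The Fourier matrix of the approximants, normalised by the multiplier, has rank at
    most [p] but should be close to the identity of size [N]. *)
Lemma averaging_bound p N (e : 'I_p -> Y) (y : 'I_N -> Y) (D : R) :
  (forall i, lin_span e (y i)) ->
  (forall k : 'I_N, nY (Id (gX (E k)) - y k) ^+ 2 <= D) ->
  N%:R - p%:R <= D * Ssum N.
Proof.
move=> ye hD; have /choice[c hc] := ye.
pose A : 'M[R[i]]_N := \matrix_(k, l) ((lam (E k))^-1 * fc (E l) (y k)).
have rA : (\rank A <= p)%N.
  pose A1 : 'M[R[i]]_(N, p) := \matrix_(k, j) ((lam (E k))^-1 * c k j).
  pose A2 : 'M[R[i]]_(p, N) := \matrix_(j, l) fc (E l) (e j).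
  have -> : A = A1 *m A2.
    apply/matrixP => k l; rewrite !mxE hc fc_sum mulr_sumr.
    by apply: eq_bigr => j _; rewrite !mxE mulrA.
  exact: leq_trans (mxrankM_maxl _ _) (rank_leq_col _).
apply: (le_trans (fro_rank_deficit rA)); rewrite /fro /Ssum mulr_sumr.
apply: ler_sum => k _.
have lk0 : lam (E k) != 0 := lam_neq0 m (E_nz k).
have E1 (l : 'I_N) : normc ((1%:M - A) k l) ^+ 2 =
    tau k * normc (fc (E l) (Id (gX (E k)) - y k)) ^+ 2.
  rewrite fcB fc_gX// !mxE (inj_eq E_inj) [k == l :> nat](_ : _ = (k == l))//.
  have -> : (k == l)%:R - (lam (E k))^-1 * fc (E l) (y k) =
     (lam (E k))^-1 * (lam (E l) * (k == l)%:R - fc (E l) (y k)).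
    rewrite mulrBr mulrA; congr (_ - _).
    by case: eqP => [<-|_]; rewrite ?mulr0// mulVf// mulr1.
  rewrite normcM normcV exprMn normc_lamE; congr (_ * _).
  by rewrite /sig invrK.
under eq_bigr do rewrite E1.
rewrite -mulr_sumr mulrC ler_wpM2r ?(ltW (tau_gt0 k))//.
exact: le_trans (besselE N _) (hD k).
Qed.

Lemma normSW_gX1 i : nX (gX (E i)) <= 1.
Proof.
have := normSW_gX_sum m_gt0 (fun=> 1 : R[i]) (fun _ : 'I_1 => E_nz i).
by rewrite !big_ord1 scale1r normc1.
Qed.

(** The largest of the [N] errors is at least the mean one of [averaging_bound]. *)
Definition lower_width N p : R := Num.sqrt ((N%:R - p%:R) / Ssum N).

Lemma averaging_exists p N (e : 'I_p -> Y) (y : 'I_N -> Y) : (p < N)%N ->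
  (forall i, lin_span e (y i)) ->
  exists k : 'I_N, lower_width N p <= nY (Id (gX (E k)) - y k).
Proof.
move=> pN ye; apply/not_existsP => hn.
have S0 : 0 < Ssum N by rewrite Ssum_gt0// (leq_ltn_trans _ pN).
pose D := \big[Num.max/0]_(k < N) nY (Id (gX (E k)) - y k) ^+ 2.
have hD (k : 'I_N) : nY (Id (gX (E k)) - y k) ^+ 2 <= D by exact: le_bigmax_cond.
have w0 : 0 < lower_width N p ^+ 2.
  by rewrite exprn_gt0// sqrtr_gt0 divr_gt0// subr_gt0 ltr_nat.
have : D < lower_width N p ^+ 2.
  apply: bigmax_lt => // k _; rewrite ltr_pXn2r ?nnegrE ?normLp_ge0 ?sqrtr_ge0//.
  by rewrite ltNge; apply/negP => /(hn k).
rewrite sqr_sqrtr; last by rewrite divr_ge0 ?ltW// subr_gt0 ltr_nat.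
by rewrite ltr_pdivlMr// ltNge (averaging_bound ye hD).
Qed.

Lemma approximation_lower n N : (n <= N)%N -> (0 < n)%N ->
  ((lower_width N n.-1)%:E <= approximation_number nX nY Id n)%E.
Proof.
move=> nN n0; apply: le_ereal_inf_tmp => _ [A [_ [k kn [e _ eA]]] <-].
have kN : (k < N)%N := leq_trans kn nN.
have [i hi] := averaging_exists (e := e) (y := fun i : 'I_N => A (gX (E i))) kN
   (fun i => eq_ind _ (fun L => L (A (gX (E i)))) (ex_intro2 _ _ (gX (E i)) I erefl) _ eA).
apply: le_ereal_sup_tmp; exists (nY (Id (gX (E i)) - A (gX (E i))))%:E.
  by exists (gX (E i)) => //; exact: normSW_gX1.
rewrite lee_fin; apply: le_trans hi; rewrite ler_wsqrtr// ler_wpM2r//.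
  by rewrite invr_ge0 ltW// Ssum_gt0// (leq_trans n0).
by rewrite lerD2l lerN2 ler_nat -ltnS prednK.
Qed.

Lemma kolmogorov_lower n N : (n <= N)%N -> (0 < n)%N ->
  ((lower_width N n.-1)%:E <= kolmogorov_number nX nY Id n)%E.
Proof.
move=> nN n0; apply: le_ereal_inf_tmp => _ [L [e _ ->] <-].
rewrite leNgt; apply/negP => hlt.
have hx (i : 'I_N) : exists y, lin_span e y /\ nY (Id (gX (E i)) - y) < lower_width N n.-1.
  have := le_lt_trans _ hlt => /(_ (ereal_inf [set (nY (Id (gX (E i)) - y))%:E | y in lin_span e])).
  have -> : (ereal_inf [set (nY (Id (gX (E i)) - y))%:E | y in lin_span e] <=
    ereal_sup [set ereal_inf [set (nY (Id x - y))%:E | y in lin_span e] | x in [set x | (nX x <= 1)%R]])%E.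
    by apply: ereal_sup_ubound; exists (gX (E i)) => //; exact: normSW_gX1.
  move=> /(_ isT) /ereal_inf_ltP[_ [y ey <-]]; rewrite lte_fin => h.
  by exists y.
have /choice[y hy] := hx.
have pN : (n.-1 < N)%N by rewrite (leq_trans _ nN)// prednK.
have [k] := averaging_exists pN (fun i => (hy i).1).
by rewrite leNgt (hy k).2.
Qed.

Lemma eL2_indep p : lin_indep (fun i : 'I_p => eL2 (E i) : Y).
Proof.
move=> c h i; have := fc_sum (E i) c (fun i : 'I_p => eL2 (E i)).
rewrite h fc0.
rewrite (bigD1 i)//= fc_eL2 eqxx mulr1 big1 ?addr0//.
move=> j ji; rewrite fc_eL2 (inj_eq E_inj) [j == i :> nat](_ : _ = (j == i))//.
by rewrite (negPf ji) mulr0.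
Qed.

Lemma tail_norm_le p (f : X) : nX f <= 1 ->
  nY (Id f - \sum_(i < p) fc (E i) (SW_id f) *: eL2 (E i)) <= sig p.
Proof.
move=> f1; rewrite -(ler_pXn2r (n := 2)) ?nnegrE ?normLp_ge0 ?(ltW (sig_gt0 p))//.
apply: (le_trans (tail_boundE p f)); rewrite -[leRHS]mulr1 ler_wpM2l ?sqr_ge0//.
by rewrite exprn_ile1// normSW_ge0.
Qed.

Lemma normL2_lincomb p (c : 'I_p -> R[i]) :
  nY (\sum_(i < p) c i *: (eL2 (E i) : Y)) ^+ 2 = \sum_(i < p) normc (c i) ^+ 2.
Proof.
have n0 : nY 0 = 0 by rewrite -(scale0r (0 : Y)) [LHS]normL2Z normc0 mul0r.
have nN (y : Y) : nY (- y) = nY y.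
  by rewrite -scaleN1r [LHS]normL2Z normcN normc1 mul1r.
have := distanceE c 0; rewrite sub0r nN n0 expr0n/= => ->.
under eq_bigr do rewrite fc0 normc0 expr0n/=.
rewrite big1// subr0 add0r; apply: eq_bigr => i _.
by rewrite fc0 sub0r normcN.
Qed.

(** Partial Fourier sums over the first [n - 1] frequencies. *)
Lemma kolmogorov_upper n : (kolmogorov_number nX nY Id n <= (sig n.-1)%:E)%E.
Proof.
apply: ge_ereal_inf; eexists.
  exists (lin_span (fun i : 'I_n.-1 => eL2 (E i) : Y)) => //.
  by exists (fun i : 'I_n.-1 => eL2 (E i) : Y) => //; exact: eL2_indep.
apply: ge_ereal_sup => _ [x x1 <-]; apply: ge_ereal_inf.
exists (nY (Id x - \sum_(i < n.-1) fc (E i) (SW_id x) *: eL2 (E i)))%:E.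
  by exists (\sum_(i < n.-1) fc (E i) (SW_id x) *: eL2 (E i)) => //;
    exists (fun i => fc (E i) (SW_id x)).
by rewrite lee_fin tail_norm_le.
Qed.

Lemma approximation_upper n : (0 < n)%N ->
  (approximation_number nX nY Id n <= (sig n.-1)%:E)%E.
Proof.
move=> n0; pose A0 (f : X) : Y := \sum_(i < n.-1) fc (E i) (SW_id f) *: eL2 (E i).
have linA : linear A0.
  move=> a f g; rewrite /A0 scaler_sumr -big_split; apply: eq_bigr => i _ /=.
  have -> : fc (E i) (SW_id (a *: f + g)) = a * fc (E i) (SW_id f) + fc (E i) (SW_id g).
    by rewrite (SW_id_linear a f g); exact: fcZD.
  by rewrite scalerDl scalerA.
pose A : {linear X -> Y} := HB.pack A0 (GRing.isLinear.Build _ _ _ _ A0 linA).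
apply: ge_ereal_inf; eexists.
  exists A => //; split.
    exists (sig 0) => f.
    rewrite -(ler_pXn2r (n := 2)) ?nnegrE ?normLp_ge0 ?mulr_ge0 ?normSW_ge0 ?(ltW (sig_gt0 0))//.
    rewrite normL2_lincomb exprMn; apply: (le_trans (besselE _ _)).
    by apply: (le_trans (split_norm 0 f)); rewrite big_ord0 add0r.
  have [||k kn hk] := @subspace_has_dim _ _ n.-1 (fun i : 'I_n.-1 => eL2 (E i) : Y) (range A).
  - move=> p a v hv; have /choice[x hx] : forall i, exists x, A x = v i.
      by move=> i; have [x _ <-] := hv i; exists x.
    exists (\sum_i a i *: x i) => //; rewrite linear_sum; apply: eq_bigr => i _.
    by rewrite linearZ/= -hx.
  - by move=> _ [f _ <-]; exists (fun i => fc (E i) (SW_id f)).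
  by exists k => //; rewrite (leq_ltn_trans kn)// prednK.
apply: ge_ereal_sup => _ [x x1 <-]; rewrite lee_fin; exact: tail_norm_le.
Qed.

(** ** Weyl numbers *)

Local Notation nE := (@norm_ell2 R).
Local Notation ell2 := (@ell2 R).

(** The diagonal operator [A] with weights proportional to the inverse multipliers has
    norm at most one by Cauchy-Schwarz, and [Id A] is [s] times an isometry on the
    span of the first [n] unit vectors, on which an operator of rank less than [n]
    has a kernel. *)
Lemma weyl_lower n : (0 < n)%N ->
  (((Num.sqrt (Ssum n))^-1)%:E <= weyl_number nX nY Id n)%E.
Proof.
move=> n0; have S0 := Ssum_gt0 n0; set s := (Num.sqrt (Ssum n))^-1.
have s0 : 0 < s by rewrite invr_gt0 sqrtr_gt0.
have s2 : s ^+ 2 * Ssum n = 1.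
  by rewrite exprVn sqr_sqrtr ?(ltW S0)// mulVf// gt_eqF.
pose w (i : 'I_n) : R := s / sig i.
have w0 i : 0 < w i by rewrite divr_gt0 ?sig_gt0.
have w2 : \sum_(i < n) w i ^+ 2 = 1.
  rewrite -s2 /Ssum mulr_sumr; apply: eq_bigr => i _.
  rewrite /w exprMn exprVn; congr (_ * _); apply/(mulfI (lt0r_neq0 (exprn_gt0 2 (sig_gt0 i)))).
  by rewrite sig_tau -exprMn divff ?expr1n// gt_eqF ?sig_gt0.
pose A0 (v : ell2) : X := \sum_(i < n) ((w i)%:C * co i v) *: gX (E i).
have linA : linear A0.
  move=> a f g; rewrite /A0 scaler_sumr -big_split; apply: eq_bigr => i _ /=.
  have -> : (w i)%:C * co i (a *: f + g) = a * ((w i)%:C * co i f) + (w i)%:C * co i g.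
    by rewrite coZD mulrDr mulrCA.
  by rewrite scalerDl scalerA.
pose A : {linear ell2 -> X} := HB.pack A0 (GRing.isLinear.Build _ _ _ _ A0 linA).
have nA v : nX (A v) <= nE v.
  have h := normSW_gX_sum m_gt0 (fun i : 'I_n => (w i)%:C * co i v) (fun i => E_nz i).
  apply: (le_trans h).
  rewrite (eq_bigr (fun i : 'I_n => normc (co i v) * w i)); last first.
    by move=> i _; rewrite normcM normcR ger0_norm ?(ltW (w0 i))// mulrC.
  rewrite -(ler_pXn2r (n := 2)) ?nnegrE ?normLp_ge0 ?sumr_ge0//; last first.
    by move=> i _; rewrite mulr_ge0 ?normc_ge0 ?(ltW (w0 i)).
  apply: le_trans (CauchySchwarz_sum _ _) _.
  by rewrite w2 mulr1; exact: norm_ell2_partial.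
apply: le_ereal_sup_tmp; eexists.
  exists A => //; split; first by exists 1 => v; rewrite mul1r.
  by apply: ge_ereal_sup => _ [v v1 <-]; rewrite lee_fin (le_trans (nA v)).
apply: le_ereal_inf_tmp => _ [B [_ [k kn [e _ eB]]] <-].
have Be (i : 'I_n) : lin_span e (B (delta i)) by rewrite -eB; exists (delta i).
have [a [i0 ai] aB] := lin_span_dependent kn Be.
pose v0 : ell2 := \sum_(i < n) a i *: delta i.
have v0n : 0 < nE v0.
  rewrite lt_neqAle normLp_ge0 andbT eq_sym -sqrf_eq0 norm_fin.
  rewrite gt_eqF// (bigD1 i0)//= ltr_pwDl//.
    by rewrite exprn_gt0// lt_neqAle normc_ge0 eq_sym normc_eq0 ai.
  by apply: sumr_ge0 => i _; rewrite sqr_ge0.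
pose v : ell2 := (nE v0)^-1%:C *: v0.
have Bv : B v = 0.
  rewrite linearZ/= linear_sum (_ : \sum_i _ = 0) ?scaler0//.
  by rewrite -[RHS]aB; apply: eq_bigr => i _; rewrite linearZ.
have nv : nE v = 1.
  by rewrite [LHS]normL2Z normcR ger0_norm ?invr_ge0 ?(ltW v0n)// mulVf// gt_eqF.
apply: le_ereal_sup_tmp; exists (nY ((Id \o A) v - B v))%:E.
  by exists v => //=; rewrite nv.
rewrite lee_fin Bv subr0 -(ler_pXn2r (n := 2)) ?nnegrE ?normLp_ge0 ?(ltW s0)//.
apply: le_trans (besselE n _).
have co_v (j : nat) : (n <= j)%N -> co j v = 0.
  move=> nj; rewrite coZ co_sum big1 ?mulr0// => i _.
  by rewrite co_delta ltn_eqF ?mulr0// (leq_trans _ nj).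
rewrite [leRHS](eq_bigr (fun i : 'I_n => s ^+ 2 * normc (co i v) ^+ 2)); last first.
  move=> i _; have inj := inj_comp E_inj (@ord_inj n).
  rewrite [fc _ _](fc_gX_sum m_gt0 (fun i : 'I_n => (w i)%:C * co i v) i inj (fun i => E_nz i)).
  rewrite !normcM normc_lamE normcR ger0_norm ?(ltW (w0 i))// mulrA exprMn; congr (_ ^+ 2 * _).
  by rewrite /w mulrCA divff ?mulr1// gt_eqF ?sig_gt0.
by rewrite -mulr_sumr -(norm_ell2_fin co_v) nv expr1n mulr1.
Qed.

Lemma opnorm_le1 (A : {linear ell2 -> X}) :
  bounded_op nE nX A -> (opnorm nE nX A <= 1)%E -> forall v, nX (A v) <= nE v.
Proof.
move=> [c Ac] A1 v; have [v0|v0] := eqVneq (nE v) 0.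
  by have := Ac v; rewrite v0 mulr0.
have vp : 0 < nE v by rewrite lt_neqAle eq_sym v0 normLp_ge0.
have nz : normc ((nE v)^-1%:C : R[i]) = (nE v)^-1.
  by rewrite normcR ger0_norm// invr_ge0 ltW.
have : ((nX (A ((nE v)^-1%:C *: v)))%:E <= 1)%E.
  apply: le_trans A1; apply: ereal_sup_ubound; exists ((nE v)^-1%:C *: v) => //=.
  by rewrite [leLHS]normL2Z nz mulVf.
by rewrite lee_fin linearZ/= normSWZ// nz mulrC ler_pdivrMr// mul1r.
Qed.

(** Dividing [n] rows of squared length at least [t^2] by their squared lengths gives
    the elements of [l_2] whose images under [A] are a family as in
    [orthonormal_family_bound], with the constant [t^-2 < Ssum n]. *)
Lemma few_large_rows (A : {linear ell2 -> X}) n M N (U : 'M[R[i]]_M) (t : R) :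
  (forall v, nX (A v) <= nE v) -> (0 < n <= M)%N -> U \is unitarymx ->
  let G := U *m (\matrix_(k < M, j < N) fc (E k) (SW_id (A (delta j)))) in
  is_diag_mx (G *m G^t*) -> (Num.sqrt (Ssum n))^-1 < t ->
  (#|[pred i | (t ^+ 2 <= \sum_j normc (G i j) ^+ 2)%R]| < n)%N.
Proof.
move=> nA nM uU; set L := \matrix_(k, j) _ => G dG st.
have [n0 _] := andP nM; have S0 := Ssum_gt0 n0.
have t0 : 0 < t by rewrite (le_lt_trans _ st)// invr_ge0 sqrtr_ge0.
rewrite ltnNge; apply/negP; set J := [pred i | _] => nJ.
pose f (i : 'I_n) : 'I_M := enum_val (widen_ord nJ i).
have f_inj : injective f by move=> i j /enum_val_inj /(congr1 val)/= ij; apply: val_inj.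
pose D i := \sum_j normc (G i j) ^+ 2.
have Dt i : t ^+ 2 <= D (f i) by have := enum_valP (widen_ord nJ i); rewrite inE.
have D0 i : 0 < D (f i) by rewrite (lt_le_trans _ (Dt i))// exprn_gt0.
have DC0 i : (D (f i))%:C != 0 :> R[i] by rewrite (inj_eq (@complexI R)) gt_eqF.
pose x (i : 'I_n) (j : 'I_N) : R[i] := Num.conj (G (f i) j) / (D (f i))%:C.
have xJ i j : Num.conj (x i j) = G (f i) j / (D (f i))%:C.
  rewrite /x rmorphM/= conjCK; congr (_ * _).
  transitivity ((Num.conj (D (f i))%:C)^-1); first exact: fmorphV.
  by congr (_^-1); exact: conjc_real.
pose h i := A (\sum_(j < N) x i j *: delta j).
pose V : 'M[R[i]]_(n, M) := \matrix_(i, k) Num.conj (U (f i) k).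
have uV : V \is unitarymx.
  apply/unitarymxP/matrixP => i j; rewrite !mxE.
  have /unitarymxP/matrixP/(_ (f j) (f i)) := uU; rewrite !mxE (inj_eq f_inj) eq_sym => <-.
  by apply: eq_bigr => k _; rewrite !mxE conjCK mulrC.
have LG : L *m G^t* = U^t* *m (G *m G^t*).
  have UU : U^t* *m U = 1%:M by rewrite -(invmx_unitary uU) mulVmx// unitarymx_unit.
  by rewrite mulmxA /G mulmxA UU mul1mx.
have hV i (k : 'I_M) : V i k = fc (E k) (SW_id (h i)).
  rewrite /h linear_sum.
  under eq_bigr do rewrite linearZ/=.
  rewrite fc_lincomb.
  have -> : \sum_j x i j * fc (E k) (SW_id (A (delta j))) = (L *m G^t*) k (f i) / (D (f i))%:C.
    rewrite mxE mulr_suml; apply: eq_bigr => j _.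
    rewrite [L k j]mxE [(G^t*) j _]mxE [G^T j _]mxE /x.
    by rewrite mulrC mulrA.
  rewrite LG [X in _ = X / _]mxE (bigD1 (f i))//= big1 ?addr0; last first.
    by move=> j ji; have /is_diag_mxP dG' := dG; rewrite dG' ?mulr0.
  by rewrite -fro_row -/(D (f i)) mulfK// !mxE.
suff : Ssum n <= (t ^+ 2)^-1.
  rewrite leNgt => /negP; apply.
  rewrite -[ltRHS]invrK ltf_pV2 ?posrE ?invr_gt0 ?exprn_gt0//.
  have -> : (Ssum n)^-1 = (Num.sqrt (Ssum n))^-1 ^+ 2 by rewrite exprVn sqr_sqrtr// ltW.
  by rewrite ltr_pXn2r ?nnegrE ?invr_ge0 ?sqrtr_ge0 ?(ltW t0).
apply: (orthonormal_family_bound nM uV _ hV) => [|a]; first by rewrite invr_ge0 exprn_ge0// ltW.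
pose r : 'rV[R[i]]_n := \row_i (Num.conj (a i) / (D (f i))%:C).
pose Gf : 'M[R[i]]_(n, N) := \matrix_(i, j) G (f i) j.
have GfE i j : Gf i j = G (f i) j by rewrite mxE.
have ctE p q (B : 'M[R[i]]_(p, q)) i j : (B^t*) i j = Num.conj (B j i) by rewrite mxE mxE.
have dGf : is_diag_mx (Gf *m Gf^t*).
  apply/is_diag_mxP => i j ij; have /is_diag_mxP/(_ (f i) (f j)) := dG.
  rewrite [val _ != _](_ : _ = (f i != f j))// (inj_eq f_inj) => /(_ ij).
  rewrite mxE => h0; rewrite mxE -[RHS]h0; apply: eq_bigr => k _.
  by rewrite !ctE !GfE.
have -> : \sum_i a i *: h i = A (\sum_(j < N) (\sum_i a i * x i j) *: delta j).
  rewrite /h; under eq_bigr do rewrite -linearZ/=.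
  rewrite -linear_sum; congr (A _).
  under eq_bigr do rewrite scaler_sumr.
  rewrite exchange_big; apply: eq_bigr => j _; rewrite scaler_suml.
  by apply: eq_bigr => i _; rewrite scalerA.
set v := \sum_j _; have vA := nA v.
have X0 := normSW_ge0 (A v).
apply: (@le_trans _ _ (nE v ^+ 2)); first by rewrite ler_pXn2r ?nnegrE ?normLp_ge0.
rewrite /v norm_fin.
have -> : \sum_j normc (\sum_i a i * x i j) ^+ 2 = fro (r *m Gf).
  rewrite fro_row_mx; apply: eq_bigr => j _; rewrite -[in LHS]normcJ; congr (normc _ ^+ 2).
  rewrite -[LHS]/(Num.conj (\sum_i a i * x i j)) rmorph_sum mxE; apply: eq_bigr => i _.
  transitivity (Num.conj (a i) * Num.conj (x i j)); first exact: rmorphM.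
  rewrite xJ GfE [r 0 i]mxE; ring.
rewrite fro_orthogonal_rows// mulr_sumr; apply: ler_sum => i _.
have -> : \sum_j normc (Gf i j) ^+ 2 = D (f i) by apply: eq_bigr => j _; rewrite GfE.
rewrite mxE normcM normcV normcR ger0_norm ?(ltW (D0 i))//.
rewrite [normc (Num.conj _)]normcJ exprMn -mulrA mulrC ler_wpM2r ?sqr_ge0//.
rewrite exprVn expr2 invfM mulrAC mulVf ?mul1r ?gt_eqF//.
by rewrite lef_pV2 ?posrE ?exprn_gt0.
Qed.

Lemma perturbed_square_sum M (al r : 'I_M -> R[i]) (t eta : R) : 0 <= t -> 0 <= eta <= 1 ->
  \sum_k normc (al k) ^+ 2 <= t ^+ 2 -> (forall k, normc (r k) <= eta) ->
  \sum_k normc (al k + r k) ^+ 2 <= t ^+ 2 + M%:R * ((2 * t + 1) * eta).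
Proof.
move=> t0 /andP[e0 e1] hal hr.
have alt k : normc (al k) <= t.
  rewrite -(ler_pXn2r (n := 2)) ?nnegrE ?normc_ge0//; apply: le_trans hal.
  by rewrite (bigD1 k)//= lerDl sumr_ge0// => j _; rewrite sqr_ge0.
apply: (@le_trans _ _ (\sum_k (normc (al k) ^+ 2 + (2 * t + 1) * eta))); last first.
  by rewrite big_split/= sumr_const card_ord -[X in _ + X]mulr_natl lerD.
apply: ler_sum => k _; have a0 := normc_ge0 (al k); have r0 := normc_ge0 (r k).
apply: (@le_trans _ _ ((normc (al k) + eta) ^+ 2)).
  rewrite ler_pXn2r ?nnegrE ?normc_ge0 ?addr_ge0//.
  by rewrite (le_trans (le_normcD _ _))// lerD.
have h1 : normc (al k) * eta <= t * eta by rewrite ler_wpM2r.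
have h2 : eta * eta <= eta by rewrite -[leRHS]mulr1 ler_wpM2l.
rewrite sqrrD -addrA lerD2l mulrDl mul1r -mulrA mulr_natl expr2.
by rewrite lerD// lerMn2r h1 orbT.
Qed.

(** Truncate [Id A] to [M] frequencies and [N] coordinates and keep only its singular
    vectors with singular value at least [t]: by [few_large_rows] these are fewer than
    [n], and the rest has norm at most [t], up to the truncation errors. *)
Lemma approximation_number_composed_upper n (A : {linear ell2 -> X}) (e : R) :
  (0 < n)%N -> (forall v, nX (A v) <= nE v) -> 0 < e ->
  (approximation_number nE nY (Id \o A) n <= ((Num.sqrt (Ssum n))^-1 + 3 * e)%:E)%E.
Proof.
move=> n0 nA e0; have S0 := Ssum_gt0 n0; set s := (Num.sqrt (Ssum n))^-1.
have s0 : 0 < s by rewrite invr_gt0 sqrtr_gt0.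
pose t := s + e; have t0 : 0 < t by rewrite addr_gt0.
have [M0 hM0] := sig_small e0; pose M := maxn M0 n.
have sM : sig M <= e by apply: hM0; exact: leq_maxl.
have nM : (0 < n <= M)%N by rewrite n0 leq_maxr.
have MR0 : 0 < M%:R :> R by rewrite ltr0n; case/andP: nM => n0' /(leq_trans n0').
pose q := M%:R * (2 * t + 1); have q0 : 0 < q.
  by rewrite mulr_gt0// addr_gt0// mulr_gt0.
(* The coordinates cut off contribute at most [eta] to each of the [M] coefficients,
   hence at most [e^2] to the squared error. *)
pose eta := Num.min 1 (e ^+ 2 / q).
have eta0 : 0 < eta by rewrite lt_min ltr01 divr_gt0// exprn_gt0.
have eta1 : eta <= 1 by rewrite ge_min lexx.
have qeta : M%:R * ((2 * t + 1) * eta) <= e ^+ 2.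
  by rewrite mulrA -/q mulrC -ler_pdivlMr// ge_min lexx orbT.
pose l (k : 'I_M) (v : ell2) : R[i] := fc (E k) (SW_id (A v)).
have lin_l k a v w : l k (a *: v + w) = a * l k v + l k w.
  by rewrite /l linearP (SW_id_linear a (A v) (A w)); exact: fcZD.
have nYA v : nY (SW_id (A v)) <= sig 0 * nE v.
  apply: (@le_trans _ _ (sig 0 * nX (A v))); last by rewrite ler_wpM2l// ltW ?sig_gt0.
  rewrite -(ler_pXn2r (n := 2)) ?nnegrE ?normLp_ge0 ?mulr_ge0 ?normSW_ge0 ?(ltW (sig_gt0 0))//.
  by apply: (le_trans (split_norm 0 (A v))); rewrite big_ord0 add0r exprMn.
have bl k v : normc (l k v) <= sig 0 * nE v.
  apply: le_trans (nYA v).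
  rewrite -(ler_pXn2r (n := 2)) ?nnegrE ?normLp_ge0 ?normc_ge0//.
  apply: le_trans (besselE M _).
  by rewrite (bigD1 k)//= lerDl sumr_ge0// => j _; rewrite sqr_ge0.
have /choice[N0 hN0] k := functional_tail (lin_l k) (bl k) eta0.
pose N := \max_k N0 k.
have lN k v : normc (l k (v - trunc N v)) <= eta * nE v.
  by apply: hN0; exact: leq_bigmax.
pose L : 'M[R[i]]_(M, N) := \matrix_(k < M, j < N) fc (E k) (SW_id (A (delta j))).
have [U uU dG] := orthogonalize_rows L; set G := U *m L in dG.
have st : s < t by rewrite ltrDl.
have := few_large_rows nA nM uU dG st; set J := [pred i | _] => Jn.
pose phi i (v : ell2) : R[i] := \sum_(j < N) G i j * co j v.
pose c k (v : ell2) : R[i] := \sum_(i in J) Num.conj (U i k) * phi i v.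
have phiZD i a v w : phi i (a *: v + w) = a * phi i v + phi i w.
  by rewrite /phi mulr_sumr -big_split; apply: eq_bigr => j _ /=; rewrite coZD; ring.
have cZD k a v w : c k (a *: v + w) = a * c k v + c k w.
  by rewrite /c mulr_sumr -big_split; apply: eq_bigr => j _ /=; rewrite phiZD; ring.
pose B0 (v : ell2) : Y := \sum_(k < M) c k v *: eL2 (E k).
have linB : linear B0.
  move=> a f g; rewrite /B0 scaler_sumr -big_split; apply: eq_bigr => k _ /=.
  by rewrite cZD scalerDl scalerA.
pose B : {linear ell2 -> Y} := HB.pack B0 (GRing.isLinear.Build _ _ _ _ B0 linB).
have co_le j v : normc (co j v) <= nE v.
  rewrite -(ler_pXn2r (n := 2)) ?nnegrE ?normLp_ge0 ?normc_ge0//.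
  apply: le_trans (norm_ell2_partial j.+1 v); rewrite big_ord_recr/= lerDr.
  by apply: sumr_ge0 => i _; rewrite sqr_ge0.
pose Cphi i := \sum_j normc (G i j).
pose Cc k := \sum_(i in J) normc (U i k) * Cphi i.
have phi_le i v : normc (phi i v) <= Cphi i * nE v.
  apply: (le_trans (normc_sum _ _ _)); rewrite /Cphi mulr_suml; apply: ler_sum => j _.
  by rewrite normcM ler_wpM2l ?normc_ge0.
have c_le k v : normc (c k v) <= Cc k * nE v.
  apply: (le_trans (normc_sum _ _ _)); rewrite /Cc mulr_suml; apply: ler_sum => i _.
  by rewrite normcM [normc (Num.conj _)]normcJ -mulrA ler_wpM2l ?normc_ge0.
have bB : bounded_op nE nY B.
  exists (Num.sqrt (\sum_k Cc k ^+ 2)) => v; have nv0 : 0 <= nE v := normLp_ge0 v.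
  rewrite -(ler_pXn2r (n := 2)) ?nnegrE ?normLp_ge0 ?mulr_ge0 ?sqrtr_ge0//.
  rewrite normL2_lincomb exprMn sqr_sqrtr; last by apply: sumr_ge0 => k _; rewrite sqr_ge0.
  rewrite mulr_suml; apply: ler_sum => k _; rewrite -exprMn.
  by rewrite ler_pXn2r ?nnegrE ?normc_ge0// (le_trans _ (c_le k v))// normc_ge0.
have rB : rank_lt B n.
  pose tv (i : 'I_#|J|) : Y := \sum_(k < M) Num.conj (U (enum_val i) k) *: eL2 (E k).
  have [||p pJ hp] := @subspace_has_dim _ _ #|J| tv (range B).
  - move=> p a y hv; have /choice[x hx] : forall i, exists x, B x = y i.
      by move=> i; have [x _ <-] := hv i; exists x.
    exists (\sum_i a i *: x i) => //; rewrite linear_sum; apply: eq_bigr => i _.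
    by rewrite linearZ/= -hx.
  - move=> _ [v _ <-]; exists (fun i => phi (enum_val i) v).
    transitivity (B0 v) => //; rewrite /B0; under eq_bigr do rewrite /c scaler_suml.
    rewrite exchange_big [LHS]big_enum_val/=; apply: eq_bigr => i _.
    rewrite /tv scaler_sumr; apply: eq_bigr => k _.
    by rewrite scalerA mulrC.
  by exists p => //; rewrite (leq_ltn_trans pJ).
apply: ge_ereal_inf; eexists; first by exists B.
apply: ge_ereal_sup => _ [v v1 <-]; rewrite lee_fin.
have nv0 := normLp_ge0 v.
rewrite -(ler_pXn2r (n := 2)) ?nnegrE ?normLp_ge0 ?addr_ge0 ?mulr_ge0 ?(ltW s0) ?(ltW e0)//.
rewrite [X in X ^+ 2 <= _]/(nY (SW_id (A v) - B0 v)) /B0.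
rewrite (distanceE (fun k => c k v) (SW_id (A v))).
have h1 : nY (SW_id (A v)) ^+ 2 - \sum_(k < M) normc (fc (E k) (SW_id (A v))) ^+ 2 <= e ^+ 2.
  rewrite lerBlDl; apply: (le_trans (split_norm M (A v))); rewrite lerD2l -exprMn.
  rewrite ler_pXn2r ?nnegrE ?mulr_ge0 ?normSW_ge0 ?(ltW e0) ?(ltW (sig_gt0 M))//.
  rewrite -[leRHS]mulr1 ler_pM ?normSW_ge0 ?(ltW (sig_gt0 M))//.
  by rewrite (le_trans (nA v)).
pose w : 'cV[R[i]]_N := \col_j co j v.
pose z : 'cV[R[i]]_M := \col_i (if i \in J then 0 else phi i v).
have UU : U^t* *m U = 1%:M by rewrite -(invmx_unitary uU) mulVmx// unitarymx_unit.
have ctE (k i : 'I_M) : (U^t*) k i = Num.conj (U i k) by rewrite mxE mxE.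
have lE k : l k v - c k v = (U^t* *m z) k 0 + l k (v - trunc N v).
  have -> : l k v = l k (v - trunc N v) + l k (trunc N v).
    by have := lin_l k 1 (v - trunc N v) (trunc N v); rewrite scale1r mul1r subrK.
  have -> : l k (trunc N v) = (U^t* *m (G *m w)) k 0.
    rewrite mulmxA /G mulmxA UU mul1mx mxE /l /trunc linear_sum.
    under eq_bigr do rewrite linearZ/=.
    by rewrite fc_lincomb; apply: eq_bigr => j _; rewrite [L k j]mxE [w j 0]mxE mulrC.
  rewrite addrAC -addrA [RHS]addrC; congr (_ + _).
  rewrite [in LHS]mxE [in RHS]mxE /c.
  have GwE i : (G *m w) i 0 = phi i v.
    by rewrite mxE; apply: eq_bigr => j _; rewrite [w j 0]mxE.
  rewrite [X in _ + X](eq_bigr (fun i => Num.conj (U i k) * phi i v)); last first.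
    by move=> i _; rewrite GwE ctE.
  rewrite [X in _ + X](bigID (mem J))/= addrA addNr add0r [RHS](bigID (mem J))/= [X in _ = X + _]big1.
    rewrite add0r; apply: eq_bigr => i iJ; rewrite ctE [z i 0]mxE; move: iJ.
    by case: ifP.
  by move=> i iJ; rewrite [z i 0]mxE iJ mulr0.
have zt : fro (U^t* *m z) <= t ^+ 2.
  have uUt : U^t* \is unitarymx by apply/unitarymxP; rewrite trmxCK.
  apply: (le_trans (fro_mul_unitary z uUt)).
  pose G' : 'M[R[i]]_(M, N) := \matrix_(i, j) (if i \in J then 0 else G i j).
  have G'E i j : G' i j = if i \in J then 0 else G i j by rewrite mxE.
  have -> : z = G' *m w.
    apply/colP => i; rewrite mxE mxE; case: ifP => iJ.
      by rewrite big1// => j _; rewrite G'E iJ mul0r.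
    by apply: eq_bigr => j _; rewrite G'E iJ [w j 0]mxE.
  have dG' : is_diag_mx (G' *m G'^t*).
    apply/is_diag_mxP => i j ij; have /is_diag_mxP/(_ i j ij) := dG.
    have ctG (H : 'M[R[i]]_(M, N)) k : (H^t*) k j = Num.conj (H j k) by rewrite mxE mxE.
    rewrite mxE => h0; rewrite mxE.
    case iJ : (i \in J); first by rewrite big1// => k _; rewrite G'E iJ mul0r.
    case jJ : (j \in J).
      by rewrite big1// => k _; rewrite ctG [G' j k]G'E jJ conjC0 mulr0.
    by rewrite -[RHS]h0; apply: eq_bigr => k _; rewrite !ctG !G'E iJ jJ.
  apply: (@le_trans _ _ (t ^+ 2 * fro w)).
    apply: fro_mul_col_le => [|r]; first by rewrite exprn_ge0// ltW.
    rewrite fro_orthogonal_rows// fro_row_mx mulr_sumr; apply: ler_sum => i _.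
    rewrite mulrC ler_wpM2r ?sqr_ge0//; case iJ : (i \in J).
      rewrite big1 ?exprn_ge0 ?(ltW t0)// => j _; by rewrite G'E iJ normc0 expr0n.
    rewrite (eq_bigr (fun j => normc (G i j) ^+ 2)); last by move=> j _; rewrite G'E iJ.
    by move: iJ => /negbT; rewrite inE -ltNge => /ltW.
  rewrite -[leRHS]mulr1 ler_wpM2l ?exprn_ge0 ?(ltW t0)//.
  rewrite fro_col_mx (eq_bigr (fun j : 'I_N => normc (co j v) ^+ 2)); last first.
    by move=> j _; rewrite mxE.
  by apply: (le_trans (norm_ell2_partial N v)); rewrite exprn_ile1.
have h2 : \sum_(k < M) normc (fc (E k) (SW_id (A v)) - c k v) ^+ 2 <=
    t ^+ 2 + M%:R * ((2 * t + 1) * eta).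
  under eq_bigr do rewrite -/(l _ v) lE.
  apply: perturbed_square_sum; rewrite ?(ltW t0) ?(ltW eta0) ?eta1//.
    by rewrite -fro_col_mx.
  move=> k; apply: (le_trans (lN k v)); rewrite -[leRHS]mulr1 ler_wpM2l ?(ltW eta0)//.
apply: (le_trans (lerD h1 h2)).
apply: (@le_trans _ _ (e ^+ 2 + (t ^+ 2 + e ^+ 2))); first by rewrite !lerD2l.
rewrite -subr_ge0 (_ : _ - _ = 4 * (s * e) + 6 * e ^+ 2); last by rewrite /t; ring.
by rewrite addr_ge0// mulr_ge0// ?mulr_ge0 ?sqr_ge0 ?(ltW s0) ?(ltW e0).
Qed.

Lemma weyl_upper n : (0 < n)%N ->
  (weyl_number nX nY Id n <= ((Num.sqrt (Ssum n))^-1)%:E)%E.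
Proof.
move=> n0; apply: ge_ereal_sup => _ [A [Ab A1] <-].
apply/lee_addgt0Pr => e e0; have e3 : 0 < e / 3 by rewrite divr_gt0.
have := approximation_number_composed_upper n0 (opnorm_le1 Ab A1) e3.
by rewrite mulrC divfK.
Qed.

End Enumeration.

(** * Counting lattice points under a hyperbola *)

Section HyperbolicCross.
Implicit Types (d s t n : nat).

Definition absprod d (k : d.-tuple int) : nat := (\prod_(j < d) `|tnth k j|)%N.

Definition signed_range t : seq int :=
  [seq Posz s | s <- iota 1 t] ++ [seq - Posz s | s <- iota 1 t].

Lemma mem_signed_range t z : (z \in signed_range t) = (z != 0) && (`|z| <= t)%N.
Proof.
rewrite mem_cat; apply/orP/andP => [|[z0 zt]].
  move=> [] /mapP[s]; rewrite mem_iota => /andP[s1 st] ->; rewrite ?abszN absz_nat.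
    by split; [rewrite -lt0n|rewrite -ltnS].
  by split; [rewrite oppr_eq0 -lt0n|rewrite -ltnS].
case: z z0 zt => [s|s] /= z0 zt; [left|right]; apply/mapP.
  by exists s => //; rewrite mem_iota add1n ltnS zt lt0n andbT.
by exists s.+1; rewrite ?NegzE// mem_iota add1n ltnS.
Qed.

Lemma signed_range_uniq t : uniq (signed_range t).
Proof.
rewrite cat_uniq !map_inj_uniq ?iota_uniq ?andbT//=.
- apply/hasPn => z /mapP[s]; rewrite mem_iota => /andP[s1 _] ->.
  by apply/negP => /mapP[r]; rewrite mem_iota => /andP[r1 _]; clear -s1 r1; lia.
- by move=> a b /oppr_inj [].
- by move=> a b [].
Qed.

Fixpoint cross d t : seq (d.-tuple int) :=
  match d with
  | 0 => if (0 < t)%N then [:: [tuple]] else [::]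
  | d'.+1 => [seq cons_tuple z k | z <- signed_range t, k <- cross d' (t %/ `|z|)]
  end.

Lemma absprodS d z (k : d.-tuple int) : absprod (cons_tuple z k) = (`|z| * absprod k)%N.
Proof.
by rewrite /absprod big_ord_recl tnth0; congr (_ * _)%N; apply: eq_bigr => j _; rewrite tnthS.
Qed.

Lemma nonzero_freqS d z (k : d.-tuple int) :
  nonzero_freq (cons_tuple z k) <-> z != 0 /\ nonzero_freq k.
Proof.
split=> [h|[z0 h] j].
  split; first by have := h ord0; rewrite tnth0.
  by move=> j; have := h (lift ord0 j); rewrite tnthS.
by case: (unliftP ord0 j) => [i|] ->; rewrite ?tnthS ?tnth0//; exact: h.
Qed.

Lemma absprod_gt0 d (k : d.-tuple int) : nonzero_freq k -> (0 < absprod k)%N.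
Proof. by move=> hk; rewrite prodn_gt0// => j; rewrite absz_gt0; exact: hk. Qed.

Lemma mem_cross d t (k : d.-tuple int) :
  reflect (nonzero_freq k /\ (absprod k <= t)%N) (k \in cross d t).
Proof.
apply: (iffP idP); elim: d t k => [|d IH] t k /=.
- case: ifP => // t0; rewrite inE => /eqP ->; split; first by case.
  by rewrite /absprod big_ord0.
- move=> /allpairsPdep[z [k' [+ /IH[hk' tk'] ->]]]; rewrite mem_signed_range => /andP[z0 zt].
  split; first exact/nonzero_freqS.
  by rewrite absprodS mulnC -leq_divRL// absz_gt0.
- by move=> [_]; rewrite /absprod big_ord0 => ->; rewrite (tuple0 k) inE.
- case/tupleP: k => z k [] /nonzero_freqS[z0 hk]; rewrite absprodS => zk.
  have zp : (0 < `|z|)%N by rewrite absz_gt0.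
  apply/allpairsPdep; exists z, k; split => //.
    rewrite mem_signed_range z0 (leq_trans _ zk)// leq_pmulr//; exact: absprod_gt0.
  by apply: IH; split => //; rewrite leq_divRL// mulnC.
Qed.

Lemma cross_uniq d t : uniq (cross d t).
Proof.
elim: d t => [|d IH] t /=; first by case: ifP.
apply: allpairs_uniq_dep; [exact: signed_range_uniq|by move=> z _; exact: IH|].
move=> [z k] [z' k'] _ _ /= h.
by have [-> /val_inj ->] : z = z' /\ tval k = tval k' by case: (congr1 (fun x : _.-tuple _ => tval x) h).
Qed.

(** The number of positive points of the cross, summed over the first coordinate. *)
Fixpoint hcount d t : nat :=
  match d with
  | 0 => (0 < t)%N
  | d'.+1 => (\sum_(s < t) hcount d' (t %/ s.+1))%N
  end.

Lemma size_cross d t : size (cross d t) = (2 ^ d * hcount d t)%N.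
Proof.
elim: d t => [|d IH] t /=; first by case: ifP.
rewrite size_allpairs_dep sumnE !big_map big_cat/= !big_map.
have E : (\sum_(s <- iota 1 t) size (cross d (t %/ `|Posz s|)) = 2 ^ d * \sum_(s < t) hcount d (t %/ s.+1))%N.
  under eq_bigr do rewrite IH.
  rewrite -big_distrr; congr (_ * _)%N.
  have -> : iota 1 t = index_iota 1 t.+1 by rewrite /index_iota subn1.
  by rewrite big_add1 big_mkord.
rewrite [X in (_ + X)%N](eq_bigr (fun s => size (cross d (t %/ `|Posz s|)))); last first.
  by move=> s _; rewrite abszN.
by rewrite !E expnS -mulnA mul2n addnn.
Qed.

Lemma hcountS d t : hcount d.+1 t = (\sum_(s < t) hcount d (t %/ s.+1))%N.
Proof. by []. Qed.

Lemma hcount1 t : hcount 1 t = t.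
Proof.
rewrite hcountS (eq_bigr (fun=> 1%N)); first by rewrite sum_nat_const card_ord muln1.
by move=> s _; rewrite /= divn_gt0// ltn_ord.
Qed.

Lemma hcount_ge d t : (t <= hcount d.+1 t)%N.
Proof.
elim: d => [|d IH]; first by rewrite hcount1.
apply: (leq_trans IH); rewrite [leqRHS]hcountS.
case: t {IH} => [|t]; first by rewrite hcountS big_ord0.
by rewrite [leqRHS]big_ord_recl divn1 leq_addr.
Qed.

Lemma hcount_mono d s t : (s <= t)%N -> (hcount d s <= hcount d t)%N.
Proof.
elim: d s t => [|d IH] s t st /=; first by case: s st => // s /(leq_trans _) ->.
rewrite (big_ord_widen t (fun i => hcount d (s %/ i.+1)) st) [leqRHS](bigID (fun i : 'I_t => (i < s)%N))/=.
apply: (leq_trans _ (leq_addr _ _)); apply: leq_sum => i _.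
by apply: IH; exact: leq_div2r.
Qed.

(** The same points ordered by their product; unlike [cross d t], these lists extend one
    another as [t] grows. *)
Definition chain d t : seq (d.-tuple int) :=
  flatten [seq [seq k <- cross d s | absprod k == s] | s <- iota 1 t].

Lemma chainS d t :
  chain d t.+1 = chain d t ++ [seq k <- cross d t.+1 | absprod k == t.+1].
Proof. by rewrite /chain -[in LHS](addn1 t) iotaD map_cat flatten_cat/= cats0 add1n. Qed.

Lemma mem_chain d t (k : d.-tuple int) :
  reflect (nonzero_freq k /\ (absprod k <= t)%N) (k \in chain d t).
Proof.
apply: (iffP flattenP) => [[_ /mapP[s + ->]]|[hk kt]].
  rewrite mem_iota mem_filter => /andP[_ st] /andP[/eqP ks /mem_cross[hk _]].
  by split => //; rewrite ks -ltnS.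
exists [seq l <- cross d (absprod k) | absprod l == absprod k].
  by apply/mapP; exists (absprod k) => //; rewrite mem_iota absprod_gt0// add1n ltnS.
by rewrite mem_filter eqxx; apply/mem_cross.
Qed.

Lemma chain_uniq d t : uniq (chain d t).
Proof.
elim: t => // t IH; rewrite chainS cat_uniq IH filter_uniq ?cross_uniq// andbT.
apply/hasPn => k; rewrite mem_filter => /andP[/eqP kt _]; apply/negP => /mem_chain[_].
by rewrite kt ltnn.
Qed.

Lemma size_chain d t : size (chain d t) = (2 ^ d * hcount d t)%N.
Proof.
rewrite -size_cross; apply: perm_size; apply: uniq_perm.
- exact: chain_uniq.
- exact: cross_uniq.
by move=> k; apply/mem_chain/mem_cross.
Qed.

Lemma chain_prefix d s t : (s <= t)%N -> prefix (chain d s) (chain d t).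
Proof.
move=> /subnKC <-; elim: (t - s)%N => [|n IH]; first by rewrite addn0 prefix_refl.
rewrite addnS chainS; apply: prefix_trans IH _; exact: prefix_prefix.
Qed.

(** Read the infinite list of which every [chain d t] is a prefix. The counting function
    is then the inverse of the enumeration. *)
Lemma enumeration_exists d : (0 < d)%N -> exists E : nat -> d.-tuple int,
  [/\ injective E, forall i, nonzero_freq (E i),
      forall k, nonzero_freq k -> exists i, E i = k &
      forall i t, (absprod (E i) <= t)%N = (i < 2 ^ d * hcount d t)%N].
Proof.
case: d => // d _; pose D := d.+1; pose dflt : D.-tuple int := [tuple 0 | j < D].
have szc i : (i < size (chain D i.+1))%N.
  by rewrite size_chain (leq_trans (hcount_ge d i.+1))// leq_pmull// expn_gt0.
pose E i := nth dflt (chain D i.+1) i.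
have EE i t : (i < size (chain D t))%N -> E i = nth dflt (chain D t) i.
  move=> it; have [le|le] := leqP i.+1 t.
    have /prefixP[r ->] := chain_prefix D le; by rewrite nth_cat szc.
  have /prefixP[r h] := chain_prefix D (ltnW le).
  by rewrite /E h nth_cat it.
have Emem i : E i \in chain D i.+1 by exact: mem_nth.
exists E; split.
- move=> i j; wlog ij : i j / (i <= j)%N => [W ij|].
    by have [/W|/ltnW/W h] := leqP i j; [exact|apply/esym/h].
  have jj := szc j; rewrite (EE i j.+1 (leq_ltn_trans ij jj)) (EE j j.+1 jj).
  by move/eqP; rewrite nth_uniq ?chain_uniq// ?(leq_ltn_trans ij jj)// => /eqP.
- by move=> i; have /mem_chain[] := Emem i.
- move=> k hk; have kc : k \in chain D (absprod k) by apply/mem_chain.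
  by exists (index k (chain D (absprod k))); rewrite (EE _ (absprod k)) ?index_mem// nth_index.
- move=> i t; rewrite -size_chain; apply/idP/idP => [it|it].
    have : E i \in chain D t by apply/mem_chain; split => //; have /mem_chain[] := Emem i.
    move=> /(nthP dflt)[j jt jE]; suff -> : i = j by [].
    pose u := maxn t i.+1.
    have ju : (j < size (chain D u))%N.
      rewrite (leq_trans jt)// !size_chain leq_mul2l hcount_mono ?orbT//; exact: leq_maxl.
    have iu : (i < size (chain D u))%N.
      rewrite (leq_trans (szc i))// !size_chain leq_mul2l hcount_mono ?orbT//; exact: leq_maxr.
    apply/esym/eqP; rewrite -(nth_uniq dflt ju iu (chain_uniq _ _)) -(EE _ _ ju) -(EE _ _ iu).
    by rewrite (EE _ _ jt) jE.
  by have := mem_nth dflt it; rewrite -(EE _ _ it) => /mem_chain[].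
Qed.

End HyperbolicCross.

Section LogarithmicBounds.
Context {R : realType}.
Implicit Types (a b c : R) (d n j t : nat).

Lemma powS_diff_le a b j : 0 <= b <= a ->
  a ^+ j.+1 - b ^+ j.+1 <= (a - b) * (j.+1%:R * a ^+ j).
Proof.
move=> /andP[b0 ba]; have a0 := le_trans b0 ba.
elim: j => [|j IH]; first by rewrite !expr1 expr0 !mulr1.
have -> : a ^+ j.+2 - b ^+ j.+2 = a * (a ^+ j.+1 - b ^+ j.+1) + (a - b) * b ^+ j.+1.
  by rewrite !exprS; ring.
have -> : (a - b) * (j.+2%:R * a ^+ j.+1) =
    a * ((a - b) * (j.+1%:R * a ^+ j)) + (a - b) * a ^+ j.+1.
  by rewrite -[j.+2]addn1 natrD !exprS; ring.
by rewrite lerD// ler_wpM2l ?subr_ge0// lerXn2r.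
Qed.

Lemma powS_diff_ge a b j : 0 <= b <= a ->
  (a - b) * (j.+1%:R * b ^+ j) <= a ^+ j.+1 - b ^+ j.+1.
Proof.
move=> /andP[b0 ba]; have a0 := le_trans b0 ba.
elim: j => [|j IH]; first by rewrite !expr1 expr0 !mulr1.
have -> : a ^+ j.+2 - b ^+ j.+2 = a * (a ^+ j.+1 - b ^+ j.+1) + (a - b) * b ^+ j.+1.
  by rewrite !exprS; ring.
have -> : (a - b) * (j.+2%:R * b ^+ j.+1) =
    b * ((a - b) * (j.+1%:R * b ^+ j)) + (a - b) * b ^+ j.+1.
  by rewrite -[j.+2]addn1 natrD !exprS; ring.
rewrite lerD// ler_pM// mulr_ge0 ?subr_ge0// mulr_ge0// exprn_ge0//.
Qed.

Lemma ln_step n : n.+2%:R^-1 <= ln n.+2%:R - ln n.+1%:R :> R.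
Proof.
have p1 : 0 < n.+1%:R :> R by [].
have p2 : 0 < n.+2%:R :> R by [].
rewrite -ln_div ?posrE// -[ln _]opprK -lnV ?posrE ?divr_gt0// invf_div.
rewrite lerNr; have -> : n.+1%:R / n.+2%:R = 1 + (- n.+2%:R^-1) :> R.
  rewrite -[n.+2]addn1 natrD; field; rewrite gt_eqF//.
by apply: le_ln1Dx; rewrite ltrN2 invf_lt1// ltr1n.
Qed.

Lemma ln_step_le n : ln n.+2%:R - ln n.+1%:R <= n.+1%:R^-1 :> R.
Proof.
have p1 : 0 < n.+1%:R :> R by [].
have p2 : 0 < n.+2%:R :> R by [].
rewrite -ln_div ?posrE//; have -> : n.+2%:R / n.+1%:R = 1 + n.+1%:R^-1 :> R.
  by rewrite -[n.+2]addn1 natrD; field; rewrite gt_eqF.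
by apply: le_ln1Dx; rewrite (@lt_trans _ _ 0)// ?ltrN10// invr_gt0.
Qed.

Lemma log_sum_ge j n : ln n.+1%:R ^+ j.+1 / j.+1%:R <=
  \sum_(s < n) s.+1%:R^-1 * (ln n.+1%:R - ln s.+1%:R) ^+ j :> R.
Proof.
pose F s : R := - ((ln n.+1%:R - ln s.+1%:R) ^+ j.+1 / j.+1%:R).
have -> : ln n.+1%:R ^+ j.+1 / j.+1%:R = \sum_(s < n) (F s.+1 - F s).
  rewrite -(big_mkord xpredT (fun s => F s.+1 - F s)) telescope_sumr//.
  by rewrite /F subrr expr0n/= mul0r oppr0 sub0r opprK ln1 subr0.
apply: ler_sum => s _; rewrite /F opprK addrC -mulrBl ler_pdivrMr//.
set a := ln n.+1%:R - ln s.+1%:R; set b := ln n.+1%:R - ln s.+2%:R.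
have b0 : 0 <= b by rewrite subr_ge0 ler_ln ?posrE// ler_nat ltnS.
have ba : b <= a by rewrite lerD2l lerN2 ler_ln ?posrE// ler_nat.
have hb : 0 <= b <= a by rewrite b0.
apply: le_trans (powS_diff_le j hb) _.
have a0 := le_trans b0 ba.
have ja : 0 <= j.+1%:R * a ^+ j by rewrite mulr_ge0// exprn_ge0.
rewrite -mulrA [X in _ <= _ * X]mulrC; apply: ler_wpM2r => //.
have -> : a - b = ln s.+2%:R - ln s.+1%:R by rewrite /a /b; ring.
exact: ln_step_le.
Qed.

Lemma log_sum_le j n c : ln n.+1%:R <= c ->
  \sum_(s < n.+1) s.+1%:R^-1 * (c - ln s.+1%:R) ^+ j <= (c + 1) ^+ j.+1 / j.+1%:R.
Proof.
move=> nc; have c0 : 0 <= c by rewrite (le_trans _ nc)// ln_ge0// ler1n.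
rewrite big_ord_recl/= ln1 subr0 invr1 mul1r.
pose F s : R := - ((c - ln s.+1%:R) ^+ j.+1 / j.+1%:R).
apply: (@le_trans _ _ (c ^+ j + \sum_(s < n) (F s.+1 - F s))).
  rewrite lerD2l; apply: ler_sum => s _; rewrite /F opprK [leRHS]addrC -mulrBl ler_pdivlMr//.
  rewrite /bump leq0n add1n.
  set a := c - ln s.+1%:R; set b := c - ln s.+2%:R.
  have b0 : 0 <= b by rewrite subr_ge0 (le_trans _ nc)// ler_ln ?posrE// ler_nat ltnS.
  have ba : b <= a by rewrite lerD2l lerN2 ler_ln ?posrE// ler_nat.
  have hb : 0 <= b <= a by rewrite b0.
  apply: le_trans (powS_diff_ge j hb).
  have jb : 0 <= j.+1%:R * b ^+ j by rewrite mulr_ge0// exprn_ge0.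
  rewrite -mulrA [X in _ * X <= _]mulrC; apply: ler_wpM2r => //.
  have -> : a - b = ln s.+2%:R - ln s.+1%:R by rewrite /a /b; ring.
  exact: ln_step.
rewrite -(big_mkord xpredT (fun s => F s.+1 - F s)) telescope_sumr// /F ln1 subr0 opprK.
apply: (@le_trans _ _ (c ^+ j + c ^+ j.+1 / j.+1%:R)).
  rewrite lerD2l gerDr oppr_le0 divr_ge0 ?exprn_ge0 ?subr_ge0//.
rewrite ler_pdivlMr// mulrDl divfK ?pnatr_eq0//.
have hc : 0 <= c <= c + 1 by rewrite c0 lerDl ler01.
have := powS_diff_ge j hc; rewrite addrAC subrr add0r mul1r lerBrDr.
by rewrite mulrC.
Qed.

(** Divisor sums of the previous dimension, compared with the integral of a power of
    the logarithm; adding the count of one dimension less absorbs all rounding. *)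
Lemma hcount_lower d n : (0 < n)%N ->
  n.+1%:R * ln n.+1%:R ^+ d / d`!%:R <= (hcount d.+1 n + hcount d n)%:R :> R.
Proof.
elim: d n => [|d IH] n n0.
  by rewrite hcount1 expr0 mulr1 fact0 divr1 /= n0 addn1.
rewrite 2!hcountS -big_split/= natr_sum.
apply: (@le_trans _ _ (\sum_(s < n) n.+1%:R * (s.+1%:R^-1 * (ln n.+1%:R - ln s.+1%:R) ^+ d) / d`!%:R)).
  rewrite -mulr_suml -mulr_sumr factS natrM invfM !mulrA.
  rewrite -[X in X / _ <= _]mulrA ler_wpM2r ?invr_ge0// ler_wpM2l//.
  exact: log_sum_ge.
apply: ler_sum => s _; set u := (n %/ s.+1)%N.
have u0 : (0 < u)%N by rewrite divn_gt0// ltn_ord.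
apply: le_trans (IH _ u0); rewrite ler_wpM2r ?invr_ge0// mulrA.
have s0 : 0 < s.+1%:R :> R by [].
have us : n.+1%:R / s.+1%:R <= u.+1%:R :> R.
  by rewrite ler_pdivrMr// -natrM ler_nat ltn_ceil.
have lnu : ln n.+1%:R - ln s.+1%:R <= ln u.+1%:R :> R.
  by rewrite -ln_div ?posrE// ler_ln ?posrE// divr_gt0.
have l0 : 0 <= ln n.+1%:R - ln s.+1%:R :> R.
  by rewrite subr_ge0 ler_ln ?posrE// ler_nat ltnS ltnW// ltn_ord.
rewrite ler_pM ?divr_ge0 ?exprn_ge0//.
by rewrite lerXn2r// nnegrE// (le_trans l0).
Qed.

(** The shift of the logarithm by [d] absorbs the first term of each sum, which exceeds
    the integral. *)
Lemma hcount_upper d n : (0 < n)%N ->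
  (hcount d.+1 n)%:R <= n%:R * (ln n%:R + d%:R) ^+ d / d`!%:R :> R.
Proof.
elim: d n => [|d IH] n n0.
  by rewrite hcount1 expr0 mulr1 fact0 divr1.
case: n n0 => // n _.
rewrite hcountS natr_sum.
apply: (@le_trans _ _ (\sum_(s < n.+1)
    n.+1%:R * (s.+1%:R^-1 * (ln n.+1%:R + d%:R - ln s.+1%:R) ^+ d) / d`!%:R)); last first.
  rewrite -mulr_suml -mulr_sumr factS natrM invfM !mulrA.
  rewrite -[X in _ <= X / _]mulrA ler_wpM2r ?invr_ge0// ler_wpM2l//.
  have -> : ln n.+1%:R + d.+1%:R = ln n.+1%:R + d%:R + 1 :> R by rewrite -[d.+1]addn1 natrD addrA.
  apply: log_sum_le.
  by rewrite lerDl.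
apply: ler_sum => s _; set u := (n.+1 %/ s.+1)%N.
have u0 : (0 < u)%N by rewrite divn_gt0// ltn_ord.
apply: (le_trans (IH _ u0)); rewrite ler_wpM2r ?invr_ge0// mulrA.
have us : u%:R <= n.+1%:R / s.+1%:R :> R.
  by rewrite ler_pdivlMr// -natrM ler_nat leq_trunc_div.
have lnu : ln u%:R <= ln n.+1%:R - ln s.+1%:R :> R.
  by rewrite -ln_div ?posrE// ler_ln ?posrE ?divr_gt0// ltr0n.
have l0 : 0 <= ln u%:R :> R by rewrite ln_ge0// ler1n.
rewrite ler_pM ?exprn_ge0 ?addr_ge0//.
have h : ln u%:R + d%:R <= ln n.+1%:R + d%:R - ln s.+1%:R :> R.
  by rewrite addrAC lerD2r.
have h0 : 0 <= ln u%:R + d%:R :> R by rewrite addr_ge0.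
by rewrite lerXn2r ?nnegrE// (le_trans h0).
Qed.

Lemma hcount_small d t : (0 < t)%N ->
  (hcount d t)%:R * ln t%:R <= t%:R * (ln t%:R + d%:R) ^+ d :> R.
Proof.
move=> t0; have L0 : 0 <= ln t%:R :> R by rewrite ln_ge0// ler1n.
case: d => [|d].
  by rewrite /= t0 mul1r expr0 mulr1 ltW// ln_sublinear// ltr0n.
have h := hcount_upper d t0.
apply: (@le_trans _ _ (t%:R * (ln t%:R + d%:R) ^+ d * ln t%:R)).
  rewrite ler_wpM2r// (le_trans h)// ler_pdivrMr ?ltr0n ?fact_gt0// ler_peMr//.
    by rewrite mulr_ge0// exprn_ge0// addr_ge0.
  by rewrite ler1n fact_gt0.
rewrite -mulrA ler_wpM2l// exprSr ler_pM ?exprn_ge0 ?addr_ge0//.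
  by rewrite lerXn2r ?nnegrE ?addr_ge0// lerD2l ler_nat.
by rewrite lerDl.
Qed.

(** The counts up to [t - 1] and up to [t] have the same main term. *)
Lemma position_bounds D t n : (1 < t)%N ->
  (2 ^ D.+1 * hcount D.+1 t.-1 <= n <= 2 ^ D.+1 * hcount D.+1 t)%N ->
  let L : R := ln t%:R in
  let y : R := n%:R / 2 ^+ D.+1 / (t%:R * L ^+ D) in
  (D`!%:R)^-1 - L^-1 * (1 + D%:R / L) ^+ D <= y <= (1 + D%:R / L) ^+ D / D`!%:R.
Proof.
move=> t1 /andP[n1 n2]; cbv zeta; set L := ln t%:R.
set y := n%:R / _ / _; have t0 : (0 < t)%N := ltnW t1.
have L0 : 0 < L by rewrite ln_gt0// ltr1n.
have tR : 0 < t%:R :> R by rewrite ltr0n.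
have W : 0 < t%:R * L ^+ D by rewrite mulr_gt0// exprn_gt0.
have p2 : 0 < 2 ^+ D.+1 :> R by rewrite exprn_gt0.
have f0 : 0 < D`!%:R :> R by rewrite ltr0n fact_gt0.
have LE : (L + D%:R) ^+ D = L ^+ D * (1 + D%:R / L) ^+ D.
  by rewrite -exprMn; congr (_ ^+ _); field; rewrite gt_eqF.
have x1 : (hcount D.+1 t.-1)%:R <= n%:R / 2 ^+ D.+1 :> R.
  by rewrite ler_pdivlMr// -natrX -natrM mulnC ler_nat.
have x2 : n%:R / 2 ^+ D.+1 <= (hcount D.+1 t)%:R :> R.
  by rewrite ler_pdivrMr// -natrX -natrM mulnC ler_nat.
apply/andP; split; last first.
  rewrite ler_pdivrMr// (le_trans x2)// (le_trans (hcount_upper D t0))// -/L LE.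
  by rewrite le_eqVlt; apply/orP; left; apply/eqP; ring.
have tp : (0 < t.-1)%N by rewrite -ltnS prednK.
have h1 := hcount_lower D tp; rewrite prednK// -/L in h1.
have h2 : (hcount D t.-1)%:R <= (t%:R * L ^+ D) * (L^-1 * (1 + D%:R / L) ^+ D) :> R.
  apply: (@le_trans _ _ (hcount D t)%:R); first by rewrite ler_nat hcount_mono// leq_pred.
  have := hcount_small D t0; rewrite -/L LE -ler_pdivlMr// => h; apply: (le_trans h).
  by rewrite le_eqVlt; apply/orP; left; apply/eqP; ring.
rewrite ler_pdivlMr// (le_trans _ x1)// mulrBl lerBlDr -[X in _ <= _ + X]mulrC.
rewrite natrD in h1; apply: le_trans (lerD (lexx _) h2); apply: le_trans h1.
by rewrite mulrC.
Qed.

End LogarithmicBounds.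

(** * Asymptotics of the ordered multiplier *)

Section SequenceLimits.
Context {R : realType}.
Implicit Types (u v : nat -> R) (a b : R).

Lemma cvg_near_eq u v a : (\forall n \near \oo, u n = v n) ->
  u n @[n --> \oo] --> a -> v n @[n --> \oo] --> a.
Proof.
move=> uv ua; apply: (squeeze_cvgr (f := u) (h := u)) => //.
by near do rewrite (near uv) ?lexx//.
Unshelve. all: by end_near. Qed.

Lemma cvg_exprn k u a : u n @[n --> \oo] --> a -> u n ^+ k @[n --> \oo] --> a ^+ k.
Proof. move=> ua; apply: (@continuous_cvg _ _ _ _ _ u (fun x : R => x ^+ k) a) => //; exact: exprn_continuous. Qed.

Lemma cvg_ln u a : 0 < a -> u n @[n --> \oo] --> a -> ln (u n) @[n --> \oo] --> ln a.
Proof. move=> a0 ua; apply: (@continuous_cvg _ _ _ _ _ u (@ln R) a) => //; exact: continuous_ln. Qed.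

Lemma cvg_sqrt u a : u n @[n --> \oo] --> a -> Num.sqrt (u n) @[n --> \oo] --> Num.sqrt a.
Proof. move=> ua; apply: (@continuous_cvg _ _ _ _ _ u (@Num.sqrt R) a) => //; exact: sqrt_continuous. Qed.

Lemma cvg_pinfty_inv u : u n @[n --> \oo] --> +oo -> (u n)^-1 @[n --> \oo] --> 0.
Proof. by move=> uy; apply/(gtr0_cvgV0 _).2 => //; apply: cvgry_gt. Qed.

Lemma cvg_ln_pinfty u : u n @[n --> \oo] --> +oo -> ln (u n) @[n --> \oo] --> +oo.
Proof.
move=> /cvgryPge uy; apply/cvgryPge => A.
near=> n; rewrite -[A]expRK ler_ln ?posrE ?expR_gt0//; first by near: n; exact: uy.
by apply: lt_le_trans (expR_gt0 A) _; near: n; exact: uy.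
Unshelve. all: by end_near. Qed.

Lemma cvg_ln_div u : u n @[n --> \oo] --> +oo -> ln (u n) / u n @[n --> \oo] --> 0.
Proof.
move=> uy; apply: (squeeze_cvgr (f := fun=> 0) (h := fun n => 2 * Num.sqrt (u n)^-1)); last 2 first.
- exact: cvg_cst.
- have -> : 0 = 2 * Num.sqrt 0 :> R by rewrite sqrtr0 mulr0.
  by apply: cvgMl_tmp; apply: cvg_sqrt; exact: cvg_pinfty_inv.
near=> n; have u1 : 1 <= u n by near: n; move/cvgryPge : uy; exact.
have u0 : 0 < u n by exact: lt_le_trans u1.
have s0 : 0 < Num.sqrt (u n) by rewrite sqrtr_gt0.
have uE : u n = Num.sqrt (u n) ^+ 2 by rewrite sqr_sqrtr// ltW.
apply/andP; split; first by rewrite divr_ge0 ?ln_ge0// ltW.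
rewrite ler_pdivrMr// sqrtrV ?(ltW u0)// [X in _ <= _ * X]uE expr2 mulrA mulrVK ?unitfE ?gt_eqF//.
rewrite [X in ln X]uE lnXn// mulr_natl lerMn2r ltW ?orbT//.
exact: ln_sublinear.
Unshelve. all: by end_near. Qed.

End SequenceLimits.

Section Inversion.
Context {R : realType} (D : nat).
Local Notation position t n :=
  (2 ^ D.+1 * hcount D.+1 t.-1 <= n <= 2 ^ D.+1 * hcount D.+1 t)%N.
Variable t : nat -> nat.
Hypothesis t_infty : t n @[n --> \oo] --> \oo.
Hypothesis t_position : \forall n \near \oo, position (t n) n.

Definition kappa : R := 2 ^+ D.+1 / D`!%:R.

Lemma kappa_gt0 : 0 < kappa.
Proof. by rewrite divr_gt0 ?exprn_gt0// ltr0n fact_gt0. Qed.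

Let L n : R := ln (t n)%:R.

Lemma product_log_infty : L n @[n --> \oo] --> +oo.
Proof. by apply: cvg_ln_pinfty; apply/cvgrnyP. Qed.

Let y n : R := n%:R / 2 ^+ D.+1 / ((t n)%:R * L n ^+ D).

Lemma position_ratio_cvg : y n @[n --> \oo] --> (D`!%:R : R)^-1.
Proof.
have Li : (L n)^-1 @[n --> \oo] --> 0 by apply: cvg_pinfty_inv; exact: product_log_infty.
have B : (1 + D%:R / L n) ^+ D @[n --> \oo] --> (1 : R).
  rewrite [X in _ --> X](_ : 1 = (1 + D%:R * 0) ^+ D); last by rewrite mulr0 addr0 expr1n.
  by apply: cvg_exprn; apply: cvgD; [exact: cvg_cst|exact: cvgMl_tmp].
apply: (squeeze_cvgr (f := fun n => (D`!%:R)^-1 - (L n)^-1 * (1 + D%:R / L n) ^+ D)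
  (h := fun n => (1 + D%:R / L n) ^+ D / D`!%:R)).
- near=> n; apply: position_bounds; last by near: n; exact: t_position.
  by near: n; move/cvgnyPgt : t_infty; exact.
- rewrite -[X in _ --> X]subr0; apply: cvgB; first exact: cvg_cst.
  by rewrite -(mul0r (1 : R)); apply: cvgM.
- by rewrite -[X in _ --> X]mul1r; apply: cvgMr_tmp.
Unshelve. all: by end_near. Qed.

Lemma position_log_cvg : ln n%:R / L n @[n --> \oo] --> (1 : R).
Proof.
have f0 : 0 < D`!%:R :> R by rewrite ltr0n fact_gt0.
have p2 : 0 < 2 ^+ D.+1 :> R by rewrite exprn_gt0.
have Li : (L n)^-1 @[n --> \oo] --> 0 by apply: cvg_pinfty_inv; exact: product_log_infty.
apply: (@cvg_near_eq _ (fun n => ln (2 ^+ D.+1 * y n) * (L n)^-1 + 1 + D%:R * (ln (L n) / L n))).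
  near=> n.
  have L0 : 0 < L n by near: n; apply: cvgry_gt; exact: product_log_infty.
  have t0 : 0 < (t n)%:R :> R by rewrite ltr0n; near: n; move/cvgnyPgt : t_infty; exact.
  have n0 : 0 < n%:R :> R by rewrite ltr0n; near: n; exact: nbhs_infty_gt.
  have LD : 0 < L n ^+ D by rewrite exprn_gt0.
  have y0 : 0 < y n by rewrite !divr_gt0// mulr_gt0.
  have nE : n%:R = 2 ^+ D.+1 * y n * ((t n)%:R * L n ^+ D).
    by rewrite /y; field; rewrite !gt_eqF.
  have lnE : ln n%:R = ln (2 ^+ D.+1 * y n) + (L n + D%:R * ln (L n)).
    transitivity (ln (2 ^+ D.+1 * y n * ((t n)%:R * L n ^+ D))); first by rewrite -nE.
    have y1 : 0 < 2 ^+ D.+1 * y n by exact: mulr_gt0.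
    have y2 : 0 < (t n)%:R * L n ^+ D by exact: mulr_gt0.
    rewrite [LHS]lnM ?posrE//; congr (_ + _).
    by rewrite lnM ?posrE// lnXn// mulr_natl.
  by rewrite lnE; field; rewrite gt_eqF.
rewrite [X in _ --> X](_ : 1 = ln (2 ^+ D.+1 * (D`!%:R)^-1) * 0 + 1 + D%:R * 0); last first.
  by rewrite !mulr0 add0r addr0.
apply: cvgD; first (apply: cvgD; last exact: cvg_cst).
  apply: cvgM => //; apply: cvg_ln; first by rewrite mulr_gt0// invr_gt0.
  by apply: cvgMl_tmp; exact: position_ratio_cvg.
by apply: cvgMl_tmp; apply: cvg_ln_div; exact: product_log_infty.
Unshelve. all: by end_near. Qed.

(** As [n] is of the order of [t (ln t)^D], the logarithms of [n] and [t] are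
    asymptotically equal and may be exchanged. *)
Lemma product_asymptotics : (t n)%:R * ln n%:R ^+ D / n%:R @[n --> \oo] --> kappa^-1.
Proof.
have f0 : 0 < D`!%:R :> R by rewrite ltr0n fact_gt0.
have p2 : 0 < 2 ^+ D.+1 :> R by rewrite exprn_gt0.
apply: (@cvg_near_eq _ (fun n => (y n)^-1 / 2 ^+ D.+1 * (ln n%:R / L n) ^+ D)).
  near=> n.
  have L0 : 0 < L n by near: n; apply: cvgry_gt; exact: product_log_infty.
  have t0 : 0 < (t n)%:R :> R by rewrite ltr0n; near: n; move/cvgnyPgt : t_infty; exact.
  have n0 : 0 < n%:R :> R by rewrite ltr0n; near: n; exact: nbhs_infty_gt.
  have LD : 0 < L n ^+ D by rewrite exprn_gt0.
  by rewrite /y expr_div_n; field; rewrite !gt_eqF.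
have -> : kappa^-1 = (D`!%:R)^-1^-1 / 2 ^+ D.+1 * 1 ^+ D.
  by rewrite /kappa expr1n mulr1 invf_div invrK.
apply: cvgM; last by apply: cvg_exprn; exact: position_log_cvg.
apply: cvgMr_tmp; apply: cvgV; first by rewrite gt_eqF// invr_gt0.
exact: position_ratio_cvg.
Unshelve. all: by end_near. Qed.

End Inversion.

Section Stolz.
Context {R : realType}.
Implicit Types (S B : nat -> R) (l : R).

(** Increments of [S - l * B] are eventually dominated by those of [B]. *)
Lemma stolz_cesaro S B l : (\forall n \near \oo, B n < B n.+1) ->
  B n @[n --> \oo] --> +oo ->
  (S n.+1 - S n) / (B n.+1 - B n) @[n --> \oo] --> l -> S n / B n @[n --> \oo] --> l.
Proof.
move=> [N1 _ Bi] By /cvgrPdist_le Sl; apply/cvgrPdist_le => e e0.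
have [N2 _ hS] := Sl (e / 2) (divr_gt0 e0 (ltr0Sn _ 1)).
pose N := maxn N1 N2; pose C := `|S N - l * B N| + e / 2 * `|B N|.
have C0 : 0 <= C by rewrite addr_ge0// mulr_ge0// divr_ge0// ltW.
have key n : (N <= n)%N -> `|S n - l * B n| <= C + e / 2 * B n.
  move=> /subnKC <-; elim: (n - N)%N => [|k IH].
    rewrite addn0 /C -addrA lerDl -mulrDr mulr_ge0 ?divr_ge0 ?(ltW e0)//.
    by rewrite -lerBlDr sub0r ler_normr lexx orbT.
  set j := (N + k)%N in IH *; rewrite addnS -/j.
  have Nj : (N <= j)%N := leq_addr _ _.
  have dB : 0 < B j.+1 - B j.
    by rewrite subr_gt0; apply: Bi => /=; apply: leq_trans Nj; exact: leq_maxl.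
  have dS : `|l - (S j.+1 - S j) / (B j.+1 - B j)| <= e / 2.
    by apply: hS => /=; apply: leq_trans Nj; exact: leq_maxr.
  have -> : S j.+1 - l * B j.+1 = (S j - l * B j) -
      (l - (S j.+1 - S j) / (B j.+1 - B j)) * (B j.+1 - B j).
    by field; rewrite gt_eqF.
  apply: (le_trans (ler_normB _ _)).
  have -> : C + e / 2 * B j.+1 = (C + e / 2 * B j) + e / 2 * (B j.+1 - B j) by ring.
  by rewrite lerD// normrM (gtr0_norm dB) ler_wpM2r// ltW.
move/cvgryPge : By => By; near=> n.
have Bn : 1 + 2 * C / e <= B n by near: n; exact: By.
have B0 : 0 < B n by apply: lt_le_trans Bn; rewrite ltr_pwDl// divr_ge0 ?mulr_ge0// ltW.
have -> : l - S n / B n = - ((S n - l * B n) / B n) by field; rewrite gt_eqF.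
rewrite normrN normrM normfV (gtr0_norm B0) ler_pdivrMr//.
apply: (le_trans (key n _)); first by near: n; exact: nbhs_infty_ge.
have CB : C <= e / 2 * B n.
  rewrite mulrAC ler_pdivlMr// -ler_pdivrMl// mulrC [C * 2]mulrC.
  by apply: le_trans Bn; rewrite lerDr ler01.
by rewrite -[leRHS]/(e * B n) [e in leRHS]splitr mulrDl lerD.
Unshelve. all: by end_near. Qed.

End Stolz.

Section PowerSums.
Context {R : realType} (M q : nat).

Lemma cvg_nat_ln : ln n%:R @[n --> \oo] --> (+oo : set_system R).
Proof. by apply: cvg_ln_pinfty; exact: cvgr_idn. Qed.

Lemma cvg_nat_ln_inv : (ln n%:R)^-1 @[n --> \oo] --> (0 : R).
Proof. by apply: cvg_pinfty_inv; exact: cvg_nat_ln. Qed.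

Lemma cvg_nat_inv : (n%:R)^-1 @[n --> \oo] --> (0 : R).
Proof. by apply: cvg_pinfty_inv; exact: cvgr_idn. Qed.

Definition gauge (n : nat) : R := n%:R ^+ M.+1 / ln n%:R ^+ q.

Lemma gauge_infty : gauge n @[n --> \oo] --> +oo.
Proof.
apply/cvgryPge => A; near=> n.
have n1 : 1 < n%:R :> R by rewrite ltr1n; near: n; exact: nbhs_infty_gt.
have n0 : 0 < n%:R :> R by exact: lt_trans n1.
have l0 : 0 < ln n%:R :> R by rewrite ln_gt0.
have f0 : 0 < q.+1`!%:R :> R by rewrite ltr0n fact_gt0.
have h : ln n%:R ^+ q.+1 / q.+1`!%:R <= n%:R :> R.
  have := expR_ge1Dxn q (ltW l0); rewrite lnK ?posrE// => h.
  by apply: le_trans h; rewrite lerDr ler01.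
apply: (@le_trans _ _ (ln n%:R / q.+1`!%:R)).
  by rewrite ler_pdivlMr//; near: n; move/cvgryPge : cvg_nat_ln; exact.
rewrite /gauge ler_pdivlMr ?exprn_gt0// mulrAC -exprS (le_trans h)//.
by rewrite exprS ler_peMr ?(ltW n0)// exprn_ege1// ltW.
Unshelve. all: by end_near. Qed.

Lemma log_ratio_step : n%:R * (1 - ln n%:R / ln n.+1%:R) @[n --> \oo] --> (0 : R).
Proof.
have lS : (ln n.+1%:R)^-1 @[n --> \oo] --> (0 : R).
  have := cvg_nat_ln_inv; rewrite -(cvg_shiftn 1) /=.
  by under eq_fun do rewrite addn1.
apply: (squeeze_cvgr (f := fun=> 0) (h := fun n => (ln n.+1%:R)^-1)) => //; last exact: cvg_cst.
near=> n; have n1 : (1 < n)%N by near: n; exact: nbhs_infty_gt.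
have l0 : 0 < ln n.+1%:R :> R by rewrite ln_gt0// ltr1n ltnS ltnW.
have ll : ln n%:R <= ln n.+1%:R :> R by rewrite ler_ln ?posrE ?ltr0n ?ler_nat// ltnW.
have -> : 1 - ln n%:R / ln n.+1%:R = (ln n.+1%:R - ln n%:R) / ln n.+1%:R :> R.
  by field; rewrite gt_eqF.
rewrite mulrA; apply/andP; split.
  by rewrite divr_ge0 ?mulr_ge0 ?subr_ge0// ltW.
rewrite ler_pdivrMr// mulVf ?gt_eqF//.
have := @ln_step_le R n.-1; rewrite prednK ?(ltnW n1)// => h.
by rewrite mulrC -ler_pdivlMr ?ltr0n ?(ltnW n1)// mul1r.
Unshelve. all: by end_near. Qed.

(** The logarithm varies too slowly to contribute: only the increment of the power
    matters. *)
Lemma gauge_step :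
  (gauge n.+1 - gauge n) / (n%:R ^+ M / ln n%:R ^+ q) @[n --> \oo] --> (M.+1%:R : R).
Proof.
pose rho n : R := ln n%:R / ln n.+1%:R.
pose P n : R := n%:R * ((1 + n%:R^-1) ^+ M.+1 - 1).
have step0 : n%:R * (1 - rho n) @[n --> \oo] --> (0 : R) := log_ratio_step.
have rho1 : rho n @[n --> \oo] --> (1 : R).
  apply: (@cvg_near_eq _ (fun n => 1 - n%:R^-1 * (n%:R * (1 - rho n)))).
    near=> n; have n0 : (0 < n)%N by near: n; exact: nbhs_infty_gt.
    by field; rewrite pnatr_eq0 -lt0n.
  rewrite [X in _ --> X](_ : 1 = 1 - 0 * 0); last by rewrite mulr0 subr0.
  by apply: cvgB; [exact: cvg_cst|apply: cvgM => //; exact: cvg_nat_inv].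
have rhole : \forall n \near \oo, 0 <= rho n <= 1.
  near=> n; have n1 : (1 < n)%N by near: n; exact: nbhs_infty_gt.
  have l0 : 0 < ln n.+1%:R :> R by rewrite ln_gt0// ltr1n ltnS ltnW.
  rewrite divr_ge0 ?ln_ge0 ?ler1n ?(ltnW n1)//= ler_pdivrMr// mul1r.
  by rewrite ler_ln ?posrE ?ltr0n ?ler_nat// ltnW.
have P1 : P n @[n --> \oo] --> (M.+1%:R : R).
  apply: (squeeze_cvgr (f := fun=> M.+1%:R) (h := fun n => M.+1%:R * (1 + n%:R^-1) ^+ M)).
  - near=> n; have n0 : 0 < n%:R :> R by rewrite ltr0n; near: n; exact: nbhs_infty_gt.
    have h : 0 <= (1 : R) <= 1 + n%:R^-1 by rewrite ler01 lerDl invr_ge0 ltW.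
    have h1 := powS_diff_ge M h; have h2 := powS_diff_le M h.
    rewrite !expr1n mulr1 addrAC subrr add0r in h1; rewrite expr1n addrAC subrr add0r in h2.
    apply/andP; split.
      by have := ler_wpM2l (ltW n0) h1; rewrite mulVKf ?gt_eqF//.
    by have := ler_wpM2l (ltW n0) h2; rewrite mulVKf ?gt_eqF//.
  - exact: cvg_cst.
  - rewrite -[X in _ --> X]mulr1; apply: cvgMl_tmp.
    rewrite [X in _ --> X](_ : 1 = (1 + 0) ^+ M); last by rewrite addr0 expr1n.
    by apply: cvg_exprn; apply: cvgD; [exact: cvg_cst|exact: cvg_nat_inv].
have rhoq : n%:R * (1 - rho n ^+ q) @[n --> \oo] --> (0 : R).
  apply: (squeeze_cvgr (f := fun=> 0) (h := fun n => q%:R * (n%:R * (1 - rho n)))).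
  - near=> n; have /andP[r0 r1] : 0 <= rho n <= 1 by near: n; exact: rhole.
    rewrite mulr_ge0 ?subr_ge0 ?exprn_ile1//= [leRHS]mulrCA ler_wpM2l//.
    case: (q) => [|j]; first by rewrite expr0 subrr mul0r.
    have := @powS_diff_le R 1 (rho n) j; rewrite r0 r1 !expr1n mulr1 => /(_ isT) h.
    by rewrite mulrC.
  - exact: cvg_cst.
  - by rewrite -(mulr0 q%:R); apply: cvgMl_tmp.
apply: (@cvg_near_eq _ (fun n => P n * rho n ^+ q - n%:R * (1 - rho n ^+ q))).
  near=> n; have n1 : (1 < n)%N by near: n; exact: nbhs_infty_gt.
  have n0 : 0 < n%:R :> R by rewrite ltr0n ltnW.
  have l0 : 0 < ln n%:R :> R by rewrite ln_gt0// ltr1n.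
  have l1 : 0 < ln n.+1%:R :> R by rewrite ln_gt0// ltr1n ltnS ltnW.
  have e1 : n.+1%:R = n%:R * (1 + n%:R^-1) :> R.
    by rewrite mulrDr mulr1 divff ?gt_eqF// -natr1.
  rewrite /gauge /P /rho expr_div_n [X in X ^+ M.+1 / _]e1 exprMn.
  have x1 : 0 < ln n%:R ^+ q :> R by rewrite exprn_gt0.
  have x2 : 0 < ln n.+1%:R ^+ q :> R by rewrite exprn_gt0.
  move: (ln n%:R ^+ q) (ln n.+1%:R ^+ q) ((1 + n%:R^-1) ^+ M.+1) x1 x2 => a b c a0 b0.
  have nM : 0 < n%:R ^+ M :> R by rewrite exprn_gt0.
  by rewrite exprS; field; rewrite !gt_eqF.
rewrite [X in _ --> X](_ : _ = M.+1%:R * 1 - 0); last by rewrite mulr1 subr0.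
apply: cvgB => //; apply: cvgM => //.
by rewrite -(expr1n R q); exact: cvg_exprn.
Unshelve. all: by end_near. Qed.

End PowerSums.

Section MultiplierAsymptotics.
Context {R : realType} (D m : nat).
Hypothesis m_gt0 : (0 < m)%N.
Local Notation position t n :=
  (2 ^ D.+1 * hcount D.+1 t.-1 <= n <= 2 ^ D.+1 * hcount D.+1 t)%N.
Local Notation kappa := (@kappa R D).
Local Notation rate n := (n%:R ^- m * ln n%:R ^+ (m * D) : R).
Local Notation gauge := (@gauge R (2 * m) (2 * (m * D))).

Let kappa_neq0 : kappa != 0. Proof. by rewrite gt_eqF// kappa_gt0. Qed.

Lemma power_asymptotics (t : nat -> nat) j : t n @[n --> \oo] --> \oo ->
  (\forall n \near \oo, position (t n) n) ->
  (t n)%:R ^+ j * (n%:R ^- j * ln n%:R ^+ (j * D)) @[n --> \oo] --> (kappa ^- j : R).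
Proof.
move=> ty tp; rewrite -exprVn.
apply: (@cvg_near_eq _ (fun n => ((t n)%:R * ln n%:R ^+ D / n%:R) ^+ j)).
  by near=> n; rewrite !exprMn exprVn mulnC exprM mulrA mulrAC.
by apply: cvg_exprn; exact: product_asymptotics.
Unshelve. all: by end_near. Qed.

Lemma multiplier_asymptotics (t : nat -> nat) : t n @[n --> \oo] --> \oo ->
  (\forall n \near \oo, position (t n) n) ->
  (t n)%:R ^- m * (rate n)^-1 @[n --> \oo] --> (kappa ^+ m : R).
Proof.
move=> ty tp; rewrite -[kappa ^+ m]invrK.
apply: (@cvg_near_eq _ (fun n => ((t n)%:R ^+ m * rate n)^-1)).
  by near=> n; rewrite invfM.
apply: cvgV; first by rewrite invr_neq0// expf_neq0.
exact: power_asymptotics.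
Unshelve. all: by end_near. Qed.

Section Sums.
Variable t : nat -> nat.
Hypothesis t_infty : t n @[n --> \oo] --> \oo.
Hypothesis t_position : \forall n \near \oo, position (t n) n.

Let S n : R := \sum_(i < n) (t i)%:R ^+ (2 * m).

Lemma sum_asymptotics :
  S n / gauge n @[n --> \oo] --> (kappa ^- (2 * m) / (2 * m).+1%:R : R).
Proof.
have gs := @gauge_step R (2 * m) (2 * (m * D)).
have nz : (2 * m).+1%:R != 0 :> R by rewrite pnatr_eq0.
have pos : \forall n \near \oo, 0 < n%:R ^+ (2 * m) / ln n%:R ^+ (2 * (m * D)) :> R.
  near=> n; have n1 : (1 < n)%N by near: n; exact: nbhs_infty_gt.
  by rewrite divr_gt0// exprn_gt0 ?ltr0n ?(ltnW n1)// ln_gt0// ltr1n.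
have inc : \forall n \near \oo, gauge n < gauge n.+1.
  near=> n; rewrite -subr_gt0 -(pmulr_lgt0 _ (x := (n%:R ^+ (2 * m) / ln n%:R ^+ (2 * (m * D)))^-1)).
    by near: n; apply: cvgr_gt gs _ _; rewrite ltr0n.
  by rewrite invr_gt0; near: n; exact: pos.
apply: stolz_cesaro => //; first exact: gauge_infty.
apply: (@cvg_near_eq _ (fun n => ((t n)%:R ^+ (2 * m) * (n%:R ^- (2 * m) * ln n%:R ^+ (2 * m * D)))
  / ((gauge n.+1 - gauge n) / (n%:R ^+ (2 * m) / ln n%:R ^+ (2 * (m * D)))))).
  near=> n; have n1 : (1 < n)%N by near: n; exact: nbhs_infty_gt.
  have g0 : 0 < gauge n.+1 - gauge n by rewrite subr_gt0; near: n; exact: inc.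
  have -> : S n.+1 - S n = (t n)%:R ^+ (2 * m) by rewrite /S big_ord_recr/= addrAC subrr add0r.
  have a0 : 0 < n%:R ^+ (2 * m) :> R by rewrite exprn_gt0// ltr0n ltnW.
  have b0 : 0 < ln n%:R ^+ (2 * (m * D)) :> R by rewrite exprn_gt0// ln_gt0// ltr1n.
  rewrite -(mulnA 2%N m D).
  move: (gauge n.+1 - gauge n) (n%:R ^+ (2 * m)) (ln n%:R ^+ _) g0 a0 b0 => g a b g0 a0 b0.
  by field; rewrite !gt_eqF.
apply: cvgM; first exact: power_asymptotics.
by apply: cvgV.
Unshelve. all: by end_near. Qed.

Lemma inverse_root_asymptotics :
  (Num.sqrt (S n))^-1 / (n%:R `^ (- m%:R - 2^-1) * ln n%:R ^+ (m * D)) @[n --> \oo] -->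
  (Num.sqrt (2 * m%:R + 1) * kappa ^+ m : R).
Proof.
have k0 : 0 < kappa ^+ m by rewrite exprn_gt0// kappa_gt0.
have k2 : kappa ^+ (2 * m) = (kappa ^+ m) ^+ 2 by rewrite mulnC exprM.
have mE : 2 * m%:R + 1 = (2 * m).+1%:R :> R by rewrite -[(2 * m).+1%:R]natr1 natrM.
apply: (@cvg_near_eq _ (fun n => (Num.sqrt (S n / gauge n))^-1)).
  near=> n; have n1 : (1 < n)%N by near: n; exact: nbhs_infty_gt.
  have n0 : 0 < n%:R :> R by rewrite ltr0n ltnW.
  have l0 : 0 < ln n%:R ^+ (m * D) :> R by rewrite exprn_gt0// ln_gt0// ltr1n.
  have S0 : 0 <= S n by apply: sumr_ge0 => i _; rewrite exprn_ge0.
  rewrite sqrtrM// sqrtrV; last by rewrite divr_ge0 ?exprn_ge0 ?ln_ge0 ?ler1n ?(ltnW n1).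
  rewrite invfM invrK; congr (_ * _).
  have -> : n%:R `^ (- m%:R - 2^-1) = (n%:R ^+ m * Num.sqrt n%:R)^-1 :> R.
    rewrite -opprD powRN powRD ?gt_eqF ?implybT// powR_mulrn ?(ltW n0)//.
    by rewrite powR12_sqrt// ltW.
  have -> : gauge n = (n%:R ^+ m / ln n%:R ^+ (m * D)) ^+ 2 * n%:R.
    rewrite /gauge exprS expr_div_n [(2 * m)%N]mulnC [(2 * (m * D))%N]mulnC !exprM.
    by rewrite -mulrA mulrC.
  have lp : 0 <= ln n%:R :> R by rewrite ln_ge0// ler1n ltnW.
  rewrite sqrtrM ?sqr_ge0// sqrtr_sqr ger0_norm ?divr_ge0 ?exprn_ge0 ?(ltW l0) ?(ltW n0)//.
  by rewrite invfM invrK mulrAC.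
rewrite [X in _ --> X](_ : _ = (Num.sqrt (kappa ^- (2 * m) / (2 * m).+1%:R))^-1); last first.
  rewrite sqrtrM ?invr_ge0 ?k2 ?sqr_ge0// !sqrtrV// ?sqr_ge0//.
  by rewrite sqrtr_sqr (gtr0_norm k0) invfM !invrK mE mulrC.
apply: cvgV; last by apply: cvg_sqrt; exact: sum_asymptotics.
by rewrite gt_eqF// sqrtr_gt0 divr_gt0// invr_gt0 exprn_gt0// kappa_gt0.
Unshelve. all: by end_near. Qed.

(** With [N] about [beta n] the square of [lower_width] is asymptotically proportional to
    [(beta - 1) / beta^(2m+1)], which is largest at [beta = (2m+1)/(2m)]. *)
Definition optimal_index n : nat := ((2 * m).+1 * n %/ (2 * m))%N.

Lemma optimal_index_ge n : (n <= optimal_index n)%N.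
Proof. by rewrite leq_divRL ?muln_gt0// mulnC leq_mul2r leqnSn orbT. Qed.

Let beta : R := (2 * m).+1%:R / (2 * m)%:R.

Let m2_gt0 : 0 < (2 * m)%:R :> R.
Proof. by rewrite ltr0n muln_gt0. Qed.

Let beta_gt0 : 0 < beta.
Proof. by rewrite divr_gt0. Qed.

Lemma optimal_index_ratio : (optimal_index n)%:R / n%:R @[n --> \oo] --> beta.
Proof.
apply: (squeeze_cvgr (f := fun n => beta - n%:R^-1) (h := fun=> beta)).
- near=> n; have n0 : 0 < n%:R :> R by rewrite ltr0n; near: n; exact: nbhs_infty_gt.
  rewrite ler_pdivlMr// ler_pdivrMr// mulrBl mulVf ?gt_eqF//; apply/andP; split.
    rewrite lerBlDr /beta mulrAC ler_pdivrMr// natr1 -!natrM ler_nat ltnW//.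
    by rewrite ltn_ceil// muln_gt0.
  by rewrite /beta mulrAC ler_pdivlMr// -!natrM ler_nat leq_trunc_div.
- rewrite [X in _ --> X](_ : _ = beta - 0); last by rewrite subr0.
  by apply: cvgB; [exact: cvg_cst|exact: cvg_nat_inv].
- exact: cvg_cst.
Unshelve. all: by end_near. Qed.

Lemma optimal_index_infty : optimal_index n @[n --> \oo] --> \oo.
Proof.
apply/cvgnyPge => A; near=> n; apply: leq_trans (optimal_index_ge n).
near: n; exact: nbhs_infty_ge.
Unshelve. all: by end_near. Qed.

Lemma width_asymptotics :
  Num.sqrt (((optimal_index n)%:R - n%:R) / S (optimal_index n)) / rate n
    @[n --> \oo] --> ((2 * m%:R / (2 * m%:R + 1)) ^+ m * kappa ^+ m : R).
Proof.
pose N := optimal_index.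
have bE : 2 * m%:R / (2 * m%:R + 1) = beta^-1 :> R.
  by rewrite /beta invf_div -[(2 * m).+1%:R]natr1 natrM.
have rat := optimal_index_ratio.
have lnr : ln (N n)%:R / ln n%:R @[n --> \oo] --> (1 : R).
  apply: (@cvg_near_eq _ (fun n => ln ((N n)%:R / n%:R) / ln n%:R + 1)).
    near=> n; have n1 : (1 < n)%N by near: n; exact: nbhs_infty_gt.
    have l0 : 0 < ln n%:R :> R by rewrite ln_gt0// ltr1n.
    have N0 : 0 < (N n)%:R :> R.
      by rewrite ltr0n (leq_trans _ (optimal_index_ge n))// ltnW.
    rewrite ln_div ?posrE ?ltr0n ?(ltnW n1)//; last by rewrite -(ltr0n R).
    by field; rewrite gt_eqF.
  rewrite [X in _ --> X](_ : 1 = ln beta * 0 + 1); last by rewrite mulr0 add0r.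
  apply: cvgD; last exact: cvg_cst.
  by apply: cvgM; [exact: cvg_ln|exact: cvg_nat_ln_inv].
have SN : S (N n) / gauge (N n) @[n --> \oo] --> (kappa ^- (2 * m) / (2 * m).+1%:R : R).
  exact: (cvg_comp _ _ optimal_index_infty sum_asymptotics).
apply: (@cvg_near_eq _ (fun n => Num.sqrt (((N n)%:R / n%:R - 1) * (S (N n) / gauge (N n))^-1 *
   ((N n)%:R / n%:R) ^- (2 * m).+1 * (ln (N n)%:R / ln n%:R) ^+ (2 * (m * D))))).
  near=> n; have n1 : (1 < n)%N by near: n; exact: nbhs_infty_gt.
  have n0 : 0 < n%:R :> R by rewrite ltr0n ltnW.
  have Nn := optimal_index_ge n.
  have N1 : (1 < N n)%N := leq_trans n1 Nn.
  have N0 : 0 < (N n)%:R :> R by rewrite ltr0n ltnW.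
  have l0 : 0 < ln n%:R :> R by rewrite ln_gt0// ltr1n.
  have l1 : 0 < ln (N n)%:R :> R by rewrite ln_gt0// ltr1n.
  have S0 : 0 <= S (N n) by apply: sumr_ge0 => i _; rewrite exprn_ge0.
  have rate0 : 0 <= (rate n)^-1.
    by rewrite invr_ge0 mulr_ge0 ?invr_ge0 ?exprn_ge0 ?(ltW l0).
  rewrite -[X in _ = _ * X](ger0_norm rate0) -sqrtr_sqr -sqrtrM; last first.
    by rewrite divr_ge0// subr_ge0 ler_nat.
  have sq (x : R) i : x ^+ (2 * i) = (x ^+ i) ^+ 2 by rewrite mulnC exprM.
  congr Num.sqrt; rewrite invf_div /gauge !expr_div_n !exprS !sq.
  have a0 : 0 < n%:R ^+ m :> R by rewrite exprn_gt0.
  have b0 : 0 < (N n)%:R ^+ m :> R by rewrite exprn_gt0.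
  have c0 : 0 < ln n%:R ^+ (m * D) :> R by rewrite exprn_gt0.
  have d0 : 0 < ln (N n)%:R ^+ (m * D) :> R by rewrite exprn_gt0.
  move: (S (N n))^-1 (n%:R ^+ m) ((N n)%:R ^+ m) (ln n%:R ^+ (m * D))
    (ln (N n)%:R ^+ (m * D)) a0 b0 c0 d0 => si a b c d a0 b0 c0 d0.
  by field; rewrite !gt_eqF.
have k0 : 0 < kappa ^+ m by rewrite exprn_gt0// kappa_gt0.
have bm0 : 0 < beta ^+ m by rewrite exprn_gt0.
have sq (x : R) i : x ^+ (2 * i) = (x ^+ i) ^+ 2 by rewrite mulnC exprM.
rewrite [X in _ --> X](_ : _ = Num.sqrt ((beta - 1) * (kappa ^- (2 * m) / (2 * m).+1%:R)^-1 *
  beta ^- (2 * m).+1 * 1 ^+ (2 * (m * D)))); last first.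
  rewrite bE expr1n mulr1.
  have h0 : 0 <= beta^-1 ^+ m * kappa ^+ m.
    by rewrite mulr_ge0 ?(ltW k0)// exprVn invr_ge0 ltW.
  rewrite -[LHS](ger0_norm h0) -sqrtr_sqr; congr Num.sqrt.
  rewrite exprVn [beta ^+ (2 * m).+1]exprS !sq.
  have -> : beta - 1 = ((2 * m)%:R)^-1.
    by rewrite /beta -[(2 * m).+1%:R]natr1 mulrDl divff ?gt_eqF// mul1r addrAC subrr add0r.
  have e1 : (2 * m).+1%:R = beta * (2 * m)%:R by rewrite /beta divfK// gt_eqF.
  have alg (be M a b : R) : be != 0 -> M != 0 -> a != 0 -> b != 0 ->
      (a^-1 * b) ^+ 2 = M^-1 * (b ^- 2 / (be * M))^-1 / (be * a ^+ 2).
    by move=> be0 M0 a0 b0; field; rewrite be0 M0 a0 b0.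
  by rewrite e1; apply: alg; rewrite gt_eqF.
apply: cvg_sqrt; apply: cvgM; last by apply: cvg_exprn.
apply: cvgM; last first.
  apply: cvgV; first by rewrite expf_neq0// gt_eqF.
  by apply: cvg_exprn.
apply: cvgM; first by apply: cvgB => //; exact: cvg_cst.
apply: cvgV => //.
by rewrite gt_eqF// divr_gt0// invr_gt0 exprn_gt0// kappa_gt0.
Unshelve. all: by end_near. Qed.

End Sums.

End MultiplierAsymptotics.

(** * Values and limits of the s-numbers *)

Section Assembly.
Context {R : realType} (d m : nat).
Hypothesis m_gt0 : (0 < m)%N.
Local Notation nX := (@normSW R d m).
Local Notation nY := (@norm_L2 R d).
Local Notation Id := (@SW_id R d m).

Lemma omega_absprod (k : d.-tuple int) : omega (R := R) m k = (absprod k)%:R ^+ m.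
Proof.
rewrite /omega /absprod natr_prod -prodrXl; apply: eq_bigr => j _.
by rewrite natr_absz intr_norm.
Qed.

Definition ordered_enumeration (E : nat -> d.-tuple int) : Prop :=
  [/\ injective E, forall i, nonzero_freq (E i),
      forall k, nonzero_freq k -> exists i, E i = k &
      forall i j, (i <= j)%N -> omega (R := R) m (E i) <= omega m (E j)].

(** Only finitely many frequencies lie in a hyperbolic cross. *)
Lemma enumeration_unbounded E : ordered_enumeration E ->
  forall B : R, exists i, B <= omega m (E i).
Proof.
move=> [E_inj E_nz _ _] B; apply/not_existsP => hB.
pose t := Num.bound `|B|.
have Et i : E i \in cross d t.
  apply/mem_cross; split; first exact: E_nz.
  have p0 := absprod_gt0 (E_nz i).
  rewrite leqNgt; apply/negP => tE; apply: (hB i).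
  rewrite omega_absprod (le_trans (le_trans (ler_norm B) (ltW (archi_boundP (normr_ge0 B)))))//.
  apply: (@le_trans _ _ (absprod (E i))%:R); first by rewrite ler_nat ltnW.
  by rewrite ler_eXnr// ler1n.
have := @uniq_leq_size _ [seq E i | i <- iota 0 (size (cross d t)).+1] (cross d t).
rewrite map_inj_uniq// iota_uniq size_map size_iota ltnn => /(_ isT).
by move=> h; suff: false by []; apply: h => _ /mapP[i _ ->].
Qed.

Lemma bernstein_weyl_value E (v : nat -> \bar R) n : ordered_enumeration E ->
  v = bernstein_number nX nY Id \/ v = weyl_number nX nY Id -> (0 < n)%N ->
  v n = ((Num.sqrt (Ssum m E n))^-1)%:E.
Proof.
move=> oE hv n0; have Eu := enumeration_unbounded oE; case: oE => Ei En Es Em.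
apply/eqP; rewrite eq_le; case: hv => ->; apply/andP; split.
- exact: bernstein_upper.
- exact: bernstein_lower.
- exact: weyl_upper.
- exact: weyl_lower.
Qed.

Lemma rearrangement_enumeration (sigma : nat -> R) :
  nonincreasing_rearrangement d m sigma -> exists2 E, ordered_enumeration E &
    forall i, sigma i.+1 = (omega m (E i))^-1.
Proof.
move=> [sm [e [[e_nz e_inj e_surj] se]]]; exists (fun i => e i.+1).
  have nz i : nonzero_freq (e i.+1) by apply: e_nz.
  split=> //.
  - by move=> i j ij; have [] : i.+1 = j.+1 by apply: e_inj; rewrite ?inE.
  - by move=> k /e_surj[[|i] // _ <-]; exists i.
  - move=> i j ij; have := sm i.+1 j.+1 isT ij.
    by rewrite !se// lef_pV2 ?posrE ?omega_gt0.
by move=> i; rewrite se.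
Qed.

Lemma bernstein_weyl_formula (v : nat -> \bar R) (sigma : nat -> R) n :
  v = bernstein_number nX nY Id \/ v = weyl_number nX nY Id ->
  nonincreasing_rearrangement d m sigma -> (0 < n)%N ->
  v n = ((\sum_(1 <= k < n.+1) sigma k ^- 2) `^ (- 2^-1))%:E.
Proof.
move=> hv /rearrangement_enumeration[E oE sE] n0.
rewrite (bernstein_weyl_value oE hv n0) big_add1 big_mkord /=.
have -> : \sum_(i < n) sigma i.+1 ^- 2 = Ssum m E n.
  by apply: eq_bigr => i _; rewrite sE exprVn invrK.
rewrite powRN powR12_sqrt//.
by apply: sumr_ge0 => i _; rewrite sqr_ge0.
Qed.

End Assembly.

Section Limits.
Context {R : realType} (D m : nat).
Hypothesis m_gt0 : (0 < m)%N.
Local Notation d := D.+1.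
Local Notation nX := (@normSW R d m).
Local Notation nY := (@norm_L2 R d).
Local Notation Id := (@SW_id R d m).
Local Notation position t n :=
  (2 ^ D.+1 * hcount D.+1 t.-1 <= n <= 2 ^ D.+1 * hcount D.+1 t)%N.
Local Notation rate n := (n%:R ^- m * ln n%:R ^+ (m * D) : R).

Variable E : nat -> d.-tuple int.
Hypothesis E_inj : injective E.
Hypothesis E_nz : forall i, nonzero_freq (E i).
Hypothesis E_surj : forall k, nonzero_freq k -> exists i, E i = k.
Hypothesis E_count : forall i t, (absprod (E i) <= t)%N = (i < 2 ^ d * hcount d t)%N.

Lemma counted_enumeration_ordered : ordered_enumeration (R := R) m E.
Proof.
split=> // i j ij; rewrite !omega_absprod lerXn2r ?nnegrE// ler_nat E_count.
by rewrite (leq_ltn_trans ij)// -E_count.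
Qed.

Let t n := absprod (E n).

Let t_infty : t n @[n --> \oo] --> \oo.
Proof.
apply/cvgnyPge => A; exists (2 ^ d * hcount d A)%N => // n /= hn.
by rewrite leqNgt; apply/negP => /ltnW; rewrite E_count ltnNge hn.
Qed.

Let t_position n : position (t n) n.
Proof.
have p0 := absprod_gt0 (E_nz n); apply/andP; split; last by rewrite ltnW// -E_count.
by rewrite leqNgt -E_count -ltnNge /t prednK.
Qed.

Let t_position_near : \forall n \near \oo, position (t n) n.
Proof. by exists 0%N => // n _; exact: t_position. Qed.

Let t_pred_infty : t n.-1 @[n --> \oo] --> \oo.
Proof.
apply/cvgnyPge => A; have /cvgnyPge/(_ A) [N _ hN] := t_infty.
by exists N.+1 => // n /= Nn; apply: hN => /=; case: n Nn.
Qed.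

Let t_pred_position n : (0 < n)%N -> position (t n.-1) n.
Proof.
move=> n0; have /andP[h _] := t_position n.-1; rewrite (leq_trans h (leq_pred n))/=.
by rewrite -{1}(prednK n0) -E_count.
Qed.

Lemma bernstein_weyl_limit (v : nat -> \bar R) :
  v = bernstein_number nX nY Id \/ v = weyl_number nX nY Id ->
  ((v n * ((n%:R `^ (- m%:R - 2^-1) * ln n%:R ^+ (m * D))^-1)%:E)%E
     @[n --> \oo] --> (Num.sqrt (2 * m%:R + 1) * kappa D ^+ m)%:E).
Proof.
move=> hv; have vE n : (0 < n)%N -> v n = ((Num.sqrt (Ssum m E n))^-1)%:E.
  exact: bernstein_weyl_value counted_enumeration_ordered hv.
have SE n : Ssum m E n = \sum_(i < n) (t i)%:R ^+ (2 * m) :> R.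
  by apply: eq_bigr => i _; rewrite /tau omega_absprod mulnC exprM.
have h := @inverse_root_asymptotics R D m t t_infty t_position_near.
apply: cvg_EFin.
  by near=> n; rewrite vE//; near: n; exact: nbhs_infty_gt.
apply: cvg_near_eq h; near=> n.
by rewrite /= vE ?SE//; near: n; exact: nbhs_infty_gt.
Unshelve. all: by end_near. Qed.

Lemma approximation_kolmogorov_bounds (u : nat -> \bar R) n :
  u = approximation_number nX nY Id \/ u = kolmogorov_number nX nY Id -> (0 < n)%N ->
  (((Num.sqrt (((optimal_index m n)%:R - n%:R) / Ssum m E (optimal_index m n)))%:E <= u n) /\
   (u n <= ((t n.-1)%:R ^- m)%:E))%E.
Proof.
move=> hu n0; have oE := counted_enumeration_ordered.
have Eu := enumeration_unbounded m_gt0 oE; case: oE => Ei En Es Em.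
pose N := optimal_index m n; have nN : (n <= N)%N by exact: (optimal_index_ge m_gt0).
split.
  apply: (@le_trans _ _ (lower_width m E N n.-1)%:E).
    rewrite lee_fin ler_wsqrtr// ler_wpM2r//.
      by rewrite invr_ge0 sumr_ge0// => i _; rewrite sqr_ge0.
    by rewrite lerD2l lerN2 ler_nat leq_pred.
  by case: hu => ->; [exact: approximation_lower|exact: kolmogorov_lower].
have -> : (t n.-1)%:R ^- m = sig m E n.-1 :> R by rewrite /sig omega_absprod.
by case: hu => ->; [exact: approximation_upper|exact: kolmogorov_upper].
Qed.

Lemma approximation_kolmogorov_limit (u : nat -> \bar R) (eps : R) :
  u = approximation_number nX nY Id \/ u = kolmogorov_number nX nY Id -> 0 < eps ->
  exists n0 : nat, forall n : nat, (n0 <= n)%N ->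
    ((((2 * m%:R / (2 * m%:R + 1)) ^+ m * kappa D ^+ m - eps)%:E <= u n * ((rate n)^-1)%:E) /\
     (u n * ((rate n)^-1)%:E <= (kappa D ^+ m + eps)%:E))%E.
Proof.
move=> hu e0.
have SE n : Ssum m E n = \sum_(i < n) (t i)%:R ^+ (2 * m) :> R.
  by apply: eq_bigr => i _; rewrite /tau omega_absprod mulnC exprM.
have low := @width_asymptotics R D m m_gt0 t t_infty t_position_near.
have tpp : \forall n \near \oo, position (t n.-1) n by exists 1%N => // n; exact: t_pred_position.
have up := @multiplier_asymptotics R D m (fun n => t n.-1) t_pred_infty tpp.
have lowE : \forall n \near \oo, (2 * m%:R / (2 * m%:R + 1)) ^+ m * kappa D ^+ m - eps <=
    Num.sqrt (((optimal_index m n)%:R - n%:R) / Ssum m E (optimal_index m n)) / rate n.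
  under eq_near do rewrite SE.
  by apply: cvgr_ge low _ _; rewrite ltrBlDr ltrDl.
have upE : \forall n \near \oo, (t n.-1)%:R ^- m / rate n <= kappa D ^+ m + eps.
  by apply: cvgr_le up _ _; rewrite ltrDl.
have : \forall n \near \oo, (((2 * m%:R / (2 * m%:R + 1)) ^+ m * kappa D ^+ m - eps)%:E <=
    u n * ((rate n)^-1)%:E)%E /\ (u n * ((rate n)^-1)%:E <= (kappa D ^+ m + eps)%:E)%E.
  near=> n; have n0 : (0 < n)%N by near: n; exact: nbhs_infty_gt.
  have [ul uu] := approximation_kolmogorov_bounds hu n0.
  have r0 : (0 <= ((rate n)^-1)%:E)%E.
    by rewrite lee_fin invr_ge0 mulr_ge0 ?invr_ge0 ?exprn_ge0// ln_ge0// ler1n.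
  split.
    apply: le_trans (lee_wpmul2r r0 ul); rewrite -EFinM lee_fin.
    by near: n.
  apply: (le_trans (lee_wpmul2r r0 uu)); rewrite -EFinM lee_fin.
  by near: n.
by move=> [n0 _ h]; exists n0 => n /h.
Unshelve. all: by end_near. Qed.

End Limits.

Theorem theorem4p11 (R : realType) (d m : nat) (d_gt0 : (0 < d)%N) (m_gt0 : (0 < m)%N) :
  let a := approximation_number (@normSW R d m) (@norm_L2 R d) (@SW_id R d m) in
  let d_ := kolmogorov_number (@normSW R d m) (@norm_L2 R d) (@SW_id R d m) in
  let x := weyl_number (@normSW R d m) (@norm_L2 R d) (@SW_id R d m) in
  let b := bernstein_number (@normSW R d m) (@norm_L2 R d) (@SW_id R d m) in
  let c : R := (2 ^+ d / (d.-1)`!%:R) ^+ m in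
  (forall v : nat -> \bar R, v = b \/ v = x ->
    (forall sigma : nat -> R, nonincreasing_rearrangement d m sigma ->
      forall n : nat, (0 < n)%N ->
        v n = ((\sum_(1 <= k < n.+1) sigma k ^- 2) `^ (- 2^-1))%:E) /\
    ((v n * ((n%:R `^ (- m%:R - 2^-1) * ln n%:R ^+ (m * d.-1))^-1)%:E)%E
        @[n --> \oo] --> (Num.sqrt (2 * m%:R + 1) * c)%:E)) /\
  (forall u : nat -> \bar R, u = a \/ u = d_ ->
    forall eps : R, 0 < eps ->
      exists n0 : nat, forall n : nat, (n0 <= n)%N ->
        ((((2 * m%:R / (2 * m%:R + 1)) ^+ m * c - eps)%:E <=
           u n * ((n%:R ^- m * ln n%:R ^+ (m * d.-1))^-1)%:E) /\
         (u n * ((n%:R ^- m * ln n%:R ^+ (m * d.-1))^-1)%:E <=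
           (c + eps)%:E))%E).
Proof.
have [E [E_inj E_nz E_surj E_count]] := enumeration_exists d_gt0.
case: d d_gt0 E E_inj E_nz E_surj E_count => // D _ E E_inj E_nz E_surj E_count a d_ x b c.
split=> [v hv|u hu eps eps0].
  split=> [sigma hsigma n n0|]; first exact: (bernstein_weyl_formula m_gt0 hv hsigma n0).
  exact: (bernstein_weyl_limit m_gt0 E_inj E_nz E_surj E_count).
exact: (approximation_kolmogorov_limit m_gt0 E_inj E_nz E_surj E_count).
Qed.
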